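(* Let $k\ge 4$, let $f_1,\dots,f_{k-1}$ be smooth nowhere vanishing functions on an open interval $I\ni x_0$, let $g(x,t)$ be a given function, and let $P(u)=\sum_{i=0}^{N}c_iu^i\in\mathbb{C}[u]$ with $c_N\ne0$, $N>1$. Let $j_1,\dots,j_{k''}\in\{1,\dots,k-1\}$ be distinct indices, $k''\le k-1$. Assume that for each $s$ the function $V_{j_s}$ satisfies the Liouville criterion and/or the integration-by-parts criterion, that the particular solution $\bar V_{k-1}$ satisfies the Liouville criterion and/or the integration-by-parts criterion (all defined in the context), and that the equation $P(u)-d=0$ (with $d$ a complex parameter) is solvable by radicals. Then the equation $$\partial_x f_{k-1}\partial_x f_{k-2}\partial_x\cdots\partial_x f_2\partial_x f_1\partial_x P(u)=g(x,t)$$ has solutions, elementary with respect to $x$, of the type $$u(x,t)=\alpha_{k'}\Big((c_i)_{i=0}^{N},\ \sum_{s=1}^{k''}A_{j_s}V_{j_s}(x,t)+B\,\bar V_{k-1}(x,t)\Big),$$ where $A_{j_s}$ and $B$ are complex constants.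
   Context: Homogeneous solutions: $f(t)$ is a given function of the parameter $t$. Put $R_{f_j}(x)=\int_{x_0}^x\frac{ds}{f_j(s)}$, $g_{j:j}=R_{f_j}$, $g_{i:j}(x)=\int_{x_0}^x\frac{g_{i+1:j}(s)}{f_i(s)}ds$ for $2\le i\le j-1$; $V_1(x,t)=f(t)R_{f_1}(x)$ and $V_j(x,t)=f(t)\int_{x_0}^x\frac{g_{2:j}(s)}{f_1(s)}ds$ for $2\le j\le k-1$. These solve the linear equation $\partial_x f_{k-1}\partial_x\cdots\partial_x f_1\partial_xV=0$. Write $g_{2:1}:=1$. Particular solution: $\bar V_{k-1}(x,t)=\int_{x_0}^x\frac{\bar g_{2}(s,t)}{f_1(s)}ds$, where $\bar g_i(x,t)$ ($2\le i\le k-2$), $\bar R(x,t)$, $G(x,t)$ are functions with $\partial_xG=g$, $f_{k-1}\partial_x\bar R=G$, $f_{k-2}\partial_x\bar g_{k-2}=\bar R$, $f_i\partial_x\bar g_i=\bar g_{i+1}$ for $2\le i\le k-3$; it solves $\partial_x f_{k-1}\partial_x\cdots\partial_x f_1\partial_xV=g(x,t)$. Criteria: for a function $\gamma(x)$, we say $\gamma$ satisfies the Liouville criterion if $\frac{\gamma(x)}{f_1(x)}=\sum_{i=1}^n c_i'\frac{h_i'(x)}{h_i(x)}+\sigma'(x)$ on $I$ for some $c_i'\in\mathbb{C}$ and elementary functions $h_i$ (nowhere zero on $I$) and $\sigma$; and $\gamma$ satisfies the integration-by-parts criterion if there exist elementary functions $\nu,S$ and a positive integer $p$ with $\nu^{(p+1)}=\frac1{f_1}$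 and $S'=\gamma^{(p+1)}\nu$. $V_j$ satisfies a criterion if $\gamma=g_{2:j}$ does; $\bar V_{k-1}$ satisfies a criterion if $\gamma=\bar g_2(\cdot,t)$ does for each fixed $t$. The functions $\alpha_{k'}((c_i)_{i=0}^{N},d)$ are the roots $u$ of $P(u)-d=0$ as functions of $d$, i.e. holomorphic branches on open sets $\Omega\subset\mathbb{C}$ with $P(\alpha_{k'}((c_i),d))=d$ for $d\in\Omega$. The functions $u(x,t)$ are considered, for each fixed $t$, on open subintervals of $I$ on which the second argument of $\alpha_{k'}$ takes values in $\Omega$. Elementary functions: one considers differential fields whose elements are complex-valued functions of the real variable $x$ on a suitable open interval with derivation $d/dx$, starting from $\mathbb{C}(x)$ (all fields can be taken inside the field of quotients of complex-valued real-analytic functions on the interval; functions occurring in the statement are assumed defined and smooth in $x$ there). A simple extension $K\subset K(g)$ is called elementary if it is exponential ($g'=s'g$, $s\in K$), or logarithmic ($g'=s'/s$, $0\ne s\in K$), or algebraic ($g$ is a root of an irreducible polynomial over $K$). A function is elementary if it belongs to the last field of a finite chain $\mathbb{C}(x)\subset K_1\subset\dots\subset K_r$ of elementary extensions. A function of $(x,t)$ is elementary with respect to $x$ if it is an elementary function of $x$ for each fixed $t$.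
   Formalization: In the integration-by-parts criterion, γ itself is also required to be elementary; without this the claim fails, e.g. f_1=e^{-x}, f_2=f_3=1, γ=(1+x)E−e^{x²}/2 with E=∫e^{s²}ds, ν=e^x, S=e^{x²+x}, P=u². *)

(* Defs.v *)
From HB Require Import structures.
From Stdlib Require Import Reals Lra Lia.
From Coquelicot Require Import Coquelicot.
From mathcomp Require Import all_boot all_order all_algebra.
From mathcomp Require Import boolp.

Set Implicit Arguments.
Unset Strict Implicit.
Unset Printing Implicit Defensive.

Import GRing.Theory.

HB.instance Definition _ := gen_eqMixin C.
HB.instance Definition _ := gen_choiceMixin C.
HB.instance Definition _ := GRing.isZmodule.Build C
  Cplus_assoc Cplus_comm Cplus_0_l (fun z => eq_trans (Cplus_comm _ _) (Cplus_opp_r z)).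

Lemma C_nonzero1 : RtoC 1 != RtoC 0 :> C.
Proof. by apply/eqP; case=> /R1_neq_R0. Qed.

HB.instance Definition _ := GRing.Zmodule_isComNzRing.Build C
  Cmult_assoc Cmult_comm Cmult_1_l (fun x y z => Cmult_plus_distr_r x y z) C_nonzero1.

Lemma C_mulV (z : C) : z != RtoC 0 -> Cmult (Cinv z) z = RtoC 1.
Proof. by move=> /eqP; exact: Cinv_l. Qed.

Lemma C_inv0 : Cinv (RtoC 0) = RtoC 0.
Proof. by rewrite /Cinv /RtoC /=; congr pair; rewrite /Rdiv ?Ropp_0 Rmult_0_l. Qed.

HB.instance Definition _ := GRing.ComNzRing_isField.Build C C_mulV C_inv0.

Local Open Scope R_scope.

Record ointerval := OInterval { lo : Rbar; hi : Rbar; lo_lt_hi : Rbar_lt lo hi }.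

Definition inside (J : ointerval) (x : R) : Prop := Rbar_lt (lo J) x /\ Rbar_lt x (hi J).

Definition differentiable_at (F : R -> C) (x : R) : Prop :=
  @ex_derive R_AbsRing C_R_NormedModule F x.

(* The derivative d/dx; a junk value where F is not differentiable. *)
Definition Dx (F : R -> C) (x : R) : C :=
  (Derive (fun y => fst (F y)) x, Derive (fun y => snd (F y)) x).

Definition smooth_on (J : ointerval) (F : R -> C) : Prop :=
  forall n x, inside J x -> differentiable_at (iter n Dx F) x.

Definition integral (F : R -> C) (x0 x : R) : C :=
  @RInt C_R_CompleteNormedModule F x0 x.

Definition analytic_at (F : R -> C) (x : R) : Prop :=
  exists (a : nat -> C) (r : posreal), forall y, Rabs (y - x) < r ->
    @is_pseries R_AbsRing C_R_NormedModule a (y - x) (F y).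

Definition ranalytic_at (F : R -> R) (x : R) : Prop :=
  exists (a : nat -> R) (r : posreal), forall y, Rabs (y - x) < r ->
    is_pseries a (y - x) (F y).

Lemma filterlim_C (u : nat -> C) (l : C) :
  filterlim u eventually (@locally C_R_NormedModule l) <->
  filterlim (fun n => fst (u n)) eventually (locally (fst l)) /\
  filterlim (fun n => snd (u n)) eventually (locally (snd l)).
Proof.
split.
  move=> H; split.
    apply/filterlim_locally => eps.
    move/filterlim_locally: H => /(_ eps) [N HN]; exists N => n Hn.
    by case: (HN n Hn).
  apply/filterlim_locally => eps.
  move/filterlim_locally: H => /(_ eps) [N HN]; exists N => n Hn.
  by case: (HN n Hn).
case=> [/filterlim_locally H1 /filterlim_locally H2].
apply/filterlim_locally => eps.
case: (H1 eps) => [N1 HN1]; case: (H2 eps) => [N2 HN2].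
exists (Nat.max N1 N2) => n Hn; split; [apply: HN1|apply: HN2]; lia.
Qed.

Lemma is_pseries_C (a : nat -> C) (x : R) (l : C) :
  @is_pseries R_AbsRing C_R_NormedModule a x l <->
  is_pseries (fun n => fst (a n)) x (fst l) /\
  is_pseries (fun n => snd (a n)) x (snd l).
Proof.
rewrite /is_pseries /is_series filterlim_C.
have E1 n : fst (@sum_n C_R_NormedModule
    (fun k => scal (pow_n x k) (a k)) n) =
    sum_n (fun k => scal (pow_n x k) (fst (a k))) n.
  elim: n => [|n IH]; first by rewrite !sum_O.
  by rewrite !sum_Sn -IH.
have E2 n : snd (@sum_n C_R_NormedModule
    (fun k => scal (pow_n x k) (a k)) n) =
    sum_n (fun k => scal (pow_n x k) (snd (a k))) n.
  elim: n => [|n IH]; first by rewrite !sum_O.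
  by rewrite !sum_Sn -IH.
by split; case=> H1 H2; split;
  [ apply: filterlim_ext H1 => n; rewrite E1
  | apply: filterlim_ext H2 => n; rewrite E2
  | apply: filterlim_ext H1 => n; rewrite E1
  | apply: filterlim_ext H2 => n; rewrite E2].
Qed.

Lemma analytic_at_components (F : R -> C) x : analytic_at F x <->
  ranalytic_at (fun y => fst (F y)) x /\ ranalytic_at (fun y => snd (F y)) x.
Proof.
split.
  case=> a [r H]; split.
    by exists (fun n => fst (a n)), r => y /H /is_pseries_C [].
  by exists (fun n => snd (a n)), r => y /H /is_pseries_C [].
case=> [[a [r H]] [b [s K]]].
exists (fun n => (a n, b n)), (mkposreal _ (Rmin_pos _ _ (cond_pos r) (cond_pos s))).
move=> y /= Hy; apply/is_pseries_C => /=; split.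
  by apply: H; apply: Rlt_le_trans Hy (Rmin_l _ _).
by apply: K; apply: Rlt_le_trans Hy (Rmin_r _ _).
Qed.

Lemma CV_radius_of_is_pseries (a : nat -> R) (f : R -> R) x (r : posreal) :
  (forall y, Rabs (y - x) < r -> is_pseries a (y - x) (f y)) ->
  forall y, Rabs (y - x) < r -> Rbar_lt (Rabs (y - x)) (CV_radius a).
Proof.
move=> H y Hy.
case: (Rbar_lt_dec (Rabs (y - x)) (CV_radius a)) => // Hn.
set z := (Rabs (y - x) + r) / 2.
have Hp := Rabs_pos (y - x). have Hr := cond_pos r.
have Hz : Rabs (x + z - x) < r.
  have -> : x + z - x = z by ring.
  by rewrite /z Rabs_pos_eq; lra.
have Hlt : Rbar_lt (CV_radius a) (Rabs z).
  apply: (Rbar_le_lt_trans _ (Rabs (y - x))); first exact: Rbar_not_lt_le.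
  by rewrite /= (Rabs_pos_eq z) /z; lra.
exfalso; apply: (CV_disk_outside _ _ Hlt).
have := H _ Hz; have -> : x + z - x = z by ring.
move=> Hs.
apply: (is_lim_seq_ext (fun n => scal (pow_n z n) (a n))).
  by move=> n; rewrite pow_n_pow /Hierarchy.scal /= /Hierarchy.mult /=; ring.
by apply: ex_series_lim_0; exists (f (x + z)).
Qed.

Lemma ranalytic_const c x : ranalytic_at (fun=> c) x.
Proof.
exists (fun n => match n with O => c | _ => 0 end), (mkposreal 1 Rlt_0_1) => y _.
apply: (filterlim_ext (fun=> c)); last exact: filterlim_const.
elim=> [|n IH].
  by rewrite sum_O /Hierarchy.scal /= /Hierarchy.mult /Hierarchy.one /=; ring.
by rewrite sum_Sn -IH /Hierarchy.plus /Hierarchy.scal /= /Hierarchy.mult /=; ring.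
Qed.

Lemma ranalytic_id x : ranalytic_at (fun y => y) x.
Proof.
exists (fun n => match n with O => x | S O => 1 | _ => 0 end), (mkposreal 1 Rlt_0_1) => y _.
apply/filterlim_locally => eps; exists 1%nat => n Hn.
have -> : sum_n (fun k => scal (pow_n (y - x) k)
   match k with | 0%nat => x | 1%nat => 1 | _ => 0 end) n = y.
  case: n Hn => [|n _]; first lia.
  elim: n => [|n IH].
    by rewrite sum_Sn sum_O /Hierarchy.plus /Hierarchy.scal /= /Hierarchy.mult /Hierarchy.one /=; ring.
  by rewrite sum_Sn IH /Hierarchy.plus /Hierarchy.scal /= /Hierarchy.mult /=; ring.
exact: ball_center.
Qed.

Lemma ranalytic_plus F G x : ranalytic_at F x -> ranalytic_at G x ->
  ranalytic_at (fun y => F y + G y) x.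
Proof.
case=> a [r H] [b [s K]].
exists (PS_plus a b), (mkposreal _ (Rmin_pos _ _ (cond_pos r) (cond_pos s))) => y /= Hy.
apply: is_pseries_plus; [apply: H|apply: K].
  by apply: Rlt_le_trans Hy (Rmin_l _ _).
by apply: Rlt_le_trans Hy (Rmin_r _ _).
Qed.

Lemma ranalytic_mult F G x : ranalytic_at F x -> ranalytic_at G x ->
  ranalytic_at (fun y => F y * G y) x.
Proof.
case=> a [r H] [b [s K]].
exists (PS_mult a b), (mkposreal _ (Rmin_pos _ _ (cond_pos r) (cond_pos s))) => y /= Hy.
have Hr : Rabs (y - x) < r by apply: Rlt_le_trans Hy (Rmin_l _ _).
have Hs : Rabs (y - x) < s by apply: Rlt_le_trans Hy (Rmin_r _ _).
apply: is_pseries_mult; [exact: H|exact: K| |].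
  exact: (CV_radius_of_is_pseries H).
exact: (CV_radius_of_is_pseries K).
Qed.

Lemma ranalytic_opp F x : ranalytic_at F x -> ranalytic_at (fun y => - F y) x.
Proof.
move=> HF; have [a [r H]] := ranalytic_mult (ranalytic_const (-1) x) HF.
by exists a, r => y /H; have -> : -1 * F y = - F y by ring.
Qed.

Lemma ranalytic_near F G x (r : posreal) :
  (forall y, Rabs (y - x) < r -> F y = G y) -> ranalytic_at F x -> ranalytic_at G x.
Proof.
move=> E [a [s H]].
exists a, (mkposreal _ (Rmin_pos _ _ (cond_pos r) (cond_pos s))) => y /= Hy.
rewrite -E; first by apply: H; apply: Rlt_le_trans Hy (Rmin_r _ _).
by apply: Rlt_le_trans Hy (Rmin_l _ _).
Qed.

Lemma ranalytic_is_derive F x : ranalytic_at F x ->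
  exists (a : nat -> R) (r : posreal), forall y, Rabs (y - x) < r ->
    [/\ is_pseries a (y - x) (F y), Rbar_lt (Rabs (y - x)) (CV_radius a) &
        is_derive F y (PSeries (PS_derive a) (y - x))].
Proof.
case=> a [r H]; exists a, r => y Hy.
have Hcv := CV_radius_of_is_pseries H Hy.
split => //; first exact: H.
apply: (is_derive_ext_loc (fun z => PSeries a (z - x))).
  have Hd : 0 < r - Rabs (y - x) by lra.
  exists (mkposreal _ Hd) => z /= Hz.
  apply: is_pseries_unique; apply: H.
  have Hz' : Rabs (z - y) < r - Rabs (y - x) by exact: Hz.
  have -> : z - x = (z - y) + (y - x) by ring.
  have := Rabs_triang (z - y) (y - x); lra.
have -> : PSeries (PS_derive a) (y - x) = scal 1 (PSeries (PS_derive a) (y - x)).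
  by rewrite /Hierarchy.scal /= /Hierarchy.mult /=; ring.
apply: is_derive_comp; first exact: is_derive_PSeries.
auto_derive => //; ring.
Qed.

Lemma ranalytic_Derive F x : ranalytic_at F x -> ranalytic_at (Derive F) x.
Proof.
case/ranalytic_is_derive => a [r H]; exists (PS_derive a), r => y /H [_ Hcv Hd].
rewrite (is_derive_unique _ _ _ Hd).
by apply: PSeries_correct; apply: ex_pseries_derive.
Qed.

Lemma ranalytic_continuous F x : ranalytic_at F x -> continuous F x.
Proof.
case/ranalytic_is_derive => a [r H].
case: (H x) => [|_ _ Hd].
  by rewrite Rminus_diag Rabs_R0; apply: cond_pos.
by apply: (@ex_derive_continuous R_AbsRing R_NormedModule); eexists; exact: Hd.
Qed.

Lemma PSeries_ray_zero (v : R) : v <> 0 -> forall (n : nat) (a : nat -> R),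
  Rbar_lt (Rabs v) (CV_radius a) ->
  (forall s, 0 < s < 1 -> PSeries a (s * v) = 0) -> a n = 0.
Proof.
move=> Hv; have H0 : forall a : nat -> R, Rbar_lt (Rabs v) (CV_radius a) ->
  (forall s, 0 < s < 1 -> PSeries a (s * v) = 0) -> a O = 0.
  move=> a Hcv Hz; rewrite -(PSeries_0 a).
  case: (Req_dec (PSeries a 0) 0) => // Hne; exfalso.
  have Hc : continuous (PSeries a) 0.
    apply/continuity_pt_filterlim; apply: PSeries_continuity.
    by rewrite Rabs_R0; apply: Rbar_le_lt_trans Hcv; apply: Rabs_pos.
  have Hpos := Rabs_pos_lt _ Hne; have Hvp := Rabs_pos_lt _ Hv.
  move/filterlim_locally: Hc => /(_ (mkposreal _ Hpos)) [d Hd].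
  have Hdp := cond_pos d.
  set s := Rmin (1 / 2) (d / (2 * Rabs v)).
  have Hq : 0 < d / (2 * Rabs v) by apply: Rdiv_lt_0_compat; lra.
  have Hs : 0 < s < 1.
    by split; [apply: Rmin_pos; lra | have := Rmin_l (1 / 2) (d / (2 * Rabs v)); rewrite -/s; lra].
  have Hb : ball 0 d (s * v).
    rewrite /ball /= /AbsRing_ball /= /Hierarchy.abs /Hierarchy.minus /Hierarchy.plus /Hierarchy.opp /=.
    have -> : s * v + - 0 = s * v by ring.
    rewrite Rabs_mult (Rabs_pos_eq s); last lra.
    have : s * Rabs v <= d / (2 * Rabs v) * Rabs v.
      by apply: Rmult_le_compat_r; [lra | exact: Rmin_r].
    have -> : d / (2 * Rabs v) * Rabs v = d / 2 by field; lra.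
    lra.
  have := Hd _ Hb; rewrite Hz //.
  rewrite /ball /= /AbsRing_ball /= /Hierarchy.abs /Hierarchy.minus /Hierarchy.plus /Hierarchy.opp /=.
  by rewrite Rplus_0_l Rabs_Ropp; lra.
elim=> [|n IH] a Hcv Hz; first exact: H0.
apply: (IH (PS_decr_1 a)); first by rewrite CV_radius_decr_1.
move=> s Hs; have := Hz s Hs; rewrite PSeries_decr_1_aux; last exact: H0.
by case/Rmult_integral => // /Rmult_integral []; lra.
Qed.

Lemma ranalytic_identity (F : R -> R) (x y : R) :
  (forall s, 0 <= s <= 1 -> ranalytic_at F (x + s * (y - x))) ->
  (exists d, 0 < d /\ forall s, 0 <= s <= d -> F (x + s * (y - x)) = 0) ->
  F y = 0.
Proof.
move=> Han [d [Hd Hz]].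
case: (Req_dec y x) => [->|Hxy].
  by have := Hz 0 ltac:(lra); rewrite Rmult_0_l Rplus_0_r.
pose E s := 0 <= s <= 1 /\ forall s', 0 <= s' <= s -> F (x + s' * (y - x)) = 0.
have HE0 : E 0 by split; [lra | move=> s' Hs'; apply: Hz; lra].
have [m [Hub Hlub]] : {m | is_lub E m}.
  by apply: completeness; [exists 1 => s [Hs _]; lra | exists 0].
have Hdm : Rmin d 1 <= m.
  apply: Hub; split; first by have := Rmin_r d 1; have := Rmin_pos d 1 Hd Rlt_0_1; lra.
  by move=> s' Hs'; apply: Hz; have := Rmin_l d 1; lra.
have Hm0 : 0 < m by have := Rmin_pos d 1 Hd Rlt_0_1; lra.
have Hm1 : m <= 1 by apply: Hlub => s [Hs _]; lra.
have Hlow s : 0 <= s < m -> F (x + s * (y - x)) = 0.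
  move=> Hs; case: (Req_dec (F (x + s * (y - x))) 0) => // Hne; exfalso.
  have : m <= s; last lra.
  apply: Hlub => s' [Hs' Hs'']; case: (Rle_lt_dec s' s) => // Hlt; exfalso.
  by apply: Hne; apply: Hs''; lra.
case/ranalytic_is_derive: (Han m ltac:(lra)) => a [r H].
have Hr := cond_pos r.
have Hp := Rabs_pos_lt (y - x) ltac:(lra).
set e := Rmin m (r / (2 * Rabs (y - x))).
have Hq : 0 < r / (2 * Rabs (y - x)) by apply: Rdiv_lt_0_compat; lra.
have He : 0 < e by apply: Rmin_pos.
have Hea : e * Rabs (y - x) <= r / 2.
  have -> : r / 2 = r / (2 * Rabs (y - x)) * Rabs (y - x) by field; lra.
  by apply: Rmult_le_compat_r; [lra | exact: Rmin_r].
have Hpt s : Rabs s <= 1 -> Rabs (x + (m + s * e) * (y - x) - (x + m * (y - x))) < r.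
  move=> Hs; have -> : x + (m + s * e) * (y - x) - (x + m * (y - x)) = s * (e * (y - x)) by ring.
  rewrite !Rabs_mult (Rabs_pos_eq e); last lra.
  have : Rabs s * (e * Rabs (y - x)) <= 1 * (e * Rabs (y - x)).
    by apply: Rmult_le_compat_r => //; apply: Rmult_le_pos; lra.
  lra.
have Ha n : a n = 0.
  apply: (@PSeries_ray_zero (- (e * (y - x)))).
  - by apply: Ropp_neq_0_compat; apply: Rmult_integral_contrapositive; lra.
  - have [|_ Hcv _] := H _ (Hpt (-1) _); first by rewrite Rabs_Ropp Rabs_R1; lra.
    have <- : x + (m + -1 * e) * (y - x) - (x + m * (y - x)) = - (e * (y - x)) by ring.
    exact: Hcv.
  - move=> s Hs; have [|Hps _ _] := H _ (Hpt (- s) _).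
      by rewrite Rabs_Ropp Rabs_pos_eq; lra.
    have <- : x + (m + - s * e) * (y - x) - (x + m * (y - x)) = s * - (e * (y - x)) by ring.
    rewrite (is_pseries_unique _ _ _ Hps); apply: Hlow.
    have Hem : e <= m by exact: Rmin_l.
    have : s * e < 1 * e by apply: Rmult_lt_compat_r; lra.
    have : 0 < s * e by apply: Rmult_lt_0_compat; lra.
    lra.
have Hhigh s : Rabs s <= 1 -> F (x + (m + s * e) * (y - x)) = 0.
  move=> Hs; have [Hps _ _] := H _ (Hpt s Hs).
  rewrite -(is_pseries_unique _ _ _ Hps).
  rewrite (PSeries_ext _ (fun=> 0)) //; exact: PSeries_const_0.
have Hall s : 0 <= s <= m + e -> F (x + s * (y - x)) = 0.
  move=> Hs; case: (Rlt_le_dec s m) => Hsm; first by apply: Hlow; lra.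
  have -> : s = m + (s - m) / e * e by field; lra.
  apply: Hhigh; rewrite Rabs_pos_eq; first by apply: (Rmult_le_reg_r e) => //; field_simplify; lra.
  by apply: Rdiv_le_0_compat; lra.
case: (Rle_lt_dec 1 m) => Hm.
  by have := Hall 1 ltac:(lra); have -> : x + 1 * (y - x) = y by ring.
have : Rmin 1 (m + e) <= m.
  apply: Hub; split; first by split; [apply: Rmin_glb; lra | exact: Rmin_l].
  by move=> s' Hs'; apply: Hall; have := Rmin_r 1 (m + e); lra.
by rewrite /Rmin; case: Rle_dec; lra.
Qed.

Lemma analytic_const c x : analytic_at (fun=> c) x.
Proof. by apply/analytic_at_components; split; exact: ranalytic_const. Qed.

Lemma analytic_id x : analytic_at RtoC x.
Proof.
by apply/analytic_at_components; split; [exact: ranalytic_id | exact: ranalytic_const].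
Qed.

Lemma analytic_plus F G x : analytic_at F x -> analytic_at G x ->
  analytic_at (fun y => Cplus (F y) (G y)) x.
Proof.
move=> /analytic_at_components [F1 F2] /analytic_at_components [G1 G2].
by apply/analytic_at_components; split; exact: ranalytic_plus.
Qed.

Lemma analytic_opp F x : analytic_at F x -> analytic_at (fun y => Copp (F y)) x.
Proof.
move=> /analytic_at_components [F1 F2].
by apply/analytic_at_components; split; exact: ranalytic_opp.
Qed.

Lemma analytic_mult F G x : analytic_at F x -> analytic_at G x ->
  analytic_at (fun y => Cmult (F y) (G y)) x.
Proof.
move=> /analytic_at_components [F1 F2] /analytic_at_components [G1 G2].
apply/analytic_at_components; split => /=; apply: ranalytic_plus;
  try apply: ranalytic_opp; exact: ranalytic_mult.
Qed.

Lemma analytic_Dx F x : analytic_at F x -> analytic_at (Dx F) x.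
Proof.
move=> /analytic_at_components [F1 F2].
by apply/analytic_at_components; split; exact: ranalytic_Derive.
Qed.

Lemma analytic_near F G x (r : posreal) :
  (forall y, Rabs (y - x) < r -> F y = G y) -> analytic_at F x -> analytic_at G x.
Proof.
move=> E /analytic_at_components [F1 F2].
by apply/analytic_at_components; split; [apply: ranalytic_near F1 | apply: ranalytic_near F2];
  move=> y /E ->.
Qed.

Lemma inside_near J x : inside J x ->
  exists r : posreal, forall y, Rabs (y - x) < r -> inside J y.
Proof.
case=> H1 H2.
have [r Hr] : locally x (fun y => Rbar_lt (lo J) y) by exact: open_Rbar_gt.
have [s Hs] : locally x (fun y => Rbar_lt y (hi J)) by exact: open_Rbar_lt.
exists (mkposreal _ (Rmin_pos _ _ (cond_pos r) (cond_pos s))) => y /= Hy; split.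
  by apply: Hr; apply: Rlt_le_trans Hy (Rmin_l _ _).
by apply: Hs; apply: Rlt_le_trans Hy (Rmin_r _ _).
Qed.

Lemma inside_convex J x y s : inside J x -> inside J y -> 0 <= s <= 1 ->
  inside J (x + s * (y - x)).
Proof.
move=> [H1 H2] [H3 H4] Hs.
case: (Rle_lt_dec x y) => Hxy.
  have H5 : x <= x + s * (y - x) <= y.
    have : 0 <= s * (y - x) by apply: Rmult_le_pos; lra.
    have : s * (y - x) <= 1 * (y - x) by apply: Rmult_le_compat_r; lra.
    lra.
  by split; [apply: (Rbar_lt_le_trans _ x) | apply: (Rbar_le_lt_trans _ y)] => //=; lra.
have H5 : y <= x + s * (y - x) <= x.
  have : 0 <= s * (x - y) by apply: Rmult_le_pos; lra.
  have : s * (x - y) <= 1 * (x - y) by apply: Rmult_le_compat_r; lra.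
  lra.
by split; [apply: (Rbar_lt_le_trans _ y) | apply: (Rbar_le_lt_trans _ x)] => //=; lra.
Qed.

Lemma inside_ex J : exists x, inside J x.
Proof.
case: J => [[a||] [b||] //= Hab]; rewrite /inside /=.
- by exists ((a + b) / 2); lra.
- by exists (a + 1); split => //; lra.
- by exists (b - 1); split => //; lra.
- by exists 0.
Qed.

Lemma analytic_integral J (F G : R -> C) :
  (forall x, inside J x -> analytic_at F x) -> (forall x, inside J x -> analytic_at G x) ->
  (forall x, inside J x -> Cmult (F x) (G x) = RtoC 0) ->
  (exists x, inside J x /\ F x <> RtoC 0) -> forall y, inside J y -> G y = RtoC 0.
Proof.
move=> HF HG FGx [x [Jx Fx]].
have /analytic_at_components [/ranalytic_continuous F1 /ranalytic_continuous F2] :=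
  HF _ Jx.
have [r0 Hr0] := inside_near Jx.
have [r Hr] : exists r : posreal, forall y, Rabs (y - x) < r -> F y <> RtoC 0.
  have [F1x|F1x] := pselect (fst (F x) = 0).
    have F2x : snd (F x) <> 0.
      by move=> F2x; apply: Fx; rewrite [F x]surjective_pairing F1x F2x.
    move/filterlim_locally: F2 => /(_ (mkposreal _ (Rabs_pos_lt _ F2x))) [r Hr].
    exists r => y /Hr Hy Fy; move: Hy; rewrite Fy /ball /= /AbsRing_ball /Hierarchy.abs /Hierarchy.minus /Hierarchy.plus /Hierarchy.opp /=.
    by rewrite Rplus_0_l Rabs_Ropp; lra.
  move/filterlim_locally: F1 => /(_ (mkposreal _ (Rabs_pos_lt _ F1x))) [r Hr].
  exists r => y /Hr Hy Fy; move: Hy; rewrite Fy /ball /= /AbsRing_ball /Hierarchy.abs /Hierarchy.minus /Hierarchy.plus /Hierarchy.opp /=.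
  by rewrite Rplus_0_l Rabs_Ropp; lra.
have G0 y : Rabs (y - x) < Rmin r0 r -> G y = RtoC 0.
  move=> Hy; have Jy : inside J y by apply: Hr0; apply: Rlt_le_trans Hy (Rmin_l _ _).
  have Fy : F y <> RtoC 0 by apply: Hr; apply: Rlt_le_trans Hy (Rmin_r _ _).
  by rewrite -(Cmult_1_l (G y)) -(Cinv_l _ Fy) -Cmult_assoc FGx // Cmult_0_r.
have Hrr : 0 < Rmin r0 r := Rmin_pos _ _ (cond_pos r0) (cond_pos r).
move=> y Jy.
have Hline s : 0 <= s <= 1 -> inside J (x + s * (y - x)) by exact: inside_convex.
have Hnear : exists d, 0 < d /\ forall s, 0 <= s <= d -> G (x + s * (y - x)) = RtoC 0.
  have Hp := Rabs_pos (y - x).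
  exists (Rmin r0 r / (2 * (Rabs (y - x) + 1))); split; first by apply: Rdiv_lt_0_compat; lra.
  move=> s Hs; apply: G0; have -> : x + s * (y - x) - x = s * (y - x) by ring.
  rewrite Rabs_mult (Rabs_pos_eq s); last lra.
  have : s * Rabs (y - x) <= Rmin r0 r / (2 * (Rabs (y - x) + 1)) * (Rabs (y - x) + 1).
    by apply: Rmult_le_compat; lra.
  have -> : Rmin r0 r / (2 * (Rabs (y - x) + 1)) * (Rabs (y - x) + 1) = Rmin r0 r / 2 by field; lra.
  lra.
case: Hnear => d [Hd Hz].
rewrite [G y]surjective_pairing; congr pair.
  apply: (ranalytic_identity (x := x) (F := fun z => fst (G z))).
    by move=> s /Hline /HG /analytic_at_components [].
  by exists d; split => // s /Hz ->.
apply: (ranalytic_identity (x := x) (F := fun z => snd (G z))).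
  by move=> s /Hline /HG /analytic_at_components [].
by exists d; split => // s /Hz ->.
Qed.

(* The ring of complex-valued real-analytic functions on J, each represented
   by its extension by 0 outside J. *)
Record afun (J : ointerval) := AFun {
  afun_fun :> R -> C;
  afun_analytic : forall x, inside J x -> analytic_at afun_fun x;
  afun_out : forall x, ~ inside J x -> afun_fun x = RtoC 0 }.

Definition cut (J : ointerval) (F : R -> C) (x : R) : C :=
  if `[< inside J x >] then F x else RtoC 0.

Lemma cut_in J F x : inside J x -> cut J F x = F x.
Proof. by move=> H; rewrite /cut; case: asboolP. Qed.

Lemma cut_out J F x : ~ inside J x -> cut J F x = RtoC 0.
Proof. by move=> H; rewrite /cut; case: asboolP. Qed.

Lemma cut_analytic J F : (forall x, inside J x -> analytic_at F x) ->
  forall x, inside J x -> analytic_at (cut J F) x.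
Proof.
move=> H x Hx; have [r Hr] := inside_near Hx.
by apply: (analytic_near (F := F) (r := r)) (H x Hx) => y /Hr Hy; rewrite cut_in.
Qed.

Definition mk_afun (J : ointerval) (F : R -> C)
    (H : forall x, inside J x -> analytic_at F x) : afun J :=
  AFun (cut_analytic H) (fun x => @cut_out J F x).

Lemma afunP J (F G : afun J) : (forall x, inside J x -> F x = G x) -> F = G.
Proof.
move=> E; have {}E : afun_fun F = afun_fun G.
  apply: funext => x; case: (pselect (inside J x)) => [/E //|Hx].
  by rewrite !afun_out.
case: F G E => F F1 F2 [G G1 G2] /= E; case: _ / E G1 G2 => G1 G2.
by rewrite (Prop_irrelevance F1 G1) (Prop_irrelevance F2 G2).
Qed.

Local Open Scope ring_scope.

Local Notation "x %:F" := (@FracField.tofrac _ x) : ring_scope.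

Section AnalyticRing.
Variable J : ointerval.
Implicit Types F G H : afun J.

Definition afun_const (c : C) : afun J := mk_afun (fun x _ => analytic_const c x).

Definition afun_id : afun J := mk_afun (fun x _ => analytic_id x).

Definition afun_add F G : afun J :=
  mk_afun (fun x Jx => analytic_plus (afun_analytic F Jx) (afun_analytic G Jx)).

Definition afun_opp F : afun J := mk_afun (fun x Jx => analytic_opp (afun_analytic F Jx)).

Definition afun_mul F G : afun J :=
  mk_afun (fun x Jx => analytic_mult (afun_analytic F Jx) (afun_analytic G Jx)).

Definition afun_deriv F : afun J := mk_afun (fun x Jx => analytic_Dx (afun_analytic F Jx)).

HB.instance Definition _ := gen_eqMixin (afun J).
HB.instance Definition _ := gen_choiceMixin (afun J).

Lemma afun_addA : associative afun_add.
Proof. by move=> F G H; apply: afunP => x Jx; rewrite /= !cut_in // Cplus_assoc. Qed.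

Lemma afun_addC : commutative afun_add.
Proof. by move=> F G; apply: afunP => x Jx; rewrite /= !cut_in // Cplus_comm. Qed.

Lemma afun_add0 : left_id (afun_const (RtoC 0)) afun_add.
Proof. by move=> F; apply: afunP => x Jx; rewrite /= !cut_in // Cplus_0_l. Qed.

Lemma afun_addN : left_inverse (afun_const (RtoC 0)) afun_opp afun_add.
Proof.
by move=> F; apply: afunP => x Jx; rewrite /= !cut_in // Cplus_comm Cplus_opp_r.
Qed.

HB.instance Definition _ :=
  GRing.isZmodule.Build (afun J) afun_addA afun_addC afun_add0 afun_addN.

Lemma afun_mulA : associative afun_mul.
Proof. by move=> F G H; apply: afunP => x Jx; rewrite /= !cut_in // Cmult_assoc. Qed.

Lemma afun_mulC : commutative afun_mul.
Proof. by move=> F G; apply: afunP => x Jx; rewrite /= !cut_in // Cmult_comm. Qed.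

Lemma afun_mul1 : left_id (afun_const (RtoC 1)) afun_mul.
Proof. by move=> F; apply: afunP => x Jx; rewrite /= !cut_in // Cmult_1_l. Qed.

Lemma afun_mulDl : left_distributive afun_mul afun_add.
Proof.
by move=> F G H; apply: afunP => x Jx; rewrite /= !cut_in // Cmult_plus_distr_r.
Qed.

Lemma afun_nonzero1 : afun_const (RtoC 1) != afun_const (RtoC 0).
Proof.
apply/eqP => E; have [x Jx] := inside_ex J.
have := congr1 (fun F : afun J => F x) E.
by rewrite /= !cut_in // => - [] /R1_neq_R0.
Qed.

HB.instance Definition _ := GRing.Zmodule_isComNzRing.Build (afun J)
  afun_mulA afun_mulC afun_mul1 afun_mulDl afun_nonzero1.

Definition afun_unit : pred (afun J) := fun F => `[< exists G, G * F = 1 >].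

Definition afun_inv F : afun J :=
  if pselect (exists G, G * F = 1) is left H then projT1 (cid H) else F.

Lemma afun_mulV : {in afun_unit, left_inverse 1 afun_inv (@GRing.mul _)}.
Proof. by move=> F /asboolP HF; rewrite /afun_inv; case: pselect => // H; case: cid. Qed.

Lemma afun_unitPl F G : G * F = 1 -> afun_unit F.
Proof. by move=> E; apply/asboolP; exists G. Qed.

Lemma afun_inv_out : {in [predC afun_unit], afun_inv =1 @Datatypes.id (afun J)}.
Proof. by move=> F /asboolP HF; rewrite /afun_inv; case: pselect. Qed.

HB.instance Definition _ := GRing.ComNzRing_hasMulInverse.Build (afun J)
  afun_mulV afun_unitPl afun_inv_out.

Lemma afun_integral F G : F * G = 0 -> (F == 0) || (G == 0).
Proof.
move=> FG0; case: (pselect (F = 0)) => [->|HF]; first by rewrite eqxx.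
apply/orP; right; apply/eqP; apply: afunP => y Jy; rewrite [RHS]cut_in //.
apply: (analytic_integral (afun_analytic F) (afun_analytic G)) Jy.
  move=> x Jx; have := congr1 (fun H : afun J => H x) FG0.
  by rewrite [LHS]cut_in // [RHS]cut_in.
apply: contrapT => Hn; apply: HF; apply: afunP => x Jx.
by rewrite [RHS]cut_in //; apply: contrapT => Fx; apply: Hn; exists x.
Qed.

HB.instance Definition _ := GRing.ComUnitRing_isIntegral.Build (afun J) afun_integral.

Lemma afun_addE F G x : inside J x -> (F + G) x = Cplus (F x) (G x).
Proof. by move=> Jx; rewrite [LHS]cut_in. Qed.

Lemma afun_mulE F G x : inside J x -> (F * G) x = Cmult (F x) (G x).
Proof. by move=> Jx; rewrite [LHS]cut_in. Qed.

Lemma afun_derivE F x : inside J x -> afun_deriv F x = Dx F x.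
Proof. by move=> Jx; rewrite [LHS]cut_in. Qed.

Lemma afun_derivM F G : afun_deriv (F * G) = afun_deriv F * G + F * afun_deriv G.
Proof.
apply: afunP => x Jx.
have D p (H : afun J) : ranalytic_at (fun y => p (H y)) x -> ex_derive (fun y => p (H y)) x.
  case/ranalytic_is_derive => a [r Hr].
  have [|_ _ Hd] := Hr x; last by eexists; exact: Hd.
  by rewrite Rminus_diag Rabs_R0; exact: cond_pos.
have [/D D1 /D D2] := proj1 (analytic_at_components F x) (afun_analytic F Jx).
have [/D D3 /D D4] := proj1 (analytic_at_components G x) (afun_analytic G Jx).
have [r Hr] := inside_near Jx.
have near_ext (p : C -> R) :
    Derive (fun y => p ((F * G) y)) x = Derive (fun y => p (Cmult (F y) (G y))) x.
  by apply: Derive_ext_loc; exists r => y /Hr Jy; rewrite afun_mulE.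
rewrite afun_addE // !afun_mulE // !afun_derivE // /Dx !near_ext /=.
have M (p q : R -> R) : ex_derive p x -> ex_derive q x -> ex_derive (fun y => Rmult (p y) (q y)) x.
  by move=> Hp Hq; exact: ex_derive_mult.
rewrite Derive_minus ?Derive_plus ?Derive_mult //; try exact: M.
by rewrite /Cmult /Cplus /=; congr pair; ring.
Qed.

(* d/dx on quotients of analytic functions, by the quotient rule. *)
Definition mer_deriv (z : {fraction afun J}) : {fraction afun J} :=
  let n := \n_(repr z) in let d := \d_(repr z) in
  (afun_deriv n * d - n * afun_deriv d)%:F / (d ^+ 2)%:F.

Lemma mer_derivE (p q : afun J) : q != 0 ->
  mer_deriv (p%:F / q%:F) = (afun_deriv p * q - p * afun_deriv q)%:F / (q ^+ 2)%:F.
Proof.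
move=> q0; rewrite /mer_deriv; set z := p%:F / q%:F.
set n := \n_(repr z); set d := \d_(repr z).
have d0 : d != 0 by exact: denom_ratioP.
have Hz : z = n%:F / d%:F.
  apply: (canRL (mulfK _)); first by rewrite tofrac_eq0.
  rewrite -[z]reprK /n /d; unlock FracField.tofrac.
  rewrite -[LHS]FracField.pi_mul /FracField.mulf !numden_Ratio ?oner_eq0 // ?mulr1 ?reprK.
  by apply/eqmodP; rewrite /= FracField.equivfE !numden_Ratio ?oner_eq0 // mulr1 mulrC.
have /eqP : n%:F * q%:F == d%:F * p%:F.
  by rewrite [X in _ == X]mulrC -eqr_div ?tofrac_eq0 // -Hz.
rewrite -!rmorphM => /eqP; rewrite tofrac_eq => /eqP E.
have E' := congr1 afun_deriv E; rewrite !afun_derivM in E'.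
apply/eqP; rewrite eqr_div ?tofrac_eq0 ?expf_neq0 // -!rmorphM tofrac_eq; apply/eqP.
have E1 : afun_deriv n * q = afun_deriv d * p + d * afun_deriv p - n * afun_deriv q.
  by rewrite -E' addrK.
have -> : (afun_deriv n * d - n * afun_deriv d) * q ^+ 2 =
    (afun_deriv n * q) * (d * q) - (n * q) * (afun_deriv d * q).
  by rewrite expr2 mulrBl; congr (_ - _); rewrite mulrACA.
have T1 : afun_deriv d * p * (d * q) = d * p * (afun_deriv d * q).
  by rewrite mulrACA [_ * d]mulrC mulrACA.
have T2 : n * afun_deriv q * (d * q) = p * afun_deriv q * d ^+ 2.
  by rewrite [d * q]mulrC mulrACA E [d * p]mulrC mulrACA expr2.
have T3 : d * afun_deriv p * (d * q) = afun_deriv p * q * d ^+ 2.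
  by rewrite [d * _]mulrC [d * q]mulrC mulrACA expr2.
rewrite E1 E !mulrBl mulrDl T1 T2 T3.
by rewrite addrAC [X in X - _ - _]addrC addrK.
Qed.

End AnalyticRing.

(* Subsets of a field: K(g), and the last fields of finite chains
   K0 < K0(g1) < K0(g1)(g2) < ... in which each extension is an allowed step. *)
Inductive adjoin (L : fieldType) (K : L -> Prop) (g : L) : L -> Prop :=
| adjoin_base x : K x -> adjoin K g x
| adjoin_gen : adjoin K g g
| adjoin_sub x y : adjoin K g x -> adjoin K g y -> adjoin K g (x - y)
| adjoin_div x y : adjoin K g x -> adjoin K g y -> adjoin K g (x / y).

Inductive tower (L : fieldType) (step : (L -> Prop) -> L -> Prop) (K0 : L -> Prop) :
    (L -> Prop) -> Prop :=
| tower_base : tower step K0 K0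
| tower_step K g : tower step K0 K -> step K g -> tower step K0 (adjoin K g).

Definition coefs_in (L : fieldType) (K : L -> Prop) (p : {poly L}) : Prop :=
  forall i, K p`_i.

Definition irreducible_over (L : fieldType) (K : L -> Prop) (p : {poly L}) : Prop :=
  [/\ coefs_in K p, (1 < size p)%N &
      forall q, coefs_in K q -> size q <> 1%N -> q %| p -> q %= p].

Definition exponential_step (L : fieldType) (D : L -> L) (K : L -> Prop) (g : L) : Prop :=
  exists s, K s /\ D g = D s * g.

Definition logarithmic_step (L : fieldType) (D : L -> L) (K : L -> Prop) (g : L) : Prop :=
  exists s, [/\ K s, s != 0 & D g = D s / s].

Definition algebraic_step (L : fieldType) (K : L -> Prop) (g : L) : Prop :=
  exists p, irreducible_over K p /\ root p g.

Definition elementary_step (L : fieldType) (D : L -> L) (K : L -> Prop) (g : L) : Prop :=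
  [\/ exponential_step D K g, logarithmic_step D K g | algebraic_step K g].

Definition radical_step (L : fieldType) (K : L -> Prop) (g : L) : Prop :=
  exists n, (0 < n)%N /\ K (g ^+ n).

(* C(x) inside the field of quotients of analytic functions on J. *)
Definition rational_functions (J : ointerval) : {fraction afun J} -> Prop :=
  adjoin (fun z => exists c, z = (afun_const J c)%:F) (afun_id J)%:F.

(* F is everywhere defined and analytic on J, and its class belongs to the last
   field of a chain of elementary extensions of C(x). *)
Definition elementary (J : ointerval) (F : R -> C) : Prop :=
  exists (G : afun J) (K : {fraction afun J} -> Prop),
    [/\ forall x, inside J x -> F x = G x,
        tower (elementary_step (@mer_deriv J)) (@rational_functions J) K & K G%:F].

Definition solvable_by_radicals (F : fieldType) (p : {poly F}) : Prop :=
  exists (L : fieldType) (iota : {rmorphism F -> L}) (rs : seq L) (K : L -> Prop),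
    [/\ map_poly iota p %= \prod_(r <- rs) ('X - r%:P),
        tower (@radical_step L) (fun y => exists x, y = iota x) K &
        forall r, r \in rs -> K r].

(* P(u) - d as a polynomial in u over C(d). *)
Definition generic_level (P : {poly C}) : {poly {fraction {poly C}}} :=
  map_poly (fun c : C => (c%:P)%:F) P - (('X : {poly C})%:F)%:P.

(* alpha is a holomorphic branch on the open set Omega of the roots u of
   P(u) - d = 0, as functions of d. *)
Definition root_branch (P : {poly C}) (Omega : C -> Prop) (alpha : C -> C) : Prop :=
  @open C_UniformSpace Omega /\
  forall d, Omega d -> @ex_derive C_AbsRing C_NormedModule alpha d /\ P.[alpha d] = d.

(* m integrations starting with index i; (iterated_integral f x0 i (j.+1 - i)) is
   g_{i:j}, and the case m = 0 includes the convention g_{2:1} = 1. *)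
Fixpoint iterated_integral (f : nat -> R -> C) (x0 : R) (i m : nat) (x : R) : C :=
  match m with
  | 0%N => 1
  | m'.+1 => integral (fun s => iterated_integral f x0 i.+1 m' s / f i s) x0 x
  end.

Definition g2 (f : nat -> R -> C) (x0 : R) (j : nat) : R -> C :=
  iterated_integral f x0 2 j.-1.

Definition V (T : Type) (f : nat -> R -> C) (ft : T -> C) (x0 : R) (j : nat)
    (x : R) (t : T) : C :=
  (ft t * integral (fun s => g2 f x0 j s / f 1%N s) x0 x)%R.

Definition flows_to (I : ointerval) (phi w w' : R -> C) : Prop :=
  forall x, inside I x -> differentiable_at w x /\ phi x * Dx w x = w' x.

(* Only gbar 2, ..., gbar (k - 2) are constrained. *)
Definition particular_data (T : Type) (I : ointerval) (k : nat) (f : nat -> R -> C)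
    (g G Rbar : R -> T -> C) (gbar : nat -> R -> T -> C) : Prop :=
  forall t,
    [/\ flows_to I (fun=> 1) (G^~ t) (g^~ t),
        flows_to I (f (k - 1)%N) (Rbar^~ t) (G^~ t),
        flows_to I (f (k - 2)%N) ((gbar (k - 2)%N)^~ t) (Rbar^~ t) &
        forall i, (2 <= i <= k - 3)%N ->
          flows_to I (f i) ((gbar i)^~ t) ((gbar i.+1)^~ t)].

Definition Vbar (T : Type) (f : nat -> R -> C) (x0 : R) (gbar : nat -> R -> T -> C)
    (x : R) (t : T) : C :=
  integral (fun s => gbar 2%N s t / f 1%N s) x0 x.

Definition liouville_criterion (I : ointerval) (f1 gamma : R -> C) : Prop :=
  exists (n : nat) (c : 'I_n -> C) (h : 'I_n -> R -> C) (sigma : R -> C),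
    [/\ forall i, elementary I (h i) /\ forall x, inside I x -> h i x <> 0,
        elementary I sigma &
        forall x, inside I x ->
          gamma x / f1 x = \sum_(i < n) c i * (Dx (h i) x / h i x) + Dx sigma x].

(* Elementarity of gamma is made explicit: integrating by parts p + 1 times,
   int gamma nu^(p+1) = sum_(i <= p) (-1)^i gamma^(i) nu^(p-i) + (-1)^(p+1) S,
   and the boundary terms need not be elementary when only nu and S are. For
   example, with E(x) = int_0^x exp(s^2) ds, f1 = exp(-x), nu = exp(x), p = 1,
   S = exp(x^2 + x) and gamma = (1 + x) E(x) - exp(x^2) / 2, one has
   gamma'' nu = S' but int gamma / f1 is not elementary. *)
Definition by_parts_criterion (I : ointerval) (f1 gamma : R -> C) : Prop :=
  elementary I gamma /\
  exists (nu S : R -> C) (p : nat),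
    [/\ (0 < p)%N, elementary I nu, elementary I S &
        forall x, inside I x ->
          iter p.+1 Dx nu x = 1 / f1 x /\ Dx S x = iter p.+1 Dx gamma x * nu x].

(* f_m d/dx ... f_2 d/dx f_1 d/dx w. *)
Fixpoint nested_deriv (f : nat -> R -> C) (m : nat) (w : R -> C) : R -> C :=
  match m with
  | 0%N => w
  | m'.+1 => fun x => f m'.+1 x * Dx (nested_deriv f m' w) x
  end.

(* d/dx f_{k-1} d/dx ... f_1 d/dx w = g on J, all derivatives existing. *)
Definition solves_on (J : ointerval) (k : nat) (f : nat -> R -> C) (g w : R -> C) : Prop :=
  forall x, inside J x ->
    (forall m, (m < k)%N -> differentiable_at (nested_deriv f m w) x) /\
    Dx (nested_deriv f k.-1 w) x = g x.

Definition subinterval (J I : ointerval) : Prop := forall x, inside J x -> inside I x.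

(* Main.v *)
From HB Require Import structures.
Require Import Defs.
From Stdlib Require Import Reals Lra Lia.
From Coquelicot Require Import Coquelicot.
From mathcomp Require Import all_boot all_order all_algebra.
From mathcomp Require Import boolp.
Import Defs GRing.Theory.

Set Implicit Arguments.
Unset Strict Implicit.
Unset Printing Implicit Defensive.

(** Put B = 1. The operator d/dx f_(k-1) d/dx ... f_1 d/dx is linear and undoes, one
   at a time, the integrations that define V_j and Vbar; it therefore sends
   W = sum_s A_s V_(j_s) + Vbar to g, whatever the constants A_s are ([V_chain],
   [Vbar_chain], [chain_solves]). A branch alpha of the roots of P(u) = d satisfies
   P(alpha(W)) = W, so u = alpha(W) solves the nonlinear equation.

   That u is elementary has two halves. Each criterion yields an elementary primitive
   of gamma / f_1: a primitive of h'/h is adjoined by a logarithmic step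
   ([elementary_logarithm]), and integration by parts is a telescoping sum
   ([afun_deriv_by_parts]). Hence W is elementary on I, and on every subinterval because
   restriction embeds one differential field into the other ([elementary_restriction]).
   Finally u is a root of P - W, so a single algebraic step over a field containing W
   reaches it ([elementary_root]).

   Elementary functions live in a field of quotients of real-analytic functions, so the
   functions that are adjoined must be shown to be analytic. For primitives this is
   termwise integration. For u, and for the quotient 1/h, it is [analytic_fixpoint]: a
   small continuous solution v of v = w_0 + w_1 v + w_2 v^2 + ... with analytic w_i and
   w_0 = w_1 = 0 at the base point is analytic. The equation has a formal power series
   solution, the limit of a Picard iteration. For small r the iteration preserves a ball
   of the norm sum |a_n| r^n, which is submultiplicative, so the formal solution
   converges; its sum is v because the right-hand side contracts small numbers.

   The same formal solution, with constant coefficients, produces the roots of P(u) = d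
   near a simple root and hence a holomorphic branch through any prescribed simple root
   ([local_root_branch]); this gives the second part of the theorem.

   On the algebraic side the elements of all towers of elementary extensions form one
   field. Two towers can be joined because an element algebraic over K is algebraic over
   any larger field, where its irreducible polynomial is replaced by a factor
   ([algebraic_stepI], [tower_join]). This field is stable under the derivation, since
   differentiating the minimal equation of an algebraic element determines its
   derivative ([elementary_over_D]). *)

Local Open Scope R_scope.

(** * Power series with complex coefficients *)

Definition shift (a : nat -> C) : nat -> C := fun n => a n.+1.

(** The Cauchy product, by recursion on its left factor, which makes [wnorm_conv] and the
   truncation lemmas direct inductions. *)
Fixpoint conv (a b : nat -> C) (n : nat) : C :=
  match n with
  | O => Cmult (a O) (b O)
  | m.+1 => Cplus (Cmult (a O) (b m.+1)) (conv (shift a) b m)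
  end.

(** Partial sums of the weighted l1 norm sum |a_i| r^i, in Horner form so that their
   recursion matches that of [conv]. *)
Fixpoint wnorm (r : R) (a : nat -> C) (n : nat) : R :=
  match n with
  | O => Cmod (a O)
  | m.+1 => Cmod (a O) + r * wnorm r (shift a) m
  end.

Definition wnorm_le (r M : R) (a : nat -> C) : Prop := forall n, wnorm r a n <= M.

Lemma wnorm_ge0 r a n : 0 <= r -> 0 <= wnorm r a n.
Proof.
move=> r0; elim: n a => [|n IH] a /=; have := Cmod_ge_0 (a O); first lra.
have := Rmult_le_pos _ _ r0 (IH (shift a)); lra.
Qed.

Lemma wnorm_ext r a b n : (forall i, (i <= n)%N -> a i = b i) -> wnorm r a n = wnorm r b n.
Proof.
elim: n a b => [|n IH] a b E /=; first by rewrite E.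
by rewrite E // (IH (shift a) (shift b)) // => i Hi; exact: E.
Qed.

Lemma wnorm_add r a b n : 0 <= r ->
  wnorm r (fun i => Cplus (a i) (b i)) n <= wnorm r a n + wnorm r b n.
Proof.
move=> r0; elim: n a b => [|n IH] a b /=; first exact: Cmod_triangle.
have := Cmod_triangle (a O) (b O).
have := Rmult_le_compat_l _ _ _ r0 (IH (shift a) (shift b)).
rewrite /shift; lra.
Qed.

Lemma wnorm_scal r c a n : wnorm r (fun i => Cmult c (a i)) n = Cmod c * wnorm r a n.
Proof.
elim: n a => [|n IH] a /=; rewrite Cmod_mult // /shift (IH (fun n => a n.+1)); ring.
Qed.

Lemma wnorm_S r a n : 0 <= r -> wnorm r a n <= wnorm r a n.+1.
Proof.
move=> r0; elim: n a => [|n IH] a.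
  by have /= := Rmult_le_pos _ _ r0 (Cmod_ge_0 (shift a O)); lra.
have := Rmult_le_compat_l _ _ _ r0 (IH (shift a)); rewrite -/(wnorm r a n.+1) /=; lra.
Qed.

(** The norm is submultiplicative already for partial sums: split off the constant term of
   the left factor. *)
Lemma wnorm_conv r a b n : 0 <= r -> wnorm r (conv a b) n <= wnorm r a n * wnorm r b n.
Proof.
move=> r0; elim: n a => [|n IH] a /=; first by rewrite Cmod_mult; lra.
rewrite Cmod_mult.
have H1 := wnorm_add (fun i => Cmult (a O) (b i.+1)) (conv (shift a) b) n r0.
rewrite (wnorm_scal r (a O) (shift b)) in H1.
have H2 := IH (shift a).
have H3 : wnorm r b n <= Cmod (b O) + r * wnorm r (shift b) n by exact: (wnorm_S b n r0).
have H4 := wnorm_ge0 (shift a) n r0.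
have H5 := Rmult_le_compat_l _ _ _ H4 H3.
have H6 := Rmult_le_compat_l _ _ _ r0 H1.
have H7 := Rmult_le_compat_l _ _ _ r0 (Rle_trans _ _ _ H2 H5).
rewrite -/(shift _) in H6 *.
have -> : shift (conv a b) = (fun i => Cplus (Cmult (a O) (b i.+1)) (conv (shift a) b i)) by [].
nra.
Qed.

Lemma wnorm_le_radius r s a n : 0 <= s <= r -> wnorm s a n <= wnorm r a n.
Proof.
move=> sr; elim: n a => [|n IH] a /=; first lra.
have := IH (shift a); have := wnorm_ge0 (shift a) n (proj1 sr); nra.
Qed.

(** Shrinking the radius makes a series without constant term small, at the rate of the
   radius. *)
Lemma wnorm_small_radius r t a n : a O = RtoC 0 -> 0 <= t <= 1 -> 0 <= r ->
  wnorm (t * r) a n <= t * wnorm r a n.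
Proof.
move=> a0 t01 r0; case: n => [|n] /=; rewrite a0 Cmod_0; first lra.
have tr : 0 <= t * r <= r by nra.
have := wnorm_le_radius (shift a) n tr; have := wnorm_ge0 (shift a) n (proj1 tr); nra.
Qed.

Lemma wnorm_sum r a n : sum_n (fun i => Cmod (a i) * r ^ i) n = wnorm r a n.
Proof.
elim: n a => [|n IH] a; first by rewrite sum_O /=; ring.
rewrite /= -IH.
have -> : r * sum_n (fun i => Cmod (shift a i) * r ^ i) n =
    sum_n (fun i => r * (Cmod (shift a i) * r ^ i)) n.
  by symmetry; exact: (sum_n_mult_l (K := R_Ring)).
rewrite /sum_n sum_Sn_m; last lia.
rewrite -sum_n_m_S /Hierarchy.plus /= Rmult_1_r; congr (_ + _).
apply: sum_n_m_ext => i; rewrite /shift /=.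
by change (Cmod (a i.+1) * (r * r ^ i) = r * (Cmod (a i.+1) * r ^ i)); ring.
Qed.

Lemma wnorm_term r a n : 0 <= r -> Cmod (a n) * r ^ n <= wnorm r a n.
Proof.
move=> r0; elim: n a => [|n IH] a /=; first lra.
have := Rmult_le_compat_l _ _ _ r0 (IH (shift a)); have := Cmod_ge_0 (a O).
rewrite /shift; lra.
Qed.

(** Summed by components, so that the calculus of real power series applies. *)
Definition cpseries (a : nat -> C) (x : R) : C :=
  (PSeries (fun n => fst (a n)) x, PSeries (fun n => snd (a n)) x).

Lemma part_le_Cmod (z : C) : Rabs (fst z) <= Cmod z /\ Rabs (snd z) <= Cmod z.
Proof.
have := Rmax_Cmod z; have := Rmax_l (Rabs (fst z)) (Rabs (snd z)).
by have := Rmax_r (Rabs (fst z)) (Rabs (snd z)); lra.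
Qed.

Lemma Cmod_le_parts (z : C) : Cmod z <= Rabs (fst z) + Rabs (snd z).
Proof.
case: z => p q /=; have -> : (p, q) = Cplus (RtoC p) (Cmult Ci (RtoC q)).
  by rewrite /Cplus /Cmult /Ci /RtoC /=; congr pair; ring.
apply: Rle_trans (Cmod_triangle _ _) _.
rewrite Cmod_mult !Cmod_R.
have -> : Cmod Ci = 1 by rewrite /Cmod /Ci /= !Rmult_0_l !Rmult_1_l Rplus_0_l sqrt_1.
lra.
Qed.

Lemma CV_radius_wnorm_le (p : C -> R) r M a x : (forall z, Rabs (p z) <= Cmod z) ->
  wnorm_le r M a -> Rabs x < r -> Rbar_lt (Rabs x) (CV_radius (fun n => p (a n))).
Proof.
move=> Hp Ha xr; have r0 : 0 <= r by have := Rabs_pos x; lra.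
apply: (Rbar_lt_le_trans _ r) => //.
case: (CV_radius_bounded (fun n => p (a n))) => Hub _; apply: Hub.
exists M => n; rewrite Rabs_mult -RPow_abs (Rabs_pos_eq r) //.
apply: Rle_trans (Ha n); apply: Rle_trans (wnorm_term _ _ r0).
by apply: Rmult_le_compat_r; [exact: pow_le | exact: Hp].
Qed.

Lemma CV_fst r M a x : wnorm_le r M a -> Rabs x < r ->
  Rbar_lt (Rabs x) (CV_radius (fun n => fst (a n))).
Proof. by apply: CV_radius_wnorm_le => z; case: (part_le_Cmod z). Qed.

Lemma CV_snd r M a x : wnorm_le r M a -> Rabs x < r ->
  Rbar_lt (Rabs x) (CV_radius (fun n => snd (a n))).
Proof. by apply: CV_radius_wnorm_le => z; case: (part_le_Cmod z). Qed.

Lemma ex_pseries_inside a x : Rbar_lt (Rabs x) (CV_radius a) -> ex_pseries a x.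
Proof. by move=> /CV_disk_inside H; apply/ex_pseries_R/ex_series_Rabs. Qed.

Lemma PS_multS a b n :
  PS_mult a b n.+1 = a O * b n.+1 + PS_mult (fun i => a i.+1) b n.
Proof.
rewrite /PS_mult decomp_sum; last lia.
by rewrite /= ; congr (_ + _); apply: sum_eq => i Hi; congr (_ * b _); lia.
Qed.

Lemma conv_parts a b n :
  conv a b n = (PS_mult (fun i => fst (a i)) (fun i => fst (b i)) n
                - PS_mult (fun i => snd (a i)) (fun i => snd (b i)) n,
                PS_mult (fun i => fst (a i)) (fun i => snd (b i)) n
                + PS_mult (fun i => snd (a i)) (fun i => fst (b i)) n).
Proof.
elim: n a => [|n IH] a; first by rewrite /PS_mult /=.
rewrite [LHS]/= IH !PS_multS /Cplus /Cmult /shift /=; congr pair; ring.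
Qed.

Lemma cpseries_conv r M M' a b x : wnorm_le r M a -> wnorm_le r M' b -> Rabs x < r ->
  cpseries (conv a b) x = Cmult (cpseries a x) (cpseries b x).
Proof.
move=> Ha Hb xr.
have [a1 a2 b1 b2] := And4 (CV_fst Ha xr) (CV_snd Ha xr) (CV_fst Hb xr) (CV_snd Hb xr).
have exm (p q : nat -> R) : Rbar_lt (Rabs x) (CV_radius p) ->
    Rbar_lt (Rabs x) (CV_radius q) -> ex_pseries (PS_mult p q) x.
  move=> Hp Hq; exists (PSeries p x * PSeries q x).
  by apply: is_pseries_mult => //; apply: PSeries_correct; exact: ex_pseries_inside.
rewrite /cpseries /Cmult /=; congr pair.
  rewrite -!PSeries_mult // -PSeries_minus; try exact: exm.
  by apply: PSeries_ext => n; rewrite conv_parts.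
rewrite -!PSeries_mult // -PSeries_plus; try exact: exm.
by apply: PSeries_ext => n; rewrite conv_parts.
Qed.

Lemma cpseries_add r M M' a b x : wnorm_le r M a -> wnorm_le r M' b -> Rabs x < r ->
  cpseries (fun n => Cplus (a n) (b n)) x = Cplus (cpseries a x) (cpseries b x).
Proof.
move=> Ha Hb xr.
have [a1 a2 b1 b2] := And4 (CV_fst Ha xr) (CV_snd Ha xr) (CV_fst Hb xr) (CV_snd Hb xr).
by rewrite /cpseries /Cplus /=; congr pair; rewrite -PSeries_plus; try exact: ex_pseries_inside.
Qed.

Lemma PSeries_part_le (p : C -> R) r M a x : (forall z, Rabs (p z) <= Cmod z) ->
  wnorm_le r M a -> Rabs x < r -> Rabs (PSeries (fun n => p (a n)) x) <= M.
Proof.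
move=> Hp Ha xr; have r0 : 0 <= r by have := Rabs_pos x; lra.
have Hex := CV_disk_inside _ _ (CV_radius_wnorm_le Hp Ha xr).
apply: Rle_trans (Series_Rabs _ Hex) _.
have : Rbar_le (Series (fun n => Rabs (p (a n) * x ^ n))) M; last by [].
apply: (is_lim_seq_le (sum_n (fun n => Rabs (p (a n) * x ^ n))) (fun=> M)).
- move=> n; apply: Rle_trans (Ha n); rewrite -wnorm_sum.
  apply: sum_n_m_le => k; rewrite Rabs_mult -RPow_abs.
  apply: Rmult_le_compat => //; try exact: Rabs_pos.
    by apply: pow_le; exact: Rabs_pos.
  by apply: pow_incr; split; [exact: Rabs_pos | lra].
- exact: (Series_correct _ Hex).
- exact: is_lim_seq_const.
Qed.

Lemma Cmod_cpseries r M a x : wnorm_le r M a -> Rabs x < r -> Cmod (cpseries a x) <= 2 * M.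
Proof.
move=> Ha xr; apply: Rle_trans (Cmod_le_parts _) _ => /=.
have := PSeries_part_le (fun z => proj1 (part_le_Cmod z)) Ha xr.
have := PSeries_part_le (fun z => proj2 (part_le_Cmod z)) Ha xr; lra.
Qed.

Lemma analytic_cpseries r M a F x : 0 < r -> wnorm_le r M a ->
  (forall y, Rabs (y - x) < r -> F y = cpseries a (y - x)) -> analytic_at F x.
Proof.
move=> r0 Ha HF; exists a, (mkposreal _ r0) => y /= yr; rewrite HF //.
apply/is_pseries_C; split; apply: PSeries_correct; apply: ex_pseries_inside.
  exact: (CV_fst Ha yr).
exact: (CV_snd Ha yr).
Qed.

Lemma CV_radius_sum_bound (p : nat -> R) r : 0 <= r -> Rbar_lt r (CV_radius p) ->
  exists M, forall n, sum_n (fun i => Rabs (p i) * r ^ i) n <= M.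
Proof.
move=> r0 Hr; have := CV_disk_inside p r; rewrite Rabs_pos_eq // => /(_ Hr) Hex.
exists (Series (fun n => Rabs (p n * r ^ n))) => n.
have -> : sum_n (fun i => Rabs (p i) * r ^ i) n = sum_n (fun n => Rabs (p n * r ^ n)) n.
  by apply: sum_n_ext => i; rewrite Rabs_mult -RPow_abs (Rabs_pos_eq r).
apply: (is_lim_seq_incr_compare (sum_n (fun n => Rabs (p n * r ^ n)))).
  exact: (Series_correct _ Hex).
move=> k; rewrite sum_Sn /Hierarchy.plus /=.
by have := Rabs_pos (p k.+1 * r ^ k.+1); rewrite /=; lra.
Qed.

Lemma analytic_wnorm_le F x : analytic_at F x -> exists r M a,
  [/\ 0 < r, wnorm_le r M a & forall y, Rabs (y - x) < r -> F y = cpseries a (y - x)].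
Proof.
case=> a [r Hr]; have r0 := cond_pos r.
have H1 y : Rabs (y - x) < r -> is_pseries (fun n => fst (a n)) (y - x) (fst (F y)).
  by move=> /Hr /is_pseries_C[].
have H2 y : Rabs (y - x) < r -> is_pseries (fun n => snd (a n)) (y - x) (snd (F y)).
  by move=> /Hr /is_pseries_C[].
have E : Rabs (x + r / 2 - x) = r / 2.
  have -> : x + r / 2 - x = r / 2 by ring.
  by apply: Rabs_pos_eq; lra.
have Hx : Rabs (x + r / 2 - x) < r by lra.
have := CV_radius_of_is_pseries H1 Hx; rewrite E => /CV_radius_sum_bound [|M1 HM1]; first lra.
have := CV_radius_of_is_pseries H2 Hx; rewrite E => /CV_radius_sum_bound [|M2 HM2]; first lra.
exists (r / 2), (M1 + M2), a; split; first lra.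
  move=> n; rewrite -wnorm_sum; apply: Rle_trans (Rplus_le_compat _ _ _ _ (HM1 n) (HM2 n)).
  have <- : sum_n (fun i => Rabs (fst (a i)) * (r / 2) ^ i + Rabs (snd (a i)) * (r / 2) ^ i) n =
      sum_n (fun i => Rabs (fst (a i)) * (r / 2) ^ i) n +
      sum_n (fun i => Rabs (snd (a i)) * (r / 2) ^ i) n.
    by apply: (sum_n_plus (fun i => Rabs (fst (a i)) * (r / 2) ^ i)).
  apply: sum_n_m_le => k.
  change (Cmod (a k) * (r / 2) ^ k <=
    Rabs (fst (a k)) * (r / 2) ^ k + Rabs (snd (a k)) * (r / 2) ^ k).
  rewrite -Rmult_plus_distr_r; apply: Rmult_le_compat_r; last exact: Cmod_le_parts.
  by apply: pow_le; lra.
move=> y Hy; have Hy' : Rabs (y - x) < r by lra.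
rewrite [F y]surjective_pairing /cpseries; congr pair; symmetry; apply: is_pseries_unique.
  exact: H1.
exact: H2.
Qed.

(** * Fixed-point equations in formal power series *)

Lemma conv_eq a a' b b' n : (forall i, (i <= n)%N -> a i = a' i) ->
  (forall i, (i <= n)%N -> b i = b' i) -> conv a b n = conv a' b' n.
Proof.
elim: n a a' => [|n IH] a a' Ha Hb /=; first by rewrite Ha // Hb.
rewrite Ha // Hb //; congr Cplus; apply: IH => i Hi; first exact: Ha.
by apply: Hb; exact: leqW.
Qed.

(** When the right factor has no constant term, the n-th coefficient of a product does not
   see the n-th coefficient of the left factor. *)
Lemma conv_eq_lt a a' b b' n : b O = RtoC 0 -> (forall i, (i < n)%N -> a i = a' i) ->
  (forall i, (i <= n)%N -> b i = b' i) -> conv a b n = conv a' b' n.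
Proof.
move=> b0; elim: n a a' => [|n IH] a a' Ha Hb /=.
  by rewrite -Hb // b0 !Cmult_0_r.
rewrite Ha // Hb //; congr Cplus; apply: IH => i Hi; first exact: Ha.
by apply: Hb; exact: leqW.
Qed.

(** The argument is the left factor of the product, the side on which [conv_eq_lt] gains a
   coefficient. *)
Fixpoint formal_horner (s : seq (nat -> C)) (v : nat -> C) : nat -> C :=
  match s with
  | [::] => fun=> RtoC 0
  | a :: s' => fun n => Cplus (conv v (formal_horner s' v) n) (a n)
  end.

Lemma formal_horner_eq s v v' n : (forall i, (i <= n)%N -> v i = v' i) ->
  formal_horner s v n = formal_horner s v' n.
Proof.
elim: s n => [|a s IH] n Hv //=; congr Cplus; apply: conv_eq => // i Hi.
by apply: IH => k Hk; apply: Hv; exact: leq_trans Hi.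
Qed.

Fixpoint all_wnorm_le (r M : R) (s : seq (nat -> C)) : Prop :=
  match s with [::] => True | a :: s' => wnorm_le r M a /\ all_wnorm_le r M s' end.

Lemma wnorm0 r n : wnorm r (fun=> RtoC 0) n = 0.
Proof.
elim: n => [|n IH] /=; rewrite Cmod_0 //.
by change (0 + r * wnorm r (fun=> RtoC 0) n = 0); rewrite IH; ring.
Qed.

Lemma wnorm_formal_horner r M s v n : 0 <= r -> 0 <= M -> all_wnorm_le r M s -> wnorm r v n <= 1 ->
  wnorm r (formal_horner s v) n <= INR (size s) * M.
Proof.
move=> r0 M0 Hs Hv; elim: s Hs => [|a s IH] /=.
  by move=> _; rewrite Rmult_0_l wnorm0; lra.
case=> Ha /IH {}IH.
have := wnorm_add (conv v (formal_horner s v)) a n r0.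
have := wnorm_conv v (formal_horner s v) n r0.
have := Ha n; have := wnorm_ge0 v n r0; have := wnorm_ge0 (formal_horner s v) n r0.
have : INR (size s).+1 = INR (size s) + 1 by rewrite S_INR.
rewrite /= => ->; nra.
Qed.

Lemma all_wnorm_le_mono r M r' M' s : 0 <= r' <= r -> M <= M' ->
  all_wnorm_le r M s -> all_wnorm_le r' M' s.
Proof.
move=> rr MM; elim: s => //= a s IH [Ha /IH ?]; split=> // n.
by have := wnorm_le_radius a n rr; have := Ha n; lra.
Qed.

Section FormalFixpoint.
Variables (r M eps : R) (w0 w1 : nat -> C) (s : seq (nat -> C)).
Hypotheses (r0 : 0 <= r) (M0 : 0 <= M) (eps01 : 0 < eps <= 1)
  (epsM : eps * (INR (size s) * M) <= 1 / 4)
  (w00 : w0 O = RtoC 0) (w10 : w1 O = RtoC 0)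
  (Hw0 : wnorm_le r (eps / 4) w0) (Hw1 : wnorm_le r (1 / 4) w1) (Hs : all_wnorm_le r M s).

Let F v := formal_horner (w0 :: w1 :: s) v.

Let picard m : nat -> C := iter m F (fun=> RtoC 0).

Let F_vanish v : v O = RtoC 0 -> F v O = RtoC 0.
Proof. by move=> v0; rewrite /F /= v0 w00 Cmult_0_l Cplus_0_r. Qed.

(** The unknown enters F only through its product with a series without constant term, so
   F determines one coefficient more than it is given; this makes the Picard iterates
   stabilize. *)
Let F_eq v v' n : v O = RtoC 0 -> v' O = RtoC 0 ->
  (forall i, (i < n)%N -> v i = v' i) -> F v n = F v' n.
Proof.
move=> v0 v0' Hv; rewrite /F [LHS]/= [RHS]/=; congr Cplus.
case: n Hv => [|n] Hv; first by rewrite /= v0 v0' !Cmult_0_l.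
rewrite [LHS]/= [RHS]/= v0 v0' !Cmult_0_l; congr Cplus.
apply: conv_eq_lt => [|i Hi|i Hi]; first by rewrite /= v0 w10 Cmult_0_l Cplus_0_r.
  exact: Hv.
apply: (@formal_horner_eq (w1 :: s)) => k Hk; apply: Hv; rewrite ltnS.
exact: leq_trans Hk Hi.
Qed.

Let picardS m : picard m.+1 = F (picard m). Proof. by []. Qed.

Let picard0 m : picard m O = RtoC 0.
Proof. by elim: m => // m IH; rewrite /picard iterS; exact: F_vanish. Qed.

Let picard_stable m n k : (n < m)%N -> picard (m + k) n = picard m n.
Proof.
elim: m n k => // m IH n k; rewrite ltnS => nm.
rewrite addSn !picardS; apply: F_eq => // i Hi; apply: IH; exact: leq_trans Hi nm.
Qed.

(** F maps the ball of radius eps into itself: the constant, linear and higher terms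
   contribute at most eps/4 each. *)
Let F_bound v n : wnorm r v n <= eps -> wnorm r (F v) n <= eps.
Proof.
move=> Hv; have Hv1 : wnorm r v n <= 1 by lra.
have H1 := wnorm_add (conv v (formal_horner (w1 :: s) v)) w0 n r0.
have H2 := wnorm_conv v (formal_horner (w1 :: s) v) n r0.
have H3 := wnorm_add (conv v (formal_horner s v)) w1 n r0.
have H4 := wnorm_conv v (formal_horner s v) n r0.
have H5 := wnorm_formal_horner r0 M0 Hs Hv1.
have H6 := wnorm_ge0 v n r0; have H7 := wnorm_ge0 (formal_horner s v) n r0.
have H8 := Hw0 n; have H9 := Hw1 n.
have H10 : wnorm r v n * wnorm r (formal_horner s v) n <= eps * (INR (size s) * M).
  by apply: Rmult_le_compat.
have H11 : wnorm r (formal_horner (w1 :: s) v) n <= 1 / 2.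
  by apply: Rle_trans H3 _; lra.
have H12 : wnorm r v n * wnorm r (formal_horner (w1 :: s) v) n <= eps * (1 / 2).
  by apply: Rmult_le_compat => //; exact: wnorm_ge0.
by apply: Rle_trans H1 _; lra.
Qed.

Let picard_bound m n : wnorm r (picard m) n <= eps.
Proof.
elim: m => [|m IH]; last by rewrite picardS; exact: F_bound.
by rewrite /picard /= wnorm0; lra.
Qed.

Lemma formal_fixpoint : exists v, [/\ v O = RtoC 0, wnorm_le r eps v &
  forall n, formal_horner (w0 :: w1 :: s) v n = v n].
Proof.
(* The n-th coefficient is final after n + 1 iterations. *)
pose v n := picard n.+1 n.
have vE m n : (n < m)%N -> v n = picard m n.
  by move=> nm; rewrite /v -(@picard_stable n.+1 n (m - n.+1)) // subnKC.
have v0 : v O = RtoC 0 by exact: picard0.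
exists v; split=> // n; first by rewrite (@wnorm_ext r v (picard n.+1)) // => i Hi; exact: vE.
rewrite -/(F v) (@F_eq v (picard n)) //.
by move=> i Hi; exact: vE.
Qed.

End FormalFixpoint.

Lemma cpseries_formal_horner r M s v x :
  0 <= M -> all_wnorm_le r M s -> wnorm_le r 1 v -> Rabs x < r ->
  cpseries (formal_horner s v) x = horner_rec [seq cpseries a x | a <- s] (cpseries v x).
Proof.
move=> M0 Hs Hv xr; have r0 : 0 <= r by have := Rabs_pos x; lra.
elim: s Hs => [|a s IH] /=; first by rewrite /cpseries !PSeries_const_0.
case=> Ha Hs; rewrite -(IH Hs).
have Hh : wnorm_le r (INR (size s) * M) (formal_horner s v).
  by move=> n; apply: wnorm_formal_horner.
have Hc : wnorm_le r (1 * (INR (size s) * M)) (conv v (formal_horner s v)).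
  move=> n; apply: Rle_trans (wnorm_conv _ _ _ r0) _.
  by apply: Rmult_le_compat => //; exact: wnorm_ge0.
by rewrite (cpseries_add Hc Ha xr) (cpseries_conv Hv Hh xr) Cmult_comm.
Qed.

Fixpoint all_le (M : R) (s : seq C) : Prop :=
  match s with [::] => True | c :: s' => Cmod c <= M /\ all_le M s' end.

Lemma Cmod_horner_rec M s z : 0 <= M -> all_le M s -> Cmod z <= 1 ->
  Cmod (horner_rec s z) <= INR (size s) * M.
Proof.
move=> M0 + Hz; elim: s => [|c s IH] /=; first by rewrite Cmod_0; lra.
case=> Hc /IH {}IH.
have := Cmod_triangle (Cmult (horner_rec s z) z) c; rewrite Cmod_mult.
have := Cmod_ge_0 z; have := Cmod_ge_0 (horner_rec s z).
have : INR (size s).+1 = INR (size s) + 1 by rewrite S_INR.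
rewrite /= => ->; rewrite /GRing.add /GRing.mul /=; nra.
Qed.

Lemma horner_rec_lipschitz M s a b : 0 <= M -> all_le M s -> Cmod a <= 1 -> Cmod b <= 1 ->
  Cmod (Cminus (horner_rec s a) (horner_rec s b)) <= INR (size s) ^ 2 * M * Cmod (Cminus a b).
Proof.
move=> M0 + Ha Hb; elim: s => [|c s IH] /=.
  by move=> _; rewrite /Cminus Cplus_opp_r Cmod_0; lra.
case=> Hc Hs; have {}IH := IH Hs.
have -> : Cminus (horner_rec s a * a + c)%R (horner_rec s b * b + c)%R =
  Cplus (Cmult (horner_rec s a) (Cminus a b))
        (Cmult b (Cminus (horner_rec s a) (horner_rec s b))).
  by rewrite /GRing.add /GRing.mul /=; ring.
apply: Rle_trans (Cmod_triangle _ _) _; rewrite !Cmod_mult.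
have H1 := Cmod_horner_rec M0 Hs Ha.
have := Cmod_ge_0 (Cminus a b); have := Cmod_ge_0 (horner_rec s a).
have := Cmod_ge_0 b; have := Cmod_ge_0 (Cminus (horner_rec s a) (horner_rec s b)).
have : INR (size s).+1 = INR (size s) + 1 by rewrite S_INR.
rewrite /= => ->; set d := Cmod (Cminus a b); set n := INR (size s).
have n0 : 0 <= n by exact: pos_INR.
move=> D0 B0 A0 d0.
have H2 : Cmod (horner_rec s a) * d <= n * M * d by apply: Rmult_le_compat_r.
have H3 : Cmod b * Cmod (Cminus (horner_rec s a) (horner_rec s b)) <= 1 * (n ^ 2 * M * d).
  by apply: Rmult_le_compat.
have H4 : 0 <= M * d by exact: Rmult_le_pos.
have H5 : 0 <= n * (M * d) by exact: Rmult_le_pos.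
rewrite /= in H3; nra.
Qed.

(** The linear coefficient is at most 1/4 and the higher terms have Lipschitz constant at
   most 1/2 on the ball of radius eps. *)
Lemma horner_rec_contraction M eps w0 w1 s a b : 0 <= M -> eps <= 1 ->
  Cmod w1 <= 1 / 4 -> all_le M s -> eps * (INR (size s).+1 ^ 2 * M) <= 1 / 8 ->
  Cmod a <= eps -> Cmod b <= eps ->
  Cmod (Cminus (horner_rec [:: w0, w1 & s] a) (horner_rec [:: w0, w1 & s] b))
    <= 3 / 4 * Cmod (Cminus a b).
Proof.
move=> M0 e1 Hw1 Hs He Ha Hb.
have Ha1 : Cmod a <= 1 by lra. have Hb1 : Cmod b <= 1 by lra.
have -> : Cminus (horner_rec [:: w0, w1 & s] a) (horner_rec [:: w0, w1 & s] b) =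
  Cplus (Cmult (Cminus a b) (Cplus w1 (Cmult (horner_rec s a) (Cplus a b))))
        (Cmult (Cmult b b) (Cminus (horner_rec s a) (horner_rec s b))).
  by rewrite /= /GRing.add /GRing.mul /=; ring.
apply: Rle_trans (Cmod_triangle _ _) _; rewrite !Cmod_mult.
have H1 := Cmod_horner_rec M0 Hs Ha1.
have H2 := horner_rec_lipschitz M0 Hs Ha1 Hb1.
have H3 := Cmod_triangle w1 (Cmult (horner_rec s a) (Cplus a b)).
have H4 := Cmod_triangle a b; rewrite Cmod_mult in H3.
have A0 := Cmod_ge_0 a; have B0 := Cmod_ge_0 b.
have h0 := Cmod_ge_0 (horner_rec s a); have d0 := Cmod_ge_0 (Cminus a b).
have dh0 := Cmod_ge_0 (Cminus (horner_rec s a) (horner_rec s b)).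
have ab0 := Cmod_ge_0 (Cplus a b).
have En : INR (size s).+1 = INR (size s) + 1 by rewrite S_INR.
rewrite En in He; move: H1 H2 He En; set n := INR (size s) => H1 H2 He _.
have n0 : 0 <= n by exact: pos_INR.
have e0 : 0 <= eps by lra.
set d := Cmod (Cminus a b) in H2 d0 *.
have K : 0 <= eps * M by exact: Rmult_le_pos.
have K1 : 0 <= n * (eps * M) by exact: Rmult_le_pos.
have K2 : 0 <= n * (n * (eps * M)) by exact: Rmult_le_pos.
have H5 : Cmod (horner_rec s a) * Cmod (Cplus a b) <= (n * M) * (2 * eps).
  by apply: Rmult_le_compat => //; lra.
have H6 : Cmod (Cplus w1 (Cmult (horner_rec s a) (Cplus a b))) <= 1 / 2 by nra.
have H7 : Cmod b * Cmod b <= eps * 1 by apply: Rmult_le_compat.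
have H8 : Cmod b * Cmod b * Cmod (Cminus (horner_rec s a) (horner_rec s b)) <=
   eps * 1 * (n ^ 2 * M * d).
  by apply: Rmult_le_compat => //; exact: Rmult_le_pos.
have H9 : eps * 1 * (n ^ 2 * M * d) <= 1 / 4 * d.
  have -> : eps * 1 * (n ^ 2 * M * d) = (eps * (n ^ 2 * M)) * d by ring.
  by apply: Rmult_le_compat_r => //; rewrite /= in He *; nra.
have := Rmult_le_compat_l _ _ _ d0 H6; lra.
Qed.

(** * Analytic solutions of fixed-point equations *)

Definition eventually_at (x : R) (Q : R -> Prop) : Prop :=
  exists d, 0 < d /\ forall y, Rabs (y - x) < d -> Q y.

Lemma eventually_and x Q Q' : eventually_at x Q -> eventually_at x Q' ->
  eventually_at x (fun y => Q y /\ Q' y).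
Proof.
move=> [d [d0 Hd]] [e [e0 He]]; exists (Rmin d e); split; first exact: Rmin_pos.
move=> y Hy; split; [apply: Hd | apply: He]; apply: Rlt_le_trans Hy _;
  [exact: Rmin_l | exact: Rmin_r].
Qed.

Lemma eventually_impl x (Q Q' : R -> Prop) : (forall y, Q y -> Q' y) ->
  eventually_at x Q -> eventually_at x Q'.
Proof. by move=> H [d [d0 Hd]]; exists d; split=> // y /Hd /H. Qed.

Lemma eventually_self x Q : eventually_at x Q -> Q x.
Proof. by move=> [d [d0 Hd]]; apply: Hd; rewrite Rminus_diag Rabs_R0. Qed.

(** The product uniform structure of C and the one given by its modulus are different
   objects with the same topology; this form of continuity serves both. *)
Definition Ccont_at (F : R -> C) (x : R) : Prop :=
  forall e, 0 < e -> eventually_at x (fun y => Cmod (Cminus (F y) (F x)) < e).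

Lemma continuous_eventually (F : R -> R) x e : continuous F x -> 0 < e ->
  eventually_at x (fun y => Rabs (F y - F x) < e).
Proof.
move=> /filterlim_locally H e0; have [d Hd] := H (mkposreal _ e0).
by exists d; split; [exact: cond_pos | move=> y Hy; apply: (Hd y)].
Qed.

Lemma Ccont_parts (F : R -> C) (x : R) : continuous (fun y => fst (F y)) x ->
  continuous (fun y => snd (F y)) x -> Ccont_at F x.
Proof.
move=> F1 F2 e e0; have e2 : 0 < e / 2 by lra.
have := eventually_and (continuous_eventually F1 e2) (continuous_eventually F2 e2).
apply: eventually_impl => y [H1 H2]; apply: Rle_lt_trans (Cmod_le_parts _) _.
by rewrite /= -!/(Rminus _ _); lra.
Qed.

Lemma analytic_Ccont F x : analytic_at F x -> Ccont_at F x.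
Proof.
move=> /analytic_at_components[/ranalytic_continuous F1 /ranalytic_continuous F2].
exact: Ccont_parts.
Qed.

Lemma Ccont_small F x e : Ccont_at F x -> F x = RtoC 0 -> 0 < e ->
  eventually_at x (fun y => Cmod (F y) < e).
Proof.
move=> HF F0 /HF; apply: eventually_impl => y; rewrite F0.
by have -> : Cminus (F y) 0 = F y by ring.
Qed.

Lemma analytic_seq_wnorm_le (ws : seq (R -> C)) x : (forall w, List.In w ws -> analytic_at w x) ->
  exists r M s, [/\ 0 < r, 0 <= M, all_wnorm_le r M s, size s = size ws &
    forall y, Rabs (y - x) < r -> [seq w y | w <- ws] = [seq cpseries a (y - x) | a <- s]].
Proof.
elim: ws => [|w ws IH] H.
  by exists 1, 0, [::]; split=> //=; lra.
have [|r [M [s [r0 M0 Hs sz E]]]] := IH; first by move=> v Hv; apply: H; right.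
have [r' [M' [a [r'0 Ha E']]]] := analytic_wnorm_le (H w (or_introl erefl)).
have Hr : 0 < Rmin r r' by exact: Rmin_pos.
have [L1 L2] := (Rmin_l r r', Rmin_r r r').
have [L3 L4] := (Rmax_l M M', Rmax_r M M').
exists (Rmin r r'), (Rmax M M'), (a :: s); split=> //=.
- lra.
- split; last by apply: all_wnorm_le_mono Hs; lra.
  have [] // : all_wnorm_le (Rmin r r') (Rmax M M') [:: a].
  by apply: (@all_wnorm_le_mono r' M') => //; lra.
- by rewrite sz.
- by move=> y Hy; rewrite E; [rewrite E' //; lra | lra].
Qed.

Lemma all_le_near (ws : seq (R -> C)) x : (forall w, List.In w ws -> analytic_at w x) ->
  exists M, 0 <= M /\ eventually_at x (fun y => all_le M [seq w y | w <- ws]).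
Proof.
elim: ws => [|w ws IH] H; first by exists 0; split; [lra | exists 1; split=> //; lra].
have [|M [M0 HM]] := IH; first by move=> v Hv; apply: H; right.
have Hw : Ccont_at w x by apply: analytic_Ccont; apply: H; left.
have w0 := Cmod_ge_0 (w x).
exists (M + Cmod (w x) + 1); split; first lra.
have := eventually_and HM (Hw 1 Rlt_0_1); apply: eventually_impl => y [Hy Hwy] /=; split.
  have := Cmod_triangle (Cminus (w y) (w x)) (w x).
  have -> : Cplus (Cminus (w y) (w x)) (w x) = w y by ring.
  lra.
by elim: [seq _ | _ <- _] Hy => //= c s IHs [Hc /IHs ?]; split=> //; lra.
Qed.

Lemma wnorm_le_scale r M t a : a O = RtoC 0 -> 0 <= t <= 1 -> 0 <= r ->
  wnorm_le r M a -> wnorm_le (t * r) (t * M) a.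
Proof.
move=> a0 t01 r0 Ha n; apply: Rle_trans (wnorm_small_radius n a0 t01 r0) _.
by apply: Rmult_le_compat_l => //; lra.
Qed.

(** The formal solution converges to an analytic function F. Near x both F and v are small
   solutions of the same equation, whose right-hand side is a contraction, so they
   agree. *)
Theorem analytic_fixpoint x (w0 w1 : R -> C) (ws : seq (R -> C)) (v : R -> C) :
  analytic_at w0 x -> analytic_at w1 x -> (forall w, List.In w ws -> analytic_at w x) ->
  w0 x = RtoC 0 -> w1 x = RtoC 0 -> v x = RtoC 0 -> Ccont_at v x ->
  eventually_at x (fun y => v y = horner_rec [:: w0 y, w1 y & [seq w y | w <- ws]] (v y)) ->
  analytic_at v x.
Proof.
move=> A0 A1 Aws w00 w10 v0 Cv Ev.
have A w : List.In w [:: w0, w1 & ws] -> analytic_at w x by case=> [<-|[<-|/Aws]].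
have [r [M [s [r0 M0 Hs sz E]]]] := analytic_seq_wnorm_le A.
case: s Hs sz E => [|a0 [|a1 s]] //= [Ha0 [Ha1 Hs]] [sz] E.
have [M' [M'0 HM']] := all_le_near Aws.
have Ex := E x ltac:(by rewrite Rminus_diag Rabs_R0).
have cps0 a : cpseries a (x - x) = a O.
  by rewrite /cpseries Rminus_diag !PSeries_0 -surjective_pairing.
move: Ex; rewrite !cps0 w00 w10 => -[a00 a10 _].
set n := INR (size ws).+1.
have n1 : 1 <= n by rewrite /n S_INR; have := pos_INR (size ws); lra.
have nE : INR (size ws) = n - 1 by rewrite /n S_INR; lra.
(* The choice eps = 1/K meets the smallness conditions of [formal_fixpoint] and of
   [horner_rec_contraction]; the factor t shrinks the radius until the series of w0
   and w1 fall below eps/4. *)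
pose K := 8 * n ^ 2 * (M + M' + 1).
have K1 : 1 <= K by rewrite /K /=; nra.
pose eps := / K.
have Ke : K * eps = 1 by rewrite /eps Rinv_r //; lra.
have e0 : 0 < eps by apply: Rinv_0_lt_compat; lra.
have e1 : eps <= 1 by nra.
have e8 : eps * n ^ 2 * (M + M' + 1) = 1 / 8 by rewrite /K in Ke; nra.
have en0 : 0 <= eps * n ^ 2 by apply: Rmult_le_pos; [lra | apply: pow_le; lra].
have enn : eps * n <= eps * n ^ 2 by rewrite /=; nra.
pose t := eps / (4 * (M + 1)).
have t0 : 0 < t by apply: Rdiv_lt_0_compat; lra.
have tE : t * (4 * (M + 1)) = eps by rewrite /t; field; lra.
have t1 : t <= 1 by nra.
have tM : t * M <= eps / 4 by nra.
have trr : 0 <= t * r <= r by nra.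
have [||||||||| f [f0 Hf Ef]] := @formal_fixpoint (t * r) M eps a0 a1 s.
- lra.
- done.
- lra.
- rewrite sz nE; have : eps * n * M <= eps * n ^ 2 * M by apply: Rmult_le_compat_r.
  nra.
- by [].
- by [].
- by move=> k; apply: Rle_trans tM; apply: wnorm_le_scale => //; lra.
- move=> k; have : wnorm_le (t * r) (t * M) a1 by apply: wnorm_le_scale => //; lra.
  by move=> /(_ k); lra.
- by apply: all_wnorm_le_mono Hs; lra.
have Hf1 : wnorm_le (t * r) 1 f by move=> k; have := Hf k; lra.
pose F y := cpseries f (y - x).
have tr0 : 0 < t * r by exact: Rmult_lt_0_compat.
have AF : analytic_at F x by exact: (analytic_cpseries tr0 Hf).
have F0 : F x = RtoC 0 by rewrite /F cps0.
have EF y : Rabs (y - x) < t * r ->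
    F y = horner_rec [:: w0 y, w1 y & [seq w y | w <- ws]] (F y).
  move=> Hy; rewrite E; last lra.
  rewrite /F -(@cpseries_formal_horner (t * r) M (a0 :: a1 :: s)) //=.
    by rewrite /cpseries; congr pair; apply: PSeries_ext => k; rewrite -[in LHS]Ef.
  by split; [|split]; [move=> k; apply: Rle_trans (wnorm_le_radius _ _ trr) _; exact: Ha0
   |move=> k; apply: Rle_trans (wnorm_le_radius _ _ trr) _; exact: Ha1
   |apply: all_wnorm_le_mono Hs; lra].
have C1 : Ccont_at w1 x by exact: analytic_Ccont.
have [d [d0 Hd]] : eventually_at x (fun y => F y = v y).
  have Htr : eventually_at x (fun y => Rabs (y - x) < t * r) by exists (t * r).
  have := eventually_and (eventually_and (eventually_and HM' Htr)
    (eventually_and Ev (Ccont_small C1 w10 (ltac:(lra) : 0 < 1 / 4))))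
    (eventually_and (Ccont_small Cv v0 e0) (Ccont_small (analytic_Ccont AF) F0 e0)).
  apply: eventually_impl => y [[[H1 H2] [H3 H4]] [H5 H6]].
  have := @horner_rec_contraction M' eps (w0 y) (w1 y) [seq w y | w <- ws] (F y) (v y).
  rewrite -H3 -EF // size_map -/n => H.
  have {}H := H M'0 e1 ltac:(lra) H1 ltac:(nra) ltac:(lra) ltac:(lra).
  have Hz : Cminus (F y) (v y) = RtoC 0.
    by apply: Cmod_eq_0; have := Cmod_ge_0 (Cminus (F y) (v y)); lra.
  have -> : F y = Cplus (Cminus (F y) (v y)) (v y) by ring.
  by rewrite Hz; ring.
by apply: (analytic_near (r := mkposreal _ d0)) AF => y /= /Hd.
Qed.

Lemma Ccont_inv h x : Ccont_at h x -> h x <> RtoC 0 -> Ccont_at (fun y => Cinv (h y)) x.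
Proof.
move=> Ch hx e e0; have m0 := proj1 (Cmod_gt_0 _) hx; set m := Cmod (h x) in m0.
have d0 : 0 < Rmin (m / 2) (e * m * m / 2).
  by apply: Rmin_pos; [lra | have := Rmult_lt_0_compat _ _ (Rmult_lt_0_compat _ _ e0 m0) m0; lra].
have := Ch _ d0; apply: eventually_impl => y Hy.
have [L1 L2] := (Rmin_l (m / 2) (e * m * m / 2), Rmin_r (m / 2) (e * m * m / 2)).
have Hm : m / 2 < Cmod (h y).
  have := Cmod_triangle (h y) (Cminus (h x) (h y)).
  have -> : Cplus (h y) (Cminus (h x) (h y)) = h x by ring.
  have -> : Cmod (Cminus (h x) (h y)) = Cmod (Cminus (h y) (h x)).
    by rewrite -Cmod_opp; congr Cmod; ring.
  by rewrite -/m; lra.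
have hy : h y <> RtoC 0 by move=> hy; move: Hm; rewrite hy Cmod_0; lra.
have -> : Cminus (Cinv (h y)) (Cinv (h x)) =
    Cmult (Copp (Cminus (h y) (h x))) (Cinv (Cmult (h y) (h x))) by field.
rewrite Cmod_mult Cmod_opp Cmod_inv ?Cmod_mult; last by apply: Cmult_neq_0.
apply: (Rmult_lt_reg_r (Cmod (h y) * m)); first by apply: Rmult_lt_0_compat; lra.
rewrite Rmult_assoc Rinv_l; last by apply: Rgt_not_eq; apply: Rmult_lt_0_compat; rewrite -/m; lra.
have : m / 2 * (e * m) < Cmod (h y) * (e * m).
  by apply: Rmult_lt_compat_r => //; exact: Rmult_lt_0_compat.
lra.
Qed.

(** Put e = 1 - h / h(x), which vanishes at x. Then 1/h = (1 + v) / h(x), where v solves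
   v = e + e v. *)
Lemma analytic_inv h x : analytic_at h x -> h x <> RtoC 0 -> analytic_at (fun y => Cinv (h y)) x.
Proof.
move=> Ah hx; have Ch := analytic_Ccont Ah.
pose c := Cinv (h x).
pose e y := Cplus (RtoC 1) (Copp (Cmult c (h y))).
have Ae : analytic_at e x.
  apply: analytic_plus; first exact: analytic_const.
  by apply/analytic_opp/analytic_mult => //; exact: analytic_const.
have e0 : e x = RtoC 0 by rewrite /e /c; field.
pose v y := Cminus (Cmult (h x) (Cinv (h y))) (RtoC 1).
have Hnz : eventually_at x (fun y => h y <> RtoC 0).
  have := Ch _ (proj1 (Cmod_gt_0 _) hx); apply: eventually_impl => y Hy hy.
  move: Hy; rewrite hy; have -> : Cminus (RtoC 0) (h x) = Copp (h x) by ring.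
  by rewrite Cmod_opp; lra.
have Av : analytic_at v x.
  apply: (@analytic_fixpoint x e e [::]) => //.
  - by rewrite /v; field.
  - move=> d d0; have m0 := proj1 (Cmod_gt_0 _) hx.
    have := Ccont_inv Ch hx (Rdiv_lt_0_compat _ _ d0 m0); apply: eventually_impl => y Hy.
    have -> : Cminus (v y) (v x) = Cmult (h x) (Cminus (Cinv (h y)) (Cinv (h x))).
      by rewrite /v; ring.
    rewrite Cmod_mult; have := Rmult_lt_compat_l _ _ _ m0 Hy.
    by have -> : Cmod (h x) * (d / Cmod (h x)) = d by [field; lra].
  - apply: eventually_impl Hnz => y hy; rewrite /= /GRing.add /GRing.mul /= /v /e /c.
    by rewrite /GRing.zero /=; field.
have A2 : analytic_at (fun y => Cmult c (Cplus (v y) (RtoC 1))) x.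
  apply: analytic_mult; first exact: analytic_const.
  by apply: analytic_plus => //; exact: analytic_const.
case: Hnz => d [d0 Hd]; apply: (analytic_near (r := mkposreal _ d0)) A2 => y /= /Hd hy.
by rewrite /v /c; field.
Qed.

(** * Roots of polynomials with analytic right-hand side *)

Lemma C_addE (x y : C) : (x + y)%R = Cplus x y. Proof. by []. Qed.
Lemma C_mulE (x y : C) : (x * y)%R = Cmult x y. Proof. by []. Qed.
Lemma C_oppE (x : C) : (- x)%R = Copp x. Proof. by []. Qed.
Lemma C_invE (x : C) : (x^-1)%R = Cinv x. Proof. by []. Qed.
Lemma C_zeroE : (0%R : C) = RtoC 0. Proof. by []. Qed.
Lemma C_oneE : (1%R : C) = RtoC 1. Proof. by []. Qed.
Definition C_ringE := (C_addE, C_mulE, C_oppE, C_invE, C_zeroE, C_oneE).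

(** The Taylor coefficients at z; a nonzero derivative guarantees that the first two are
   present. *)
Lemma taylor_seq (P : {poly C}) (z : C) : (P^`()).[z]%R <> RtoC 0 ->
  exists s, forall v, P.[Cplus z v]%R = horner_rec [:: P.[z]%R, (P^`()).[z]%R & s] v.
Proof.
move=> P'z; pose Q := (P \Po ('X + z%:P))%R.
have HQ v : P.[Cplus z v]%R = horner_rec Q v.
  by rewrite -[RHS]/(Q.[v])%R horner_comp !hornerE; congr (P.[_])%R; exact: Cplus_comm.
have Q0 : (Q`_0)%R = P.[z]%R by rewrite -horner_coef0 horner_comp !hornerE ?add0r.
have Q1 : (Q`_1)%R = (P^`()).[z]%R.
  have -> : (Q`_1 = (Q^`())`_0)%R by rewrite coef_deriv.
  rewrite -horner_coef0 deriv_comp derivD derivX derivC addr0 mulr1 horner_comp.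
  by rewrite !hornerE ?add0r.
move: HQ Q0 Q1; case: (polyseq Q) => [|a0 [|a1 s]] //= HQ Q0 Q1; try by rewrite -Q1 in P'z.
by exists s => v; rewrite HQ Q0 Q1.
Qed.

Lemma horner_rec_scale (c : C) s v :
  horner_rec [seq Cmult c x | x <- s] v = Cmult c (horner_rec s v).
Proof.
elim: s => [|a s IH] /=; first by rewrite C_ringE; ring.
by rewrite IH !C_ringE; ring.
Qed.

(** Dividing by the derivative and solving for the linear term turns P(z + v) = w into a
   fixed-point equation without linear part. *)
Lemma taylor_fixpoint (P : {poly C}) (z : C) : (P^`()).[z]%R <> RtoC 0 ->
  exists s, forall w v : C, P.[Cplus z v]%R = w <->
    v = horner_rec [:: Cdiv (Cminus w P.[z]%R) (P^`()).[z]%R, RtoC 0 & s] v.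
Proof.
move=> P'z; have [s Hs] := taylor_seq P'z.
exists [seq Cmult (Copp (Cinv (P^`()).[z]%R)) x | x <- s] => w v.
rewrite Hs /= horner_rec_scale !C_ringE.
set a := P.[z]%R; set b := (P^`()).[z]%R in P'z *; set h := horner_rec s v.
split.
  move=> <-; field; exact: P'z.
move=> E; have -> : Cplus (Cmult (Cplus (Cmult h v) b) v) a =
  Cplus (Cplus (Cmult b v) a) (Cmult h (Cmult v v)) by ring.
by rewrite {1}E; field; exact: P'z.
Qed.

(** With v = u - u(x), [taylor_fixpoint] brings P(u) = w to the form of
   [analytic_fixpoint]. *)
Lemma analytic_root (P : {poly C}) (u w : R -> C) x :
  analytic_at w x -> Ccont_at u x -> eventually_at x (fun y => P.[u y]%R = w y) ->
  (P^`()).[u x]%R <> RtoC 0 -> analytic_at u x.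
Proof.
move=> Aw Cu Eu P'u; have [s Hs] := taylor_fixpoint P'u.
have Eux := eventually_self Eu.
pose v y := Cminus (u y) (u x).
have uE y : u y = Cplus (u x) (v y) by rewrite /v; ring.
have Av : analytic_at v x.
  pose k := Cinv (P^`()).[u x]%R.
  apply: (@analytic_fixpoint x (fun y => Cmult (Cplus (w y) (Copp (w x))) k) (fun=> RtoC 0)
            [seq (fun=> c) | c <- s]).
  - apply: analytic_mult; last exact: analytic_const.
    by apply: analytic_plus => //; exact: analytic_const.
  - exact: analytic_const.
  - move=> f; elim: s {Hs} => //= c s IH [<-|/IH //]; exact: analytic_const.
  - by ring.
  - by [].
  - by rewrite /v; ring.
  - move=> e /Cu; apply: eventually_impl => y.
    have -> : Cminus (v y) (v x) = Cminus (u y) (u x) by (rewrite /v; ring).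
    by [].
  - apply: eventually_impl Eu => y; rewrite {1}uE => /Hs {1}->.
    by rewrite -map_comp (@eq_map _ _ _ id) // map_id Eux.
apply: (analytic_near (r := mkposreal _ Rlt_0_1)) (analytic_plus (analytic_const (u x) x) Av).
by move=> y _; rewrite -uE.
Qed.

(** The difference quotient of a polynomial is again a polynomial, with the derivative as
   its value on the diagonal. *)
Lemma poly_slope (P : {poly C}) (b : C) : exists Q : {poly C},
  Q.[b]%R = (P^`()).[b]%R /\
  forall a, Cminus P.[a]%R P.[b]%R = Cmult (Cminus a b) Q.[a]%R.
Proof.
have [Q HQ] : exists Q, (P - P.[b]%:P = Q * ('X - b%:P))%R.
  by apply/factor_theorem; rewrite /root !hornerE subrr.
exists Q; split.
  have := congr1 (@deriv _) HQ; rewrite derivB derivC subr0 => ->.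
  by rewrite derivM derivB derivX derivC subr0 mulr1 hornerD hornerM hornerXsubC subrr mulr0 add0r.
move=> a; have := congr1 (fun p => p.[a]%R) HQ; rewrite !hornerE /= => E.
exact: etrans E (Cmult_comm _ _).
Qed.

Lemma all_le_ex s : exists M, 0 <= M /\ all_le M s.
Proof.
elim: s => [|c s [M [M0 HM]]]; first by exists 0; split=> //; lra.
have c0 := Cmod_ge_0 c; exists (M + Cmod c); split; first lra.
split; first lra.
by elim: s HM => //= d s IHs [Hd /IHs ?]; split=> //; lra.
Qed.

Lemma poly_Ccont (Q : {poly C}) (b : C) e : 0 < e ->
  exists d, 0 < d /\ forall a, Cmod (Cminus a b) < d -> Cmod (Cminus Q.[a]%R Q.[b]%R) < e.
Proof.
move=> e0; pose R := (Q \Po ('X + b%:P))%R.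
have HR v : Q.[Cplus b v]%R = horner_rec R v.
  by rewrite -[RHS]/(R.[v])%R horner_comp !hornerE; congr (Q.[_])%R; exact: Cplus_comm.
have [M [M0 HM]] := all_le_ex R.
set L := INR (size R) ^ 2 * M.
have L0 : 0 <= L by apply: Rmult_le_pos => //; exact: pow2_ge_0.
exists (Rmin 1 (e / (L + 1))); split.
  by apply: Rmin_pos; [lra | apply: Rdiv_lt_0_compat; lra].
move=> a Ha; have := Rmin_l 1 (e / (L + 1)); have := Rmin_r 1 (e / (L + 1)) => H2 H1.
have -> : a = Cplus b (Cminus a b) by ring.
have E0 : Q.[b]%R = horner_rec R (RtoC 0) by rewrite -HR; congr (Q.[_])%R; exact/esym/Cplus_0_r.
rewrite HR E0; apply: Rle_lt_trans (horner_rec_lipschitz M0 HM _ _) _.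
- by lra.
- by rewrite Cmod_0; lra.
- have -> : Cminus (Cminus a b) (RtoC 0) = Cminus a b by ring.
  rewrite -/L; have {}Ha : Cmod (Cminus a b) < e / (L + 1) by lra.
  have Hm := Cmod_ge_0 (Cminus a b).
  have : (L + 1) * Cmod (Cminus a b) < (L + 1) * (e / (L + 1)) by apply: Rmult_lt_compat_l; lra.
  have -> : (L + 1) * (e / (L + 1)) = e by field; lra.
  by nra.
Qed.

Lemma C_is_derive_intro (f : C -> C) (d l : C) :
  (forall e, 0 < e -> exists r, 0 < r /\ forall y, Cmod (Cminus y d) < r ->
    Cmod (Cminus (Cminus (f y) (f d)) (Cmult (Cminus y d) l)) <= e * Cmod (Cminus y d)) ->
  @ex_derive C_AbsRing C_NormedModule f d.
Proof.
move=> H; exists l; split; first exact: is_linear_scal_l.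
move=> x Hx; have <- : d = x := is_filter_lim_locally_unique _ _ Hx.
move=> e; have [r [r0 Hr]] := H e (cond_pos e).
by exists (mkposreal _ r0) => y Hy; exact: Hr.
Qed.

Lemma C_ex_derive_lipschitz (f : C -> C) (d : C) :
  @ex_derive C_AbsRing C_NormedModule f d ->
  exists L r, [/\ 0 < L, 0 < r & forall y, Cmod (Cminus y d) < r ->
    Cmod (Cminus (f y) (f d)) <= L * Cmod (Cminus y d)].
Proof.
case=> l [_ Hl]; have [r Hr] := Hl d (fun P HP => HP) (mkposreal _ Rlt_0_1).
have l0 := Cmod_ge_0 l.
exists (1 + Cmod l), r; split; [lra | exact: cond_pos |] => y Hy.
have {}Hr : Cmod (Cminus (Cminus (f y) (f d)) (Cmult (Cminus y d) l)) <= 1 * Cmod (Cminus y d).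
  exact: (Hr y Hy).
have := Cmod_triangle (Cminus (Cminus (f y) (f d)) (Cmult (Cminus y d) l)) (Cmult (Cminus y d) l).
have -> : Cplus (Cminus (Cminus (f y) (f d)) (Cmult (Cminus y d) l)) (Cmult (Cminus y d) l) =
  Cminus (f y) (f d) by ring.
by rewrite Cmod_mult; lra.
Qed.

Lemma open_C_near (Omega : C -> Prop) d : @open C_UniformSpace Omega -> Omega d ->
  exists r, 0 < r /\ forall y, Cmod (Cminus y d) < r -> Omega y.
Proof.
move=> HO /HO [r Hr]; exists r; split; first exact: cond_pos.
move=> y Hy; apply: Hr; have [H1 H2] := part_le_Cmod (Cminus y d).
by split; rewrite /ball /= /AbsRing_ball /=; apply: Rle_lt_trans Hy.
Qed.

(** A differentiable branch is Lipschitz at d. If P' vanished at alpha(d), the difference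
   quotient of P would be small near it, and P(alpha(y)) - P(alpha(d)) would be smaller
   than y - d, to which it is equal. *)
Lemma root_branch_deriv_neq0 P Omega alpha d : root_branch P Omega alpha -> Omega d ->
  (P^`()).[alpha d]%R <> RtoC 0.
Proof.
move=> [HO Ha] Od P'0; have [Dd Ed] := Ha d Od.
have [L [r [L0 r0 HL]]] := C_ex_derive_lipschitz Dd.
have [r' [r'0 HO']] := open_C_near HO Od.
have [Q [Q0 HQ]] := poly_slope P (alpha d).
have L2 : 0 < 1 / (2 * L) by apply: Rdiv_lt_0_compat; lra.
have [c [c0 Hc]] := poly_Ccont Q (alpha d) L2.
pose h := Rmin (Rmin r r') (c / L) / 2.
have cL : 0 < c / L by exact: Rdiv_lt_0_compat.
have h0 : 0 < h by rewrite /h; have := Rmin_pos _ _ (Rmin_pos _ _ r0 r'0) cL; lra.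
have h1 : h < r /\ h < r' /\ h < c / L.
  rewrite /h; have := Rmin_l (Rmin r r') (c / L); have := Rmin_r (Rmin r r') (c / L).
  have := Rmin_l r r'; have := Rmin_r r r'; have := h0; rewrite /h; lra.
pose y := Cplus d (RtoC h).
have yd : Cmod (Cminus y d) = h.
  have -> : Cminus y d = RtoC h by rewrite /y; ring.
  by rewrite Cmod_R Rabs_pos_eq; lra.
have Hy : Cmod (Cminus (alpha y) (alpha d)) <= L * h by rewrite -yd; apply: HL; lra.
have Oy : Omega y by apply: HO'; lra.
have := HQ (alpha y); rewrite Ed (proj2 (Ha _ Oy)) => /(congr1 Cmod).
rewrite Cmod_mult yd => E.
have Lh : L * h < c.
  have -> : c = L * (c / L) by field; lra.
  by apply: Rmult_lt_compat_l; lra.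
have := Hc (alpha y); rewrite Q0 P'0.
have -> : Cminus Q.[alpha y]%R (RtoC 0) = Q.[alpha y]%R by ring.
move=> /(_ ltac:(lra)) HQy.
have q0 := Cmod_ge_0 Q.[alpha y]%R.
have : Cmod (Cminus (alpha y) (alpha d)) * Cmod Q.[alpha y]%R <= L * h * (1 / (2 * L)).
  by apply: Rmult_le_compat => //; [exact: Cmod_ge_0 | lra].
have -> : L * h * (1 / (2 * L)) = h / 2 by field; lra.
lra.
Qed.

(** * Local holomorphic inverses of a polynomial *)

Definition monomial (k : nat) (c : C) (n : nat) : C := if n == k then c else RtoC 0.

Lemma cpseries_monomial0 c x : cpseries (monomial 0 c) x = c.
Proof.
have H (p : C -> R) : p (RtoC 0) = 0 -> PSeries (fun n => p (monomial 0 c n)) x = p c.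
  move=> p0; apply: is_pseries_unique; apply/filterlim_locally => eps.
  exists O => n _; suff -> : sum_n (fun k => scal (pow_n x k) (p (monomial 0 c k))) n = p c.
    exact: ball_center.
  elim: n => [|n IH].
    by rewrite sum_O /Hierarchy.scal /= /Hierarchy.mult /Hierarchy.one /monomial /=; ring.
  by rewrite sum_Sn IH /Hierarchy.plus /Hierarchy.scal /= /Hierarchy.mult /= /monomial /= p0; ring.
by rewrite /cpseries !H // -surjective_pairing.
Qed.

Lemma cpseries_monomial1 c : cpseries (monomial 1 c) 1 = c.
Proof.
have H (p : C -> R) : p (RtoC 0) = 0 -> PSeries (fun n => p (monomial 1 c n)) 1 = p c.
  move=> p0; apply: is_pseries_unique; apply/filterlim_locally => eps.
  exists 1%N => -[|n] Hn; first by lia.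
  clear Hn.
  suff -> : sum_n (fun k => scal (pow_n 1 k) (p (monomial 1 c k))) n.+1 = p c.
    exact: ball_center.
  elim: n => [|n IH].
    rewrite sum_Sn sum_O /Hierarchy.plus /Hierarchy.scal /= /Hierarchy.mult /Hierarchy.one /=.
    by rewrite /monomial /= p0; ring.
  by rewrite sum_Sn IH /Hierarchy.plus /Hierarchy.scal /= /Hierarchy.mult /= /monomial /= p0; ring.
by rewrite /cpseries !H // -surjective_pairing.
Qed.

Lemma wnorm_le_monomial0 r c : wnorm_le r (Cmod c) (monomial 0 c).
Proof.
case=> [|n] /=; first by rewrite /monomial /=; lra.
have -> : wnorm r (shift (monomial 0 c)) n = wnorm r (fun=> RtoC 0) n by exact: wnorm_ext.
by rewrite wnorm0 /monomial /=; lra.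
Qed.

Lemma wnorm_le_monomial1 r c : 0 <= r -> wnorm_le r (r * Cmod c) (monomial 1 c).
Proof.
move=> r0; have m0 := Cmod_ge_0 c; have rm := Rmult_le_pos _ _ r0 m0.
case=> [|n] /=; rewrite {1}/monomial /= Cmod_0; first lra.
have -> : wnorm r (shift (monomial 1 c)) n = wnorm r (monomial 0 c) n by exact: wnorm_ext.
have := Rmult_le_compat_l _ _ _ r0 (wnorm_le_monomial0 r c n); lra.
Qed.

(** A number is obtained from the formal solution by letting X carry w0 and keeping the
   other coefficients constant: the sum at X = 1 solves the equation, and radius 2
   ensures convergence there. *)
Lemma small_fixpoint (s : seq C) M eps w0 : 0 <= M -> 0 < eps <= 1 -> all_le M s ->
  eps * (INR (size s) * M) <= 1 / 4 -> Cmod w0 <= eps / 16 ->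
  exists v, Cmod v <= eps /\ v = horner_rec [:: w0, RtoC 0 & s] v.
Proof.
move=> M0 e01 Hs He Hw.
have Hs2 : all_wnorm_le 2 M [seq monomial 0 c | c <- s].
  elim: s Hs {He} => //= c s IH [Hc /IH ?]; split=> // n.
  by apply: Rle_trans (wnorm_le_monomial0 2 c n) Hc.
have H0 : wnorm_le 2 (1 / 4) (monomial 0 (RtoC 0)).
  by move=> n; have := wnorm_le_monomial0 2 (RtoC 0) n; rewrite Cmod_0; lra.
have Hw0 : wnorm_le 2 ((eps / 2) / 4) (monomial 1 w0).
  by move=> n; have := @wnorm_le_monomial1 2 w0 ltac:(lra) n; lra.
have m0 := Cmod_ge_0 w0.
have [| | | | | |//|//||f [f0 Hf Ef]] :=
  @formal_fixpoint 2 M (eps / 2) (monomial 1 w0) (monomial 0 (RtoC 0)) [seq monomial 0 c | c <- s].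
- lra.
- done.
- lra.
- by rewrite size_map; lra.
- by [].
- by [].
- by [].
exists (cpseries f 1); split.
  by have := @Cmod_cpseries 2 (eps / 2) f 1 Hf ltac:(rewrite Rabs_R1; lra); lra.
have Hf1 : wnorm_le 2 1 f by move=> k; have := Hf k; lra.
have -> : [:: w0, RtoC 0 & s] =
    [seq cpseries a 1 | a <- [:: monomial 1 w0, monomial 0 (RtoC 0) & [seq monomial 0 c | c <- s]]].
  rewrite /= cpseries_monomial1 cpseries_monomial0; congr [:: _, _ & _].
  by rewrite -map_comp (@eq_map _ _ _ id) ?map_id // => c /=; exact: cpseries_monomial0.
rewrite -(@cpseries_formal_horner 2 (M + 1)) //.
- by rewrite /cpseries; congr pair; apply: PSeries_ext => k; rewrite Ef.
- lra.
- split; [|split].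
  + by move=> k; have := Hw0 k; lra.
  + by move=> k; have := H0 k; lra.
  + by apply: all_wnorm_le_mono Hs2; lra.
- by rewrite Rabs_R1; lra.
Qed.

(** Small solutions of P(z + v) = d exist by [small_fixpoint] and depend on d in a
   Lipschitz way by [horner_rec_contraction]; being Lipschitz, they are differentiable
   because P has nonzero derivative at them. *)
Lemma local_root_branch (P : {poly C}) (z : C) : (P^`()).[z]%R <> RtoC 0 ->
  exists Omega alpha, [/\ root_branch P Omega alpha, Omega P.[z]%R & alpha P.[z]%R = z].
Proof.
move=> P'z; have [s Hs] := taylor_fixpoint P'z.
set p := P.[z]%R in Hs *; set b := (P^`()).[z]%R in P'z Hs.
have [M [M0 HM]] := all_le_ex s.
have b0 := proj1 (Cmod_gt_0 _) P'z.
have [c [c0 Hc]] := poly_Ccont (P^`())%R z b0.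
pose n := INR (size s).+1.
have n1 : 1 <= n by rewrite /n S_INR; have := pos_INR (size s); lra.
pose K := 8 * n ^ 2 * (M + 1) + 1.
have n2M : 0 <= n ^ 2 * M by apply: Rmult_le_pos => //; exact: pow2_ge_0.
have n21 : 1 <= n ^ 2 by rewrite /=; nra.
have K1 : 1 <= K by rewrite /K; nra.
(* Below 1/K the right-hand side is a contraction; below c the derivative of P stays
   away from zero. *)
pose eps := Rmin (/ K) (c / 2).
have Ki : 0 < / K by apply: Rinv_0_lt_compat; lra.
have e0 : 0 < eps by apply: Rmin_pos; lra.
have eK : eps * K <= 1.
  have <- : / K * K = 1 by field; lra.
  by apply: Rmult_le_compat_r; [lra | exact: Rmin_l].
have ec : eps < c by have := Rmin_r (/ K) (c / 2); rewrite -/eps; lra.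
have e1 : eps <= 1 by nra.
have eM : eps * (n ^ 2 * M) <= 1 / 8 by rewrite /K in eK; nra.
have enM : eps * (INR (size s) * M) <= 1 / 4.
  have : INR (size s) * M <= n ^ 2 * M.
    by apply: Rmult_le_compat_r => //; have := pos_INR (size s); rewrite /n S_INR /=; nra.
  by nra.
pose delta := eps / 16 * Cmod b.
have delta0 : 0 < delta by apply: Rmult_lt_0_compat; lra.
pose Omega (d : C) := Cmod (Cminus d p) < delta.
pose good (d v : C) := Cmod v <= eps /\ P.[Cplus z v]%R = d.
have Hgood d : exists v, Omega d -> good d v.
  have [Od|nOd] := EM (Omega d); last by exists (RtoC 0).
  have [|v [Hv Ev]] := @small_fixpoint s M eps (Cdiv (Cminus d p) b) M0 (conj e0 e1) HM enM.
    rewrite Cmod_div //; apply: (Rmult_le_reg_r (Cmod b)) => //.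
    by rewrite /Rdiv Rmult_assoc Rinv_l; [rewrite /Omega /delta in Od; lra | lra].
  by exists v => _; split=> //; apply/Hs.
pose nu d := projT1 (cid (Hgood d)).
have Hnu d : Omega d -> good d (nu d) by exact: (projT2 (cid (Hgood d))).
have lip d d' v v' : good d v -> good d' v' ->
    Cmod (Cminus v v') <= 4 / Cmod b * Cmod (Cminus d d').
  move=> [Hv /Hs Ev] [Hv' /Hs Ev'].
  have H := @horner_rec_contraction M eps (Cdiv (Cminus d' p) b) (RtoC 0) s v v'
     M0 e1 ltac:(rewrite Cmod_0; lra) HM eM Hv Hv'.
  have := Cmod_triangle (Cdiv (Cminus d d') b)
     (Cminus (horner_rec [:: Cdiv (Cminus d' p) b, RtoC 0 & s] v)
             (horner_rec [:: Cdiv (Cminus d' p) b, RtoC 0 & s] v')).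
  rewrite -Ev'.
  have -> : Cplus (Cdiv (Cminus d d') b)
     (Cminus (horner_rec [:: Cdiv (Cminus d' p) b, RtoC 0 & s] v) v') = Cminus v v'.
    by rewrite [v in RHS]Ev /= !C_ringE; field.
  rewrite -Ev' in H; rewrite Cmod_div // => H'.
  have -> : 4 / Cmod b * Cmod (Cminus d d') = 4 * (Cmod (Cminus d d') / Cmod b) by field; lra.
  lra.
pose alpha d := Cplus z (nu d).
have Op : Omega p.
  by rewrite /Omega; have -> : Cminus p p = RtoC 0 by [ring]; rewrite Cmod_0.
have lipA d d' : Omega d -> Omega d' ->
    Cmod (Cminus (alpha d) (alpha d')) <= 4 / Cmod b * Cmod (Cminus d d').
  move=> Od Od'; have -> : Cminus (alpha d) (alpha d') = Cminus (nu d) (nu d').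
    by rewrite /alpha; ring.
  by apply: lip; exact: Hnu.
exists Omega, alpha; split=> //; last first.
  have H0 : good p (RtoC 0).
    by split; [rewrite Cmod_0; lra | rewrite /p; congr (P.[_])%R; exact: Cplus_0_r].
  have := lip _ _ _ _ (Hnu _ Op) H0.
  have -> : Cminus p p = RtoC 0 by ring.
  rewrite Cmod_0 Rmult_0_r => H.
  have : Cminus (nu p) (RtoC 0) = RtoC 0.
    by apply: Cmod_eq_0; have := Cmod_ge_0 (Cminus (nu p) (RtoC 0)); lra.
  have -> : Cminus (nu p) (RtoC 0) = nu p by ring.
  by rewrite /alpha => ->; ring.
have Onear d : Omega d -> exists r, 0 < r /\ forall y, Cmod (Cminus y d) < r -> Omega y.
  move=> Od; exists (delta - Cmod (Cminus d p)); split; first by rewrite /Omega in Od; lra.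
  move=> y Hy; have := Cmod_triangle (Cminus y d) (Cminus d p).
  have -> : Cplus (Cminus y d) (Cminus d p) = Cminus y p by ring.
  by rewrite /Omega; lra.
split.
  move=> d /Onear [r [r0 Hr]]; have r2 : 0 < r / 2 by lra.
  exists (mkposreal _ r2) => y [/= H1 H2]; apply: Hr.
  apply: Rle_lt_trans (Cmod_le_parts _) _.
  have {}H1 : Rabs (fst (Cminus y d)) < r / 2 by exact: H1.
  have {}H2 : Rabs (snd (Cminus y d)) < r / 2 by exact: H2.
  lra.
move=> d Od; split; last by case: (Hnu _ Od).
have P'a : (P^`()).[alpha d]%R <> RtoC 0.
  have := Hc (alpha d); have -> : Cminus (alpha d) z = nu d by rewrite /alpha; ring.
  move=> /(_ ltac:(have [] := Hnu _ Od; lra)) + E; rewrite E.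
  have -> : Cminus (RtoC 0) (P^`()).[z]%R = Copp b by rewrite /b; ring.
  by rewrite Cmod_opp; lra.
have [Q [Q0 HQ]] := poly_slope P (alpha d).
set q := (P^`()).[alpha d]%R in P'a Q0.
apply: (@C_is_derive_intro alpha d (Cinv q)) => e e0'.
have q0 := proj1 (Cmod_gt_0 _) P'a.
have L0 : 0 < 4 / Cmod b by apply: Rdiv_lt_0_compat; lra.
have eq0 : 0 < e * Cmod q / (4 / Cmod b).
  by apply: Rdiv_lt_0_compat => //; exact: Rmult_lt_0_compat.
have [r [r0 Hr]] := Onear d Od.
have [c' [c'0 Hc']] := poly_Ccont Q (alpha d) eq0.
have cL0 : 0 < c' / (4 / Cmod b) by exact: Rdiv_lt_0_compat.
exists (Rmin r (c' / (4 / Cmod b))); split; first exact: Rmin_pos.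
move=> y Hy; have Oy : Omega y by apply: Hr; apply: Rlt_le_trans Hy (Rmin_l _ _).
have Hl := lipA _ _ Oy Od; set t := Cmod (Cminus y d) in Hy Hl *.
have t0 : 0 <= t := Cmod_ge_0 _.
have Ha : Cmod (Cminus (alpha y) (alpha d)) < c'.
  apply: Rle_lt_trans Hl _.
  have -> : c' = 4 / Cmod b * (c' / (4 / Cmod b)) by field; lra.
  by apply: Rmult_lt_compat_l => //; apply: Rlt_le_trans Hy (Rmin_r _ _).
have {}Hc' := Hc' _ Ha; rewrite Q0 in Hc'.
have := HQ (alpha y); rewrite /alpha.
have [_ ->] := Hnu _ Oy; have [_ ->] := Hnu _ Od; rewrite -!/(alpha _) => E.
have -> : Cminus (Cminus (alpha y) (alpha d)) (Cmult (Cminus y d) (Cinv q)) =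
    Cmult (Cminus (alpha y) (alpha d)) (Cmult (Copp (Cminus Q.[alpha y]%R q)) (Cinv q)).
  by rewrite E; field.
rewrite !Cmod_mult Cmod_opp Cmod_inv //.
have B0 := Cmod_ge_0 (Cminus Q.[alpha y]%R q).
have : Cmod (Cminus Q.[alpha y]%R q) * / Cmod q <= e / (4 / Cmod b).
  apply: (Rmult_le_reg_r (Cmod q)) => //; rewrite Rmult_assoc Rinv_l; last lra.
  have -> : e / (4 / Cmod b) * Cmod q = e * Cmod q / (4 / Cmod b) by field; lra.
  by lra.
move=> H; have -> : e * t = (4 / Cmod b * t) * (e / (4 / Cmod b)) by field; lra.
apply: Rmult_le_compat => //; first exact: Cmod_ge_0.
by apply: Rmult_le_pos => //; apply/Rlt_le/Rinv_0_lt_compat.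
Qed.

(** * Differentiation and integration of complex-valued functions *)

Definition has_deriv (F : R -> C) (x : R) (l : C) : Prop :=
  @is_derive R_AbsRing C_R_NormedModule F x l.

Lemma has_deriv_parts (F : R -> C) (x : R) (l : C) : has_deriv F x l <->
  is_derive (fun y => fst (F y)) x (fst l) /\ is_derive (fun y => snd (F y)) x (snd l).
Proof.
split.
  move=> H; split.
    apply: (@filterdiff_comp' _ _ _ _ F fst x _ fst H).
    by apply: filterdiff_linear; exact: is_linear_fst.
  apply: (@filterdiff_comp' _ _ _ _ F snd x _ snd H).
  by apply: filterdiff_linear; exact: is_linear_snd.
case=> H1 H2.
have D1 := @is_derive_scal_l R_AbsRing C_R_NormedModule _ _ _ (RtoC 1) H1.
have D2 := @is_derive_scal_l R_AbsRing C_R_NormedModule _ _ _ Ci H2.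
have := is_derive_plus _ _ _ _ _ D1 D2; rewrite /has_deriv.
have E (a b : R) : @Hierarchy.plus C_R_NormedModule (@Hierarchy.scal _ C_R_NormedModule a (RtoC 1))
   (@Hierarchy.scal _ C_R_NormedModule b Ci) = (a, b).
  rewrite /Hierarchy.plus /Hierarchy.scal /= /prod_plus /prod_scal /=.
  rewrite /Hierarchy.plus /Hierarchy.scal /=.
  by rewrite /Hierarchy.mult /=; congr pair; ring.
rewrite E -surjective_pairing; apply: is_derive_ext => y.
by rewrite E -surjective_pairing.
Qed.

Lemma has_derivP F x : differentiable_at F x <-> has_deriv F x (Dx F x).
Proof.
split; last by move=> H; exists (Dx F x).
case=> l Hl; have [H1 H2] := proj1 (@has_deriv_parts F x l) Hl.
by apply/has_deriv_parts; rewrite /Dx /= (is_derive_unique _ _ _ H1) (is_derive_unique _ _ _ H2).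
Qed.

Lemma has_deriv_Dx F x l : has_deriv F x l -> Dx F x = l.
Proof.
move=> /has_deriv_parts[H1 H2].
by rewrite /Dx (is_derive_unique _ _ _ H1) (is_derive_unique _ _ _ H2) -surjective_pairing.
Qed.

Lemma has_deriv_differentiable F x l : has_deriv F x l -> differentiable_at F x.
Proof. by move=> H; exists l. Qed.

Lemma has_deriv_ext F G x l : eventually_at x (fun y => F y = G y) ->
  has_deriv F x l -> has_deriv G x l.
Proof.
move=> [d [d0 Hd]]; apply: is_derive_ext_loc; exists (mkposreal _ d0) => y Hy; exact: Hd.
Qed.

Lemma has_deriv_const c x : has_deriv (fun=> c) x (RtoC 0).
Proof. by apply/has_deriv_parts; split; exact: is_derive_const. Qed.

Lemma has_deriv_plus F G x l m : has_deriv F x l -> has_deriv G x m ->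
  has_deriv (fun y => Cplus (F y) (G y)) x (Cplus l m).
Proof.
move=> /has_deriv_parts[F1 F2] /has_deriv_parts[G1 G2]; apply/has_deriv_parts.
by split; apply: is_derive_plus.
Qed.

Lemma has_deriv_scal c F x l : has_deriv F x l ->
  has_deriv (fun y => Cmult c (F y)) x (Cmult c l).
Proof.
move=> /has_deriv_parts[F1 F2]; apply/has_deriv_parts; split => /=.
  by apply: (@is_derive_minus _ R_NormedModule); apply: (@is_derive_scal _ _ _ _ _).
by apply: (@is_derive_plus _ R_NormedModule); apply: (@is_derive_scal _ _ _ _ _).
Qed.

Lemma has_deriv_Ccont F x l : has_deriv F x l -> Ccont_at F x.
Proof.
move=> /has_deriv_parts[F1 F2]; apply: Ccont_parts;
  apply: (@ex_derive_continuous R_AbsRing R_NormedModule); eexists; eassumption.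
Qed.

Lemma analytic_has_deriv F x : analytic_at F x -> has_deriv F x (Dx F x).
Proof.
move=> /analytic_at_components[F1 F2]; apply/has_deriv_parts.
have D p : ranalytic_at p x -> is_derive p x (Derive p x).
  move=> /ranalytic_is_derive [a [r Hr]]; apply: Derive_correct.
  have [|_ _ Hd] := Hr x; last by eexists; exact: Hd.
  by rewrite Rminus_diag Rabs_R0; exact: cond_pos.
by split; exact: D.
Qed.

Lemma real_constant (F : R -> R) a b :
  (forall y, Rmin a b <= y <= Rmax a b -> is_derive F y 0) -> F b = F a.
Proof.
move=> H; have [||c [_]] := @MVT_gen F a b (fun=> 0).
- by move=> y Hy; apply: H; lra.
- move=> y Hy; apply/continuity_pt_filterlim.
  by apply: (@ex_derive_continuous R_AbsRing R_NormedModule); exists 0; exact: H.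
- by lra.
Qed.

(** Subtracting the termwise primitive of the series of G leaves a function with zero
   derivative. *)
Lemma ranalytic_antiderivative (F G : R -> R) x : ranalytic_at G x ->
  eventually_at x (fun y => is_derive F y (G y)) -> ranalytic_at F x.
Proof.
move=> /ranalytic_is_derive[a [r Hr]] [d [d0 Hd]].
have e0 : 0 < Rmin r d by apply: Rmin_pos => //; exact: cond_pos.
pose H y := PSeries (PS_Int a) (y - x).
have DH y : Rabs (y - x) < r -> is_derive H y (G y).
  move=> /Hr[Ga Hcv _].
  have -> : G y = scal 1 (PSeries a (y - x)).
    by rewrite (is_pseries_unique _ _ _ Ga) /Hierarchy.scal /= /Hierarchy.mult /=; ring.
  apply: (is_derive_comp (PSeries (PS_Int a)) (fun y => y - x)); last by auto_derive => //; ring.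
  have -> : PSeries a (y - x) = PSeries (PS_derive (PS_Int a)) (y - x).
    apply: PSeries_ext => n; rewrite /PS_derive /PS_Int; field.
    by rewrite -/(INR n.+1); apply: not_0_INR.
  by apply: is_derive_PSeries; rewrite CV_radius_Int.
have AH : ranalytic_at H x.
  exists (PS_Int a), (mkposreal _ e0) => y /= Hy.
  have [|_ Hcv _] := Hr y; first by apply: Rlt_le_trans Hy (Rmin_l _ _).
  by apply: PSeries_correct; apply: ex_pseries_inside; rewrite CV_radius_Int.
apply: (ranalytic_near (r := mkposreal _ e0)) (ranalytic_plus AH (ranalytic_const (F x - H x) x)).
move=> y /= Hy.
have : F y - H y = F x - H x.
  apply: (@real_constant (fun y => F y - H y) x y) => z Hz.
  have Hzx : Rabs (z - x) < Rmin r d.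
    apply: Rle_lt_trans Hy; move: Hz; rewrite /Rmin /Rmax; case: Rle_dec => Hxy Hz.
      by rewrite !Rabs_pos_eq; lra.
    by rewrite !Rabs_left1; lra.
  have -> : 0 = G z - G z by ring.
  apply: (@is_derive_minus _ R_NormedModule).
    by apply: Hd; apply: Rlt_le_trans Hzx (Rmin_r _ _).
  by apply: DH; apply: Rlt_le_trans Hzx (Rmin_l _ _).
lra.
Qed.

Lemma analytic_antiderivative (F G : R -> C) x : analytic_at G x ->
  eventually_at x (fun y => has_deriv F y (G y)) -> analytic_at F x.
Proof.
move=> /analytic_at_components[G1 G2] HF; apply/analytic_at_components; split.
  by apply: ranalytic_antiderivative G1 _; apply: eventually_impl HF => y /has_deriv_parts[].
by apply: ranalytic_antiderivative G2 _; apply: eventually_impl HF => y /has_deriv_parts[].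
Qed.

Section OnInterval.
Variable I : ointerval.

Lemma inside_eventually x : inside I x -> eventually_at x (inside I).
Proof. by move=> /inside_near[r Hr]; exists r; split=> //; exact: cond_pos. Qed.

Lemma inside_between a b y : inside I a -> inside I b ->
  Rmin a b <= y <= Rmax a b -> inside I y.
Proof.
move=> [a1 a2] [b1 b2]; rewrite /Rmin /Rmax; case: Rle_dec => _ Hy; split.
- by apply: (Rbar_lt_le_trans _ a) => //=; lra.
- by apply: (Rbar_le_lt_trans _ b) => //=; lra.
- by apply: (Rbar_lt_le_trans _ b) => //=; lra.
- by apply: (Rbar_le_lt_trans _ a) => //=; lra.
Qed.

Lemma constant_on F a b : inside I a -> inside I b ->
  (forall y, inside I y -> has_deriv F y (RtoC 0)) -> F b = F a.
Proof.
move=> Ia Ib HF; rewrite [LHS]surjective_pairing [RHS]surjective_pairing; congr pair.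
  apply: (@real_constant (fun y => fst (F y))) => y Hy.
  by have /has_deriv_parts[] := HF y (inside_between Ia Ib Hy).
apply: (@real_constant (fun y => snd (F y))) => y Hy.
by have /has_deriv_parts[] := HF y (inside_between Ia Ib Hy).
Qed.

Lemma Ccont_continuous (F : R -> C) x : Ccont_at F x ->
  @continuous R_UniformSpace C_R_NormedModule F x.
Proof.
move=> HF; apply/filterlim_locally => eps.
have [d [d0 Hd]] := HF eps (cond_pos eps); exists (mkposreal _ d0) => y Hy.
have := Hd y Hy; have [H1 H2] := part_le_Cmod (Cminus (F y) (F x)) => H3.
by split; apply: Rle_lt_trans H3.
Qed.

Variable x0 : R.
Hypothesis Ix0 : inside I x0.

Lemma integral_has_deriv G x : (forall y, inside I y -> Ccont_at G y) -> inside I x ->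
  has_deriv (integral G x0) x (G x).
Proof.
move=> HG Ix; have [d [d0 Hd]] := inside_eventually Ix.
apply: (is_derive_RInt G _ x0); last exact/Ccont_continuous/HG.
exists (mkposreal _ d0) => y Hy; apply: (@RInt_correct C_R_CompleteNormedModule).
apply: (@ex_RInt_continuous C_R_CompleteNormedModule) => z Hz.
by apply/Ccont_continuous/HG; apply: inside_between Hz => //; exact: Hd.
Qed.

Lemma integral_refl G : integral G x0 x0 = RtoC 0.
Proof. exact: (@RInt_point C_R_CompleteNormedModule). Qed.

Lemma integral_antiderivative F G x : (forall y, inside I y -> Ccont_at G y) ->
  (forall y, inside I y -> has_deriv F y (G y)) -> inside I x ->
  integral G x0 x = Cminus (F x) (F x0).
Proof.
move=> HG HF Ix.
have H : Cplus (integral G x0 x) (Cmult (RtoC (-1)) (F x)) =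
    Cplus (integral G x0 x0) (Cmult (RtoC (-1)) (F x0)).
  apply: (@constant_on (fun y => Cplus (integral G x0 y) (Cmult (RtoC (-1)) (F y)))) => // y Iy.
  have -> : RtoC 0 = Cplus (G y) (Cmult (RtoC (-1)) (G y)).
    by rewrite /Cplus /Cmult /RtoC /=; congr pair; ring.
  by apply: has_deriv_plus; [exact: integral_has_deriv | apply: has_deriv_scal; exact: HF].
have N z : Cmult (RtoC (-1)) z = Copp z.
  by rewrite /Cmult /Copp /RtoC /=; congr pair; ring.
rewrite integral_refl !N in H.
have -> : integral G x0 x = Cplus (Cplus (integral G x0 x) (Copp (F x))) (F x) by ring.
by rewrite H; ring.
Qed.

End OnInterval.

(** The identity theorem along the segment that joins a point of J to the given point. *)
Lemma vanishing_on_subinterval (I J : ointerval) (F : R -> R) : subinterval J I ->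
  (forall x, inside I x -> ranalytic_at F x) -> (forall x, inside J x -> F x = 0) ->
  forall x, inside I x -> F x = 0.
Proof.
move=> sub AF F0 y Iy; have [x Jx] := inside_ex J; have [r Hr] := inside_near Jx.
apply: (@ranalytic_identity F x y) => [s Hs|].
  by apply/AF/inside_convex => //; exact: sub.
have r0 := cond_pos r; have d0 := Rabs_pos (y - x).
exists (r / (2 * (Rabs (y - x) + 1))); split; first by apply: Rdiv_lt_0_compat; lra.
move=> s Hs; apply/F0/Hr.
have -> : (x + s * (y - x) - x = s * (y - x)) by ring.
rewrite Rabs_mult (Rabs_pos_eq s); last lra.
have : (s * (Rabs (y - x) + 1) <= r / 2).
  have -> : (r / 2 = r / (2 * (Rabs (y - x) + 1)) * (Rabs (y - x) + 1)) by field; lra.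
  by apply: Rmult_le_compat_r; lra.
have := proj1 Hs; lra.
Qed.

Lemma Ccont_mult F G x : Ccont_at F x -> Ccont_at G x ->
  Ccont_at (fun y => Cmult (F y) (G y)) x.
Proof.
move=> CF CG e e0.
have f0 := Cmod_ge_0 (F x); have g0 := Cmod_ge_0 (G x).
set a := Cmod (F x) in f0; set b := Cmod (G x) in g0.
pose q := Rmin 1 (e / (a + b + 2)).
have q0 : 0 < q by apply: Rmin_pos; [lra | apply: Rdiv_lt_0_compat; lra].
have q1 : q <= 1 by exact: Rmin_l.
have qe : (a + b + 2) * q <= e.
  have -> : e = (a + b + 2) * (e / (a + b + 2)) by field; lra.
  by apply: Rmult_le_compat_l; [lra | exact: Rmin_r].
have := eventually_and (CF q q0) (CG q q0); apply: eventually_impl => y [Hf Hg].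
have -> : Cminus (Cmult (F y) (G y)) (Cmult (F x) (G x)) =
  Cplus (Cmult (Cminus (F y) (F x)) (Cminus (G y) (G x)))
    (Cplus (Cmult (Cminus (F y) (F x)) (G x)) (Cmult (F x) (Cminus (G y) (G x)))) by ring.
apply: Rle_lt_trans (Cmod_triangle _ _) _.
have := Cmod_triangle (Cmult (Cminus (F y) (F x)) (G x)) (Cmult (F x) (Cminus (G y) (G x))).
rewrite !Cmod_mult -/a -/b.
have := Cmod_ge_0 (Cminus (F y) (F x)); have := Cmod_ge_0 (Cminus (G y) (G x)).
nra.
Qed.

Lemma Ccont_comp_lipschitz (alpha : C -> C) (W : R -> C) x L r : Ccont_at W x ->
  0 < L -> 0 < r ->
  (forall z, Cmod (Cminus z (W x)) < r ->
     Cmod (Cminus (alpha z) (alpha (W x))) <= L * Cmod (Cminus z (W x))) ->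
  Ccont_at (fun y => alpha (W y)) x.
Proof.
move=> CW L0 r0 HL e e0; have q0 : 0 < e / L by exact: Rdiv_lt_0_compat.
have := CW _ (Rmin_pos _ _ r0 q0); apply: eventually_impl => y Hy.
have [m1 m2] := (Rmin_l r (e / L), Rmin_r r (e / L)).
apply: Rle_lt_trans (HL _ _) _; first lra.
have -> : e = L * (e / L) by field; lra.
by apply: Rmult_lt_compat_l; lra.
Qed.

Lemma small_interval x d : 0 < d -> exists J : ointerval,
  (forall y, inside J y -> Rabs (y - x) < d) /\ inside J x.
Proof.
move=> d0; have lt : Rbar_lt (x - d) (x + d) by rewrite /=; lra.
exists (OInterval lt); rewrite /inside /=; split; last lra.
by move=> y [H1 H2]; apply: Rabs_def1; lra.
Qed.

Local Close Scope R_scope.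
Local Open Scope ring_scope.

(** * Towers of elementary extensions *)

(** The closure properties that adjoin preserves, phrased for a Prop-valued predicate. *)
Definition subfield (L : fieldType) (K : L -> Prop) : Prop :=
  [/\ K 1, forall x y, K x -> K y -> K (x - y) & forall x y, K x -> K y -> K (x / y)].

(** Classically a Prop-valued subfield is a boolean one, so that the closure lemmas for
   sums, products, polynomials and their derivatives apply. *)
Lemma subfield_closed (L : fieldType) (K : L -> Prop) :
  subfield K -> exists S : divringClosed L, forall x, (x \in S) <-> K x.
Proof.
case=> K1 KB Kd; pose S : L -> bool := fun x => `[<K x>].
have inS x : (x \in S) = `[<K x>] by [].
have SC : divring_closed S.
  by split=> [|x y|x y]; rewrite !inS; [exact/asboolP | |];
    move=> /asboolP Kx /asboolP Ky; apply/asboolP; auto.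
pose m := GRing.isDivringClosed.Build L S SC.
pose T : divringClosed L := HB.pack S m.
by exists T => x; rewrite inS; split=> /asboolP.
Qed.

Lemma adjoin_subfield (L : fieldType) (K : L -> Prop) g : K 1 -> subfield (adjoin K g).
Proof.
move=> K1; split; [exact: adjoin_base | exact: adjoin_sub | exact: adjoin_div].
Qed.

Section Minimal.
Variables (L : fieldType) (S : divringClosed L).

(** By induction on the size of s: its leading coefficient is a quotient of leading
   coefficients of polynomials over S, so the leading term can be subtracted. *)
Lemma polyOver_quotient (r s : {poly L}) : r != 0 -> r \is a polyOver S ->
  s * r \is a polyOver S -> s \is a polyOver S.
Proof.
move=> r0 Sr; have [n] := ubnP (size s); elim: n s => // n IH s sn Ssr.
have [->|s0] := eqVneq s 0; first exact: rpred0.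
have Sl : lead_coef s \in S.
  have -> : lead_coef s = lead_coef (s * r) / lead_coef r.
    by rewrite lead_coefM mulfK // lead_coef_eq0.
  by rewrite rpred_div // lead_coefE; apply: (polyOverP _).
pose t := lead_coef s *: 'X^((size s).-1).
have St : t \is a polyOver S by rewrite polyOverZ // polyOverXn.
have -> : s = (s - t) + t by rewrite subrK.
apply: rpredD => //; apply: IH; last by rewrite mulrBl rpredB // rpredM.
rewrite -ltnS; apply: leq_trans sn; rewrite ltnS.
have sp : (0 < size s)%N by rewrite size_poly_gt0.
rewrite -[X in (_ < X)%N](prednK sp) ltnS; apply/leq_sizeP => i Hi.
rewrite coefB coefZ coefXn; move: Hi; rewrite leq_eqVlt => /orP[/eqP <-|Hi].
  by rewrite eqxx mulr1 lead_coefE subrr.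
rewrite (gtn_eqF Hi) mulr0 subr0; apply: nth_default.
by rewrite -(prednK sp).
Qed.

Lemma minimal_polynomial (g : L) :
  (exists p, [/\ p != 0, p \is a polyOver S & root p g]) ->
  exists q, [/\ q != 0, q \is a polyOver S, root q g &
    forall r, r != 0 -> r \is a polyOver S -> root r g -> (size q <= size r)%N].
Proof.
move=> Hex; pose Q n := `[<exists p, [/\ p != 0, p \is a polyOver S, root p g & size p = n]>].
have exQ : exists n, Q n by case: Hex => p [? ? ?]; exists (size p); apply/asboolP; exists p.
case: (ex_minnP exQ) => n /asboolP[q [q0 Sq qg sq]] Hmin; exists q; split=> // r r0 Sr rg.
by rewrite sq; apply: Hmin; apply/asboolP; exists r.
Qed.

(** In a factorization over S one of the factors vanishes at g, and by minimality that
   factor has full size. *)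
Lemma minimal_irreducible (g : L) q : q != 0 -> q \is a polyOver S -> root q g ->
  (forall r, r != 0 -> r \is a polyOver S -> root r g -> (size q <= size r)%N) ->
  irreducible_over (fun x => x \in S) q.
Proof.
move=> q0 Sq qg qmin; split; first exact/polyOverP.
  exact: root_size_gt1 qg.
move=> r /polyOverP Sr r1 rq.
have r0 : r != 0 by apply: contraTneq rq => ->; rewrite dvd0p.
rewrite -(dvdp_size_eqp rq) eqn_leq dvdp_leq //=.
set s := q %/ r; have qE : q = s * r by rewrite divpK.
have s0 : s != 0 by apply: contraNneq q0 => s0; rewrite qE s0 mul0r.
have Ss : s \is a polyOver S by apply: (polyOver_quotient r0 Sr); rewrite -qE.
move: (qg); rewrite {1}qE rootM => /orP[sg|rg]; last exact: qmin.
have := qmin _ s0 Ss sg; rewrite {1}qE size_mul // => H.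
have sp : (0 < size s)%N by rewrite size_poly_gt0.
move/eqP: r1; case: (size r) (size_poly_gt0 r) H => [|[|n]] //; first by rewrite r0.
by move=> _; rewrite !addnS /= -ltn_subRL subnn.
Qed.

End Minimal.

(** An algebraic step asks for an irreducible polynomial; any nonzero polynomial over K
   leads to one, namely the polynomial of least size that vanishes at g. *)
Lemma algebraic_stepI (L : fieldType) (K : L -> Prop) (g : L) (p : {poly L}) :
  subfield K -> p != 0 -> coefs_in K p -> root p g -> algebraic_step K g.
Proof.
move=> /subfield_closed[S SK] p0 Kp pg.
have Sp : p \is a polyOver S by apply/polyOverP => i; apply/SK.
have [|q [q0 Sq qg qmin]] := @minimal_polynomial _ S g; first by exists p.
exists q; split=> //; have [c1 c2 c3] := minimal_irreducible q0 Sq qg qmin.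
split=> // [i|r Kr]; first exact/SK.
by apply: c3 => i; apply/SK.
Qed.

Lemma adjoin_mono (L : fieldType) (K K' : L -> Prop) g :
  (forall x, K x -> K' x) -> forall x, adjoin K g x -> adjoin K' g x.
Proof.
move=> KK' x; elim=> [y /KK'||y z _ Hy _ Hz|y z _ Hy _ Hz].
- exact: adjoin_base.
- exact: adjoin_gen.
- exact: adjoin_sub.
- exact: adjoin_div.
Qed.

Definition elementary_over (L : fieldType) (D : L -> L) (K0 : L -> Prop) (z : L) : Prop :=
  exists K, tower (elementary_step D) K0 K /\ K z.

Section Elementary.
Variables (L : fieldType) (D : L -> L) (K0 : L -> Prop).
Hypothesis K0f : subfield K0.
Local Notation E := (elementary_over D K0).

Lemma tower_subfield K : tower (elementary_step D) K0 K -> subfield K.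
Proof. by elim=> // K' g _ [K1 _ _] _; exact: adjoin_subfield. Qed.

Lemma elementary_step_mono (K K' : L -> Prop) g : subfield K' ->
  (forall x, K x -> K' x) -> elementary_step D K g -> elementary_step D K' g.
Proof.
move=> fK' KK' [[s [/KK' Ks Hs]]|[s [/KK' Ks s0 Hs]]|[p [[Kp sp _] pg]]].
- by apply: Or31; exists s.
- by apply: Or32; exists s.
- apply: Or33; apply: (algebraic_stepI fK' (p := p)) => // [|i]; last exact/KK'.
  by rewrite -size_poly_gt0; apply: ltnW.
Qed.

(** The second tower is rebuilt on top of the first. Its steps remain elementary over the
   larger fields, the algebraic ones by [algebraic_stepI]. *)
Lemma tower_join K1 K2 : tower (elementary_step D) K0 K1 ->
  tower (elementary_step D) K0 K2 ->
  exists K, [/\ tower (elementary_step D) K0 K, forall x, K1 x -> K x &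
                forall x, K2 x -> K x].
Proof.
move=> T1; elim=> [|K g _ [K' [T' H1 H2]] Hg].
  exists K1; split=> //; elim: T1 => // K g _ IH _ x /IH; exact: adjoin_base.
exists (adjoin K' g); split; last exact: adjoin_mono.
  by apply: tower_step => //; apply: elementary_step_mono Hg => //; exact: tower_subfield.
by move=> x /H1; exact: adjoin_base.
Qed.

Lemma elementary_over_base x : K0 x -> E x.
Proof. by exists K0; split=> //; exact: tower_base. Qed.

Lemma elementary_over_subfield : subfield E.
Proof.
split; first by case: K0f => K1 _ _; exact: elementary_over_base.
  move=> x y [K1 [T1 Kx]] [K2 [T2 Ky]]; have [K [T H1 H2]] := tower_join T1 T2.
  by exists K; split=> //; have [_ KB _] := tower_subfield T; auto.
move=> x y [K1 [T1 Kx]] [K2 [T2 Ky]]; have [K [T H1 H2]] := tower_join T1 T2.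
by exists K; split=> //; have [_ _ Kd] := tower_subfield T; auto.
Qed.

Lemma elementary_over_adjoin K g : tower (elementary_step D) K0 K ->
  elementary_step D K g -> E g.
Proof.
by move=> T Hg; exists (adjoin K g); split; [exact: tower_step | exact: adjoin_gen].
Qed.

Lemma elementary_over_exp s g : E s -> D g = D s * g -> E g.
Proof. by move=> [K [T Ks]] H; apply: (elementary_over_adjoin T); apply: Or31; exists s. Qed.

Lemma elementary_over_log s g : E s -> s != 0 -> D g = D s / s -> E g.
Proof.
by move=> [K [T Ks]] s0 H; apply: (elementary_over_adjoin T); apply: Or32; exists s.
Qed.

Lemma elementary_over_seq (s : seq L) : (forall x, x \in s -> E x) ->
  exists K, tower (elementary_step D) K0 K /\ forall x, x \in s -> K x.
Proof.
elim: s => [|a s IH] Hs; first by exists K0; split=> //; exact: tower_base.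
have [|K1 [T1 H1]] := IH; first by move=> x xs; apply: Hs; rewrite inE xs orbT.
have [K2 [T2 H2]] := Hs a (mem_head _ _).
have [K [T HK1 HK2]] := tower_join T1 T2.
by exists K; split=> // x; rewrite inE => /orP[/eqP->|xs]; auto.
Qed.

Lemma elementary_over_alg p g : p != 0 -> coefs_in E p -> root p g -> E g.
Proof.
move=> p0 Ep pg; have [x /(nthP 0)[i _ <-] //|K [T HK]] := @elementary_over_seq p.
apply: (elementary_over_adjoin T); apply: Or33.
apply: (algebraic_stepI (tower_subfield T) p0) => // i.
have [si|si] := leqP (size p) i; last exact/HK/mem_nth.
by rewrite nth_default // -[X in K X](subrr 1); have [K1 KB _] := tower_subfield T; auto.
Qed.

(** Induction over towers in terms of the closure properties of Q only, without mention of
   the intermediate fields. *)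
Lemma tower_ind_elementary (Q : L -> Prop) :
  (forall x, K0 x -> Q x) -> subfield Q ->
  (forall s g, E s -> E g -> Q s -> D g = D s * g -> Q g) ->
  (forall s g, E s -> E g -> Q s -> s != 0 -> D g = D s / s -> Q g) ->
  (forall p g, E g -> p != 0 -> coefs_in E p -> coefs_in Q p -> root p g -> Q g) ->
  forall x, E x -> Q x.
Proof.
move=> Q0 [_ QB Qd] Qe Ql Qa x [K [T Kx]]; elim: T x Kx => // {}K g T IH Hg.
have Eg := elementary_over_adjoin T Hg.
have KE y : K y -> E y by exists K.
have Qg : Q g.
  case: Hg => [[s [Ks H]]|[s [Ks s0 H]]|[p [[Kp sp _] pg]]].
  - exact: (Qe s g (KE _ Ks) Eg (IH _ Ks)).
  - exact: (Ql s g (KE _ Ks) Eg (IH _ Ks)).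
  - apply: (Qa p g) => // [|i|i]; [|exact/KE|exact/IH].
    by rewrite -size_poly_gt0; apply: ltnW.
by move=> x; elim=> [y /IH||y z _ Hy _ Hz|y z _ Hy _ Hz] //; auto.
Qed.

Hypotheses (DB : {morph D : x y / x - y}) (DM : forall x y, D (x * y) = D x * y + x * D y).

Lemma derivation0 : D 0 = 0. Proof. by have := DB 0 0; rewrite !subrr. Qed.

Lemma derivationD x y : D (x + y) = D x + D y.
Proof. by rewrite -[y in LHS]opprK DB -[in LHS](sub0r y) DB derivation0 sub0r opprK. Qed.

Lemma derivation1 : D 1 = 0.
Proof. by apply: (addrI (D 1)); rewrite addr0; have := DM 1 1; rewrite !mulr1 mul1r. Qed.

Lemma derivationV y : y != 0 -> D y^-1 = - (D y / y ^+ 2).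
Proof.
move=> y0; apply: (mulfI y0); apply: (addrI (D y * y^-1)).
by rewrite -DM mulfV // derivation1 mulrN [y * _]mulrC expr2 invfM mulrA divfK // subrr.
Qed.

(** The chain rule, where the first term differentiates the coefficients. *)
Lemma derivation_horner p x : D p.[x] = (map_poly D p).[x] + p^`().[x] * D x.
Proof.
have Dz := derivation0; elim/poly_ind: p => [|p c IH].
  by rewrite deriv0 map_polyE polyseq0 /= !horner0 Dz mul0r addr0.
rewrite !hornerE_comm derivationD DM IH derivD derivM derivX derivC addr0 mulr1.
have -> : map_poly D (p * 'X + c%:P) = map_poly D p * 'X + (D c)%:P.
  apply/polyP=> i; rewrite coef_map_id0 // !coefD !coefMX !coefC derivationD.
  by case: i => [|i] /=; rewrite ?derivation0 // coef_map_id0.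
rewrite !hornerE /= !mulrDl -!addrA; congr (_ + _).
by rewrite mulrAC addrA addrC.
Qed.

(** Makes stability of a field under the derivation provable by induction over its
   construction. *)
Lemma derivation_subfield (K : L -> Prop) : subfield K ->
  subfield (fun z => K z /\ K (D z)).
Proof.
move=> /subfield_closed[S SK].
split=> [|x y [/SK Sx /SK SDx] [/SK Sy /SK SDy]|x y [/SK Sx /SK SDx] [/SK Sy /SK SDy]].
- by split; apply/SK; [exact: rpred1 | rewrite derivation1; exact: rpred0].
- by split; apply/SK; rewrite ?DB; apply: rpredB.
split; apply/SK; first exact: rpred_div.
have [->|y0] := eqVneq y 0; first by rewrite invr0 mulr0 derivation0 rpred0.
by rewrite DM derivationV // mulrN rpredB ?rpred_div // rpredM // rpred_div // rpredX.
Qed.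

Hypotheses (DK0 : forall x, K0 x -> E (D x)) (char0 : forall n, n.+1%:R != 0 :> L).

(** For an algebraic element g, differentiate the equation q(g) = 0 of least degree: q'(g)
   is nonzero by minimality in characteristic 0, so the derivative of g is a quotient
   of elements already known to be elementary. *)
Lemma elementary_over_D x : E x -> E (D x).
Proof.
have Ef := elementary_over_subfield; have [E1 EB Ed] := Ef.
have [S SE] := subfield_closed Ef.
have Emul y z : E y -> E z -> E (y * z) by move=> /SE Sy /SE Sz; apply/SE; exact: rpredM.
have Qf := derivation_subfield Ef.
suff H z : E z -> E z /\ E (D z) by move=> /H[].
apply: (@tower_ind_elementary (fun z => E z /\ E (D z))) =>
  // [y Ky|s g Es Eg [_ EDs] H|s g Es Eg [_ EDs] s0 H|p g Eg p0 Ep Qp pg].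
- by split; [exact: elementary_over_base | exact: DK0].
- by split=> //; rewrite H; apply: Emul.
- by split=> //; rewrite H; apply: Ed.
split=> //; have [S' S'E] := subfield_closed Qf.
have S'p : p \is a polyOver S' by apply/polyOverP => i; apply/S'E.
have [|q [q0 Sq qg qmin]] := @minimal_polynomial _ S' g; first by exists p.
have q1 := root_size_gt1 q0 qg.
have dq0 : q^`() != 0.
  apply/eqP => /(congr1 (fun r : {poly L} => r`_(size q).-2)).
  rewrite coef_deriv coef0 -mulr_natr; case: (size q) q1 (lead_coefE q) => [|[|n]] //= _.
  move=> lq /eqP; rewrite -lq mulf_eq0 lead_coef_eq0 (negbTE q0) /=.
  by rewrite (negbTE (char0 n)).
have dqg : q^`().[g] != 0.
  apply/negP => dqg; have := qmin _ dq0 (polyOver_deriv Sq) dqg.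
  by rewrite leqNgt (lt_size_deriv q0).
have := derivation_horner q g; rewrite (rootP qg) derivation0 => /esym/eqP.
rewrite addrC addr_eq0 mulrC => /eqP Hg.
have -> : D g = - ((map_poly D q).[g] / q^`().[g]).
  by apply: (mulIf dqg); rewrite Hg mulNr divfK.
have coefE (r : {poly L}) y : (forall i, E r`_i) -> E y -> E r.[y].
  move=> Hr /SE Sy; apply/SE; apply: rpred_horner => //.
  by apply/polyOverP => i; apply/SE.
have Sq' i : E q`_i /\ E (D q`_i) by apply/S'E; apply: (polyOverP Sq).
rewrite -sub0r; apply: EB; first by rewrite -(subrr 1); case: Ef => _ EB _; exact: EB.
apply: Ed; apply: coefE => // i.
  by rewrite coef_map_id0 ?derivation0 //; case: (Sq' i).
by apply/SE/polyOverP/polyOver_deriv/polyOverP => l; apply/SE; case: (Sq' l).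
Qed.

End Elementary.

(** * The differential field of meromorphic functions *)

From mathcomp Require Import ring zify.

Local Notation "x %:F" := (@FracField.tofrac _ x) : ring_scope.

(** The product and difference rules for the quotient-rule formula, isolated over an
   abstract field where they are identities of rational functions. *)
Lemma quotient_derivM (L : fieldType) (p p' q q' r r' s s' : L) : q != 0 -> s != 0 ->
  ((p' * r + p * r') * (q * s) - p * r * (q' * s + q * s')) / (q * s) ^+ 2 =
  (p' * q - p * q') / q ^+ 2 * (r / s) + p / q * ((r' * s - r * s') / s ^+ 2).
Proof. by move=> q0 s0; field; rewrite ?q0 ?s0. Qed.

Lemma quotient_derivB (L : fieldType) (p p' q q' r r' s s' : L) : q != 0 -> s != 0 ->
  ((p' * s + p * s' - (r' * q + r * q')) * (q * s) - (p * s - r * q) * (q' * s + q * s'))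
     / (q * s) ^+ 2 =
  (p' * q - p * q') / q ^+ 2 - (r' * s - r * s') / s ^+ 2.
Proof. by move=> q0 s0; field; rewrite ?q0 ?s0. Qed.

Section MeromorphicDerivation.
Variable J : ointerval.
Implicit Types F G : afun J.

Lemma afun_constE c x : inside J x -> afun_const J c x = c.
Proof. exact: cut_in. Qed.

Lemma afun_idE x : inside J x -> afun_id J x = RtoC x.
Proof. exact: cut_in. Qed.

Lemma afun_oppE F x : inside J x -> (- F) x = Copp (F x).
Proof. by move=> Jx; rewrite [LHS]cut_in. Qed.

Lemma afun_has_deriv F x : inside J x -> has_deriv F x (afun_deriv F x).
Proof.
by move=> Jx; rewrite afun_derivE //; apply: analytic_has_deriv; exact: afun_analytic.
Qed.

Lemma afun_derivI F G : (forall x, inside J x -> has_deriv F x (G x)) -> afun_deriv F = G.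
Proof.
by move=> H; apply: afunP => x Jx; rewrite afun_derivE //; apply: has_deriv_Dx; exact: H.
Qed.

Lemma has_deriv_inside (F G : R -> C) x l : inside J x ->
  (forall y, inside J y -> F y = G y) -> has_deriv F x l -> has_deriv G x l.
Proof.
move=> Jx E; apply: has_deriv_ext; apply: eventually_impl E _; exact: inside_eventually.
Qed.

Lemma afun_derivD F G : afun_deriv (F + G) = afun_deriv F + afun_deriv G.
Proof.
apply: afun_derivI => x Jx; rewrite afun_addE //.
apply: (has_deriv_inside (F := fun y => Cplus (F y) (G y))) => // [y Jy|].
  by rewrite afun_addE.
by apply: has_deriv_plus; exact: afun_has_deriv.
Qed.

Lemma afun_deriv_const c : afun_deriv (afun_const J c) = 0.
Proof.
apply: afun_derivI => x Jx; rewrite [X in has_deriv _ _ X]cut_in //.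
apply: (has_deriv_inside (F := fun=> c)) => // [y Jy|]; first by rewrite [RHS]cut_in.
exact: has_deriv_const.
Qed.

Lemma afun_derivN F : afun_deriv (- F) = - afun_deriv F.
Proof.
have H : afun_deriv (0 : afun J) = 0 := afun_deriv_const 0.
by apply: (addrI (afun_deriv F)); rewrite -afun_derivD !subrr H.
Qed.

Lemma afun_deriv_id : afun_deriv (afun_id J) = 1.
Proof.
apply: afun_derivI => x Jx; rewrite [X in has_deriv _ _ X]cut_in //.
apply: (has_deriv_inside (F := RtoC)) => // [y Jy|]; first by rewrite [RHS]cut_in.
apply/has_deriv_parts; split => /=; first exact: is_derive_id.
exact: is_derive_const.
Qed.

Lemma frac_repr (z : {fraction afun J}) : z = (\n_(repr z))%:F / (\d_(repr z))%:F.
Proof.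
have d0 : \d_(repr z) != 0 := denom_ratioP _.
apply: (canRL (mulfK _)); first by rewrite tofrac_eq0.
rewrite -[z]reprK; unlock FracField.tofrac.
rewrite -[LHS]FracField.pi_mul /FracField.mulf !numden_Ratio ?oner_eq0 // ?mulr1 ?reprK.
by apply/eqmodP; rewrite /= FracField.equivfE !numden_Ratio ?oner_eq0 // mulr1 mulrC.
Qed.

Lemma frac_ratio (z : {fraction afun J}) : exists p q, q != 0 /\ z = p%:F / q%:F.
Proof.
by exists (\n_(repr z)), (\d_(repr z)); split; [exact: denom_ratioP | exact: frac_repr].
Qed.

Local Notation D := (@mer_deriv J).

Lemma mer_deriv_tofrac F : D F%:F = (afun_deriv F)%:F.
Proof.
have := mer_derivE F (oner_neq0 (afun J)); rewrite tofrac1 divr1 expr1n tofrac1 divr1.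
have -> : afun_deriv (1 : afun J) = 0 by exact: afun_deriv_const.
by rewrite mulr1 mulr0 subr0.
Qed.

Lemma mer_derivM x y : D (x * y) = D x * y + x * D y.
Proof.
have [p [q [q0 ->]]] := frac_ratio x; have [r [s [s0 ->]]] := frac_ratio y.
have q0' : q%:F != 0 by rewrite tofrac_eq0.
have s0' : s%:F != 0 by rewrite tofrac_eq0.
rewrite mulf_div -!tofracM !mer_derivE ?mulf_neq0 // !afun_derivM.
rewrite !tofracXn !tofracB !tofracM !tofracD !tofracM.
exact: quotient_derivM.
Qed.

Lemma mer_derivB : {morph D : x y / x - y}.
Proof.
move=> x y; have [p [q [q0 ->]]] := frac_ratio x; have [r [s [s0 ->]]] := frac_ratio y.
have q0' : q%:F != 0 by rewrite tofrac_eq0.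
have s0' : s%:F != 0 by rewrite tofrac_eq0.
rewrite -mulNr addf_div // mulNr -!tofracM -tofracB !mer_derivE ?mulf_neq0 //.
rewrite afun_derivD afun_derivN !afun_derivM.
rewrite !tofracXn !tofracB !tofracM !tofracB !tofracD !tofracM.
exact: quotient_derivB.
Qed.

Lemma natr_C n : (n%:R : C) = RtoC (INR n).
Proof.
elim: n => [//|n IH]; rewrite S_INR -addn1 natrD IH.
by rewrite /GRing.add /= /Cplus /RtoC /=; congr pair; rewrite Rplus_0_r.
Qed.

Lemma afun_natrE n x : inside J x -> (n%:R : afun J) x = n%:R.
Proof.
move=> Jx; elim: n => [|n IH]; first by rewrite [LHS]cut_in.
by rewrite -addn1 !natrD afun_addE // IH [(1 : afun J) x]cut_in.
Qed.

Lemma frac_char0 n : n.+1%:R != 0 :> {fraction afun J}.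
Proof.
rewrite -(rmorph_nat (@FracField.tofrac (afun J))) tofrac_eq0; apply/eqP => E.
have [x Jx] := inside_ex J; have := congr1 (fun F : afun J => F x) E.
rewrite afun_natrE // natr_C [RHS]cut_in // => -[].
exact: (not_0_INR n.+1 (PeanoNat.Nat.neq_succ_0 n)).
Qed.

Lemma afun_const1 : afun_const J (RtoC 1) = 1. Proof. by []. Qed.

Lemma rational_subfield : subfield (@rational_functions J).
Proof. by apply: adjoin_subfield; exists (RtoC 1); rewrite afun_const1 tofrac1. Qed.

Lemma afun_const_zmod : zmod_morphism (afun_const J).
Proof.
by move=> c d; apply: afunP => x Jx; rewrite afun_addE // afun_oppE // !afun_constE.
Qed.

Lemma afun_const_monoid : monoid_morphism (afun_const J).
Proof.
by split=> // c d; apply: afunP => x Jx; rewrite afun_mulE // !afun_constE.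
Qed.

HB.instance Definition _ := GRing.isZmodMorphism.Build C (afun J) (afun_const J) afun_const_zmod.
HB.instance Definition _ :=
  GRing.isMonoidMorphism.Build C (afun J) (afun_const J) afun_const_monoid.

Local Notation E := (elementary_over D (@rational_functions J)).

Lemma rational_deriv z : rational_functions z -> E (D z).
Proof.
move=> Hz; apply: elementary_over_base.
suff : rational_functions z /\ rational_functions (D z) by case.
have [H1 HB Hd] := derivation_subfield mer_derivB mer_derivM rational_subfield.
elim: Hz => [_ [c ->]||x y _ Hx _ Hy|x y _ Hx _ Hy]; try by auto.
- split; first by apply: adjoin_base; exists c.
  rewrite mer_deriv_tofrac afun_deriv_const tofrac0 -(subrr 1).
  by have [R1 RB _] := rational_subfield; exact: RB.
- split; first exact: adjoin_gen.
  by rewrite mer_deriv_tofrac afun_deriv_id tofrac1; have [] := rational_subfield.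
Qed.

Lemma elementary_subfield : subfield E.
Proof. exact: elementary_over_subfield rational_subfield. Qed.

Lemma elementary_mer_deriv z : E z -> E (D z).
Proof.
exact: (elementary_over_D rational_subfield mer_derivB mer_derivM rational_deriv frac_char0).
Qed.

Lemma elementaryP (F : R -> C) : elementary J F <->
  exists G : afun J, (forall x, inside J x -> F x = G x) /\ E G%:F.
Proof.
split=> [[G [K [H1 H2 H3]]]|[G [H1 [K [H2 H3]]]]].
  by exists G; split=> //; exists K.
by exists G, K.
Qed.

Lemma elementary_analytic (F : R -> C) x : elementary J F -> inside J x -> analytic_at F x.
Proof.
move=> [G [K [H _ _]]] Jx; have [r Hr] := inside_near Jx.
by apply: (analytic_near (r := r)) (afun_analytic G Jx) => y /Hr Jy; rewrite H.
Qed.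

Lemma elementary_ext (F G : R -> C) : (forall x, inside J x -> F x = G x) ->
  elementary J F -> elementary J G.
Proof.
by move=> E0 [H [K [H1 H2 H3]]]; exists H, K; split=> // x Jx; rewrite -E0 // H1.
Qed.

Lemma elementary_const c : elementary J (fun=> c).
Proof.
apply/elementaryP; exists (afun_const J c); split=> [x Jx|]; first by rewrite [RHS]cut_in.
by apply/elementary_over_base/adjoin_base; exists c.
Qed.

Lemma elementary_closed : exists S : divringClosed {fraction afun J}, forall z, z \in S <-> E z.
Proof. exact: subfield_closed elementary_subfield. Qed.

Lemma elementary_plus (F G : R -> C) : elementary J F -> elementary J G ->
  elementary J (fun x => F x + G x).
Proof.
have [S SE] := elementary_closed.
move=> /elementaryP[F' [HF /SE EF]] /elementaryP[G' [HG /SE EG]]; apply/elementaryP.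
exists (F' + G'); split=> [x Jx|]; first by rewrite afun_addE // HF // HG.
by apply/SE; rewrite tofracD; exact: rpredD.
Qed.

Lemma elementary_mult (F G : R -> C) : elementary J F -> elementary J G ->
  elementary J (fun x => F x * G x).
Proof.
have [S SE] := elementary_closed.
move=> /elementaryP[F' [HF /SE EF]] /elementaryP[G' [HG /SE EG]]; apply/elementaryP.
exists (F' * G'); split=> [x Jx|]; first by rewrite afun_mulE // HF // HG.
by apply/SE; rewrite tofracM; exact: rpredM.
Qed.

Lemma elementary_sum (n : nat) (F : 'I_n -> R -> C) : (forall i, elementary J (F i)) ->
  elementary J (fun x => \sum_(i < n) F i x).
Proof.
elim: n F => [|n IH] F HF.
  by apply: (elementary_ext _ (elementary_const 0)) => x _; rewrite big_ord0.
apply: (elementary_ext _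
  (elementary_plus (IH _ (fun i => HF (widen_ord (leqnSn n) i))) (HF ord_max))).
by move=> x _; rewrite big_ord_recr.
Qed.

Lemma Dx_inside (F G : R -> C) x : inside J x -> (forall y, inside J y -> F y = G y) ->
  Dx F x = Dx G x.
Proof.
move=> Jx H; have [r Hr] := inside_near Jx.
by rewrite /Dx; congr pair; apply: Derive_ext_loc; exists r => y /Hr /H ->.
Qed.

Lemma iter_Dx_inside n (F : R -> C) (G : afun J) x : inside J x ->
  (forall y, inside J y -> F y = G y) -> iter n Dx F x = iter n (@afun_deriv J) G x.
Proof.
move=> Jx H; elim: n x Jx => [|n IH] x Jx; first exact: H.
by rewrite !iterS (Dx_inside Jx IH) afun_derivE.
Qed.

Lemma elementary_iter_deriv n G : E G%:F -> E (iter n (@afun_deriv J) G)%:F.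
Proof. by move=> EG; elim: n => //= n /elementary_mer_deriv; rewrite mer_deriv_tofrac. Qed.

(** A primitive of h'/h is a logarithm of h in the sense of differential algebra,
   whichever branch it is; no complex logarithm function is involved. *)
Lemma elementary_logarithm (h F : R -> C) : elementary J h -> (forall x, inside J x -> h x <> 0) ->
  (forall x, inside J x -> has_deriv F x (Dx h x / h x)) -> elementary J F.
Proof.
move=> Eh h0 HF; have AF x : inside J x -> analytic_at F x.
  move=> Jx; apply: (@analytic_antiderivative _ (fun y => Dx h y / h y)).
    apply: analytic_mult; first exact/analytic_Dx/elementary_analytic.
    by apply: analytic_inv; [exact: elementary_analytic | exact: h0].
  by apply: eventually_impl HF _; exact: inside_eventually.
move/elementaryP: Eh => [H [HH EH]].
apply/elementaryP; exists (mk_afun AF); split=> [x Jx|]; first by rewrite [RHS]cut_in.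
have H0 : H != 0.
  apply/eqP => H0; have [x Jx] := inside_ex J.
  by apply: (h0 x Jx); rewrite HH // H0 [LHS]cut_in.
apply: (elementary_over_log (s := H%:F)) => //.
  by rewrite tofrac_eq0.
have H0' : H%:F != 0 by rewrite tofrac_eq0.
rewrite !mer_deriv_tofrac; apply: (canRL (mulfK H0')); rewrite -tofracM; congr (_%:F).
apply: afunP => x Jx; rewrite afun_mulE //.
have -> : afun_deriv (mk_afun AF) x = Dx h x / h x.
  rewrite afun_derivE //; rewrite (@Dx_inside _ F) // => [|y Jy]; last by rewrite [LHS]cut_in.
  exact/has_deriv_Dx/HF.
rewrite afun_derivE // -(Dx_inside Jx HH) -HH //.
by apply: divfK; apply/eqP/h0.
Qed.

Lemma afun_hornerE (P : {poly C}) (U : afun J) x : inside J x ->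
  (map_poly (afun_const J) P).[U] x = P.[U x].
Proof.
move=> Jx; elim/poly_ind: P => [|P c IH].
  by rewrite rmorph0 !horner0 [LHS]cut_in.
rewrite rmorphD rmorphM /= map_polyX map_polyC !hornerE afun_addE // afun_mulE // IH.
by rewrite afun_constE.
Qed.

(** The polynomial P - w has coefficients in C(w) and u as a root. *)
Lemma elementary_root (P : {poly C}) (u w : R -> C) : (1 < size P)%N -> elementary J w ->
  (forall x, inside J x -> analytic_at u x) ->
  (forall x, inside J x -> P.[u x] = w x) -> elementary J u.
Proof.
move=> sP /elementaryP[W [HW EW]] Au Pu; have [S SE] := elementary_closed.
apply/elementaryP; exists (mk_afun Au); split=> [x Jx|]; first by rewrite [RHS]cut_in.
set U := mk_afun Au.
pose phi : {rmorphism C -> {fraction afun J}} := @FracField.tofrac (afun J) \o afun_const J.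
pose Q := map_poly phi P - (W%:F)%:P.
have sQ : size Q = size P.
  by rewrite size_polyDl size_map_poly // size_polyN (leq_ltn_trans (size_polyC_leq1 _)).
apply: (@elementary_over_alg _ _ _ rational_subfield Q).
- by rewrite -size_poly_gt0 sQ; exact: ltnW.
- move=> i; rewrite coefB coef_map coefC /=; have [R1 _ _] := rational_subfield.
  apply/SE/rpredB; first by apply/SE/elementary_over_base/adjoin_base; exists P`_i.
  by case: (i == 0%N); [apply/SE | exact: rpred0].
- rewrite /root !hornerE; apply/eqP.
  rewrite (map_poly_comp (@FracField.tofrac _) (afun_const J)) horner_map -tofracB.
  rewrite -[RHS]tofrac0; congr (_%:F); apply/eqP; rewrite subr_eq0; apply/eqP.
  by apply: afunP => x Jx; rewrite -HW // -Pu // afun_hornerE // [U x]cut_in.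
Qed.

End MeromorphicDerivation.

(** * Restriction to a subinterval *)

Section Restriction.
Variables I J : ointerval.
Hypothesis sub : subinterval J I.

Definition restriction (F : afun I) : afun J :=
  mk_afun (fun x Jx => afun_analytic F (sub Jx)).

Lemma restrictionE F x : inside J x -> restriction F x = F x.
Proof. exact: cut_in. Qed.

Lemma restriction_zmod : zmod_morphism restriction.
Proof.
move=> F G; apply: afunP => x Jx; have Ix := sub Jx.
by rewrite restrictionE // !afun_addE // !afun_oppE // !restrictionE.
Qed.

Lemma restriction_monoid : monoid_morphism restriction.
Proof.
split=> [|F G]; apply: afunP => x Jx; have Ix := sub Jx; last first.
  by rewrite restrictionE // !afun_mulE // !restrictionE.
by rewrite restrictionE // [LHS]cut_in // [RHS]cut_in.
Qed.

HB.instance Definition _ :=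
  GRing.isZmodMorphism.Build (afun I) (afun J) restriction restriction_zmod.
HB.instance Definition _ :=
  GRing.isMonoidMorphism.Build (afun I) (afun J) restriction restriction_monoid.

(** Restriction is injective by the identity theorem, so it extends to quotients. *)
Lemma restriction_eq0 F : (restriction F == 0) = (F == 0).
Proof.
apply/eqP/eqP => [F0|->]; last exact: rmorph0.
have H x : inside J x -> F x = RtoC 0.
  by move=> Jx; rewrite -restrictionE // F0 [LHS]cut_in.
apply: afunP => x Ix; rewrite [RHS]cut_in // [F x]surjective_pairing; congr pair.
  apply: (vanishing_on_subinterval (F := fun y => fst (F y)) sub) Ix => [y Iy|y /H -> //].
  by have /analytic_at_components[] := afun_analytic F Iy.
apply: (vanishing_on_subinterval (F := fun y => snd (F y)) sub) Ix => [y Iy|y /H -> //].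
by have /analytic_at_components[] := afun_analytic F Iy.
Qed.

Lemma restriction_deriv F : restriction (afun_deriv F) = afun_deriv (restriction F).
Proof.
apply: afunP => x Jx; have Ix := sub Jx; rewrite restrictionE // !afun_derivE //.
by apply: (Dx_inside Jx) => y Jy; rewrite restrictionE.
Qed.

Definition frac_restriction (z : {fraction afun I}) : {fraction afun J} :=
  (restriction (\n_(repr z)))%:F / (restriction (\d_(repr z)))%:F.

Lemma frac_restrictionE p q : q != 0 ->
  frac_restriction (p%:F / q%:F) = (restriction p)%:F / (restriction q)%:F.
Proof.
move=> q0; rewrite /frac_restriction; set z := p%:F / q%:F.
set n := \n_(repr z); set d := \d_(repr z).
have d0 : d != 0 by exact: denom_ratioP.
have /eqP : n%:F / d%:F = z by rewrite -frac_repr.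
rewrite /z eqr_div ?tofrac_eq0 // -!tofracM tofrac_eq => /eqP E.
apply/eqP; rewrite eqr_div ?tofrac_eq0 ?restriction_eq0 // -!tofracM tofrac_eq.
by rewrite -!rmorphM E.
Qed.

Lemma frac_restriction_tofrac p : frac_restriction p%:F = (restriction p)%:F.
Proof.
have := frac_restrictionE p (oner_neq0 _).
by rewrite !rmorph1 !divr1.
Qed.

Lemma frac_restriction_zmod : zmod_morphism frac_restriction.
Proof.
move=> x y; have [p [q [q0 ->]]] := frac_ratio x; have [r [s [s0 ->]]] := frac_ratio y.
rewrite -mulNr addf_div ?tofrac_eq0 // mulNr -!tofracM -tofracB !frac_restrictionE ?mulf_neq0 //.
rewrite -[in RHS]mulNr addf_div ?tofrac_eq0 ?restriction_eq0 // mulNr.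
by rewrite !rmorphB !rmorphM.
Qed.

Lemma frac_restriction_monoid : monoid_morphism frac_restriction.
Proof.
split; first by rewrite -tofrac1 frac_restriction_tofrac rmorph1.
move=> x y; have [p [q [q0 ->]]] := frac_ratio x; have [r [s [s0 ->]]] := frac_ratio y.
by rewrite mulf_div -!tofracM !frac_restrictionE ?mulf_neq0 // mulf_div !rmorphM.
Qed.

HB.instance Definition _ := GRing.isZmodMorphism.Build {fraction afun I} {fraction afun J}
  frac_restriction frac_restriction_zmod.
HB.instance Definition _ := GRing.isMonoidMorphism.Build {fraction afun I} {fraction afun J}
  frac_restriction frac_restriction_monoid.

Lemma frac_restriction_deriv z :
  frac_restriction (mer_deriv z) = mer_deriv (frac_restriction z).
Proof.
have [p [q [q0 ->]]] := frac_ratio z.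
rewrite mer_derivE // !frac_restrictionE ?expf_neq0 // mer_derivE ?restriction_eq0 //.
by rewrite !rmorphB !rmorphXn !rmorphM /= !restriction_deriv.
Qed.

(** Restriction to a subinterval is an embedding of differential fields that preserves
   constants and the coordinate function, so it carries each elementary step to an
   elementary step. *)
Lemma elementary_over_restriction z :
  elementary_over (@mer_deriv I) (@rational_functions I) z ->
  elementary_over (@mer_deriv J) (@rational_functions J) (frac_restriction z).
Proof.
have [S SE] := elementary_closed J.
have SD x y : frac_restriction (x / y) = frac_restriction x / frac_restriction y.
  exact: fmorph_div.
pose Q z := elementary_over (@mer_deriv J) (@rational_functions J) (frac_restriction z).
move: z; apply: (@tower_ind_elementary _ _ _ Q); rewrite /Q.
- move=> z; elim=> [_ [c ->]||x y _ /SE Hx _ /SE Hy|x y _ /SE Hx _ /SE Hy].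
  + apply/elementary_over_base/adjoin_base; exists c.
    rewrite frac_restriction_tofrac; congr (_%:F); apply: afunP => x Jx.
    by rewrite restrictionE // !afun_constE //; exact: sub.
  + have -> : frac_restriction (afun_id I)%:F = (afun_id J)%:F.
      rewrite frac_restriction_tofrac; congr (_%:F); apply: afunP => x Jx.
      by rewrite restrictionE // !afun_idE //; exact: sub.
    exact/elementary_over_base/adjoin_gen.
  + by rewrite rmorphB; apply/SE; exact: rpredB.
  + by rewrite SD; apply/SE; exact: rpred_div.
- split; first by rewrite rmorph1; apply/SE/rpred1.
    by move=> x y /SE Hx /SE Hy; rewrite rmorphB; apply/SE; exact: rpredB.
  by move=> x y /SE Hx /SE Hy; rewrite SD; apply/SE; exact: rpred_div.
- move=> s g _ _ Hs Hg; apply: (elementary_over_exp Hs).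
  by rewrite -!frac_restriction_deriv Hg rmorphM.
- move=> s g _ _ Hs s0 Hg; apply: (elementary_over_log Hs).
    by rewrite fmorph_eq0.
  by rewrite -!frac_restriction_deriv Hg SD.
- move=> p g _ p0 _ Hp pg.
  apply: (@elementary_over_alg _ _ _ (rational_subfield J) (map_poly frac_restriction p)).
  + by rewrite map_poly_eq0.
  + by move=> i; rewrite coef_map.
  + exact: rmorph_root.
Qed.

Lemma elementary_restriction F : elementary I F -> elementary J F.
Proof.
move=> /elementaryP[G [HG EG]]; apply/elementaryP; exists (restriction G); split.
  by move=> x Jx; rewrite restrictionE // HG //; exact: sub.
by rewrite -frac_restriction_tofrac; exact: elementary_over_restriction.
Qed.

End Restriction.

(** * Elementary primitives *)

Definition elementary_primitive (I : ointerval) (w : R -> C) : Prop :=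
  exists F, elementary I F /\ forall x, inside I x -> has_deriv F x (w x).

Section Criteria.
Variables (I : ointerval) (x0 : R).
Hypothesis Ix0 : inside I x0.

Lemma has_deriv_sum n (F : 'I_n -> R -> C) (l : 'I_n -> C) x :
  (forall i, has_deriv (F i) x (l i)) ->
  has_deriv (fun y => \sum_(i < n) F i y) x (\sum_(i < n) l i).
Proof.
elim: n F l => [|n IH] F l HF.
  have -> : (fun y => \sum_(i < 0) F i y) = (fun=> 0) by apply: funext => y; rewrite big_ord0.
  by rewrite big_ord0; exact: has_deriv_const.
have -> : (fun y => \sum_(i < n.+1) F i y) =
    (fun y => F ord0 y + \sum_(i < n) F (lift ord0 i) y).
  by apply: funext => y; rewrite big_ord_recl.
by rewrite big_ord_recl; apply: has_deriv_plus => //; exact: IH.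
Qed.

(** The primitive is sum c_i L_i + sigma with L_i a primitive of h_i'/h_i. *)
Lemma liouville_primitive f1 gamma : liouville_criterion I f1 gamma ->
  elementary_primitive I (fun x => gamma x / f1 x).
Proof.
move=> [n [c [h [sigma [Hh Es E]]]]].
pose L i := integral (fun x => Dx (h i) x / h i x) x0.
have HL i x : inside I x -> has_deriv (L i) x (Dx (h i) x / h i x).
  have [Eh h0] := Hh i.
  move=> Ix; apply: (@integral_has_deriv I x0 Ix0 (fun y => Dx (h i) y / h i y)) Ix => y Iy.
  apply: analytic_Ccont; apply: analytic_mult.
    by apply: analytic_Dx; exact: elementary_analytic Eh Iy.
  by apply: analytic_inv; [exact: elementary_analytic Eh Iy | exact: h0].
exists (fun x => \sum_(i < n) c i * L i x + sigma x); split.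
  apply: elementary_plus => //; apply: elementary_sum => i.
  apply: elementary_mult; first exact: elementary_const.
  by have [Eh h0] := Hh i; apply: (elementary_logarithm Eh h0) => x; exact: HL.
move=> x Ix; rewrite E //; apply: has_deriv_plus; last first.
  by apply: analytic_has_deriv; exact: elementary_analytic Es Ix.
by apply: has_deriv_sum => i; apply: has_deriv_scal; exact: HL.
Qed.

(** The sum telescopes: the derivative of the i-th term is the difference of two
   consecutive boundary terms. *)
Lemma afun_deriv_by_parts (a b : afun I) p m : (m <= p.+1)%N ->
  afun_deriv (\sum_(i < m) (-1) ^+ i * (iter i (@afun_deriv I) a * iter (p - i) (@afun_deriv I) b))
  = a * iter p.+1 (@afun_deriv I) b
    - (-1) ^+ m * (iter m (@afun_deriv I) a * iter (p.+1 - m) (@afun_deriv I) b).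
Proof.
have D0 : afun_deriv (0 : afun I) = 0 by exact: afun_deriv_const.
have Dsign i (z : afun I) : afun_deriv ((-1) ^+ i * z) = (-1) ^+ i * afun_deriv z.
  by rewrite -signr_odd; case: odd; rewrite ?mulN1r ?mul1r // afun_derivN.
elim: m => [|m IH] Hm; first by rewrite big_ord0 expr0 mul1r subn0 subrr.
rewrite big_ord_recr /= afun_derivD IH; last exact: ltnW.
rewrite Dsign afun_derivM subSS subSn // exprS iterS [iter (p - m).+1 _ _]iterS.
move: (iter m _ a) (iter (p - m) _ b) => u v; ring.
Qed.

(** After p + 1 integrations by parts the remaining integrand is, up to sign, the
   derivative of S. *)
Lemma by_parts_primitive f1 gamma : by_parts_criterion I f1 gamma ->
  elementary_primitive I (fun x => gamma x / f1 x).
Proof.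
move=> [/elementaryP[a [Ha Ea]] [nu [S [p [_ /elementaryP[b [Hb Eb]] /elementaryP[s [Hs Es]] E]]]]].
pose F := \sum_(i < p.+1) (-1) ^+ i * (iter i (@afun_deriv I) a * iter (p - i) (@afun_deriv I) b)
  + (-1) ^+ p.+1 * s.
have Ds : afun_deriv s = iter p.+1 (@afun_deriv I) a * b.
  apply: afunP => x Ix; rewrite afun_mulE // -(iter_Dx_inside _ Ix Ha) -Hb //.
  by rewrite afun_derivE // -(Dx_inside Ix Hs); case: (E x Ix).
have DF : afun_deriv F = a * iter p.+1 (@afun_deriv I) b.
  rewrite /F afun_derivD afun_deriv_by_parts // subnn.
  have -> : afun_deriv ((-1) ^+ p.+1 * s) = (-1) ^+ p.+1 * afun_deriv s.
    by rewrite -signr_odd; case: odd; rewrite ?mulN1r ?mul1r // afun_derivN.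
  by rewrite Ds subrK.
exists F; split; last first.
  move=> x Ix; have -> : gamma x / f1 x = afun_deriv F x; last exact: afun_has_deriv.
  rewrite DF afun_mulE // -(iter_Dx_inside _ Ix Hb) -Ha //.
  by case: (E x Ix) => -> _; rewrite mul1r.
apply/elementaryP; exists F; split=> //.
have [S' SE] := elementary_closed I.
have Si n (c : afun I) : elementary_over (@mer_deriv I) (@rational_functions I) c%:F ->
    (iter n (@afun_deriv I) c)%:F \in S'.
  by move=> Ec; apply/SE; exact: elementary_iter_deriv.
apply/SE; rewrite /F rmorphD rmorph_sum; apply: rpredD.
  apply: rpred_sum => i _; rewrite !rmorphM rmorphXn rmorphN1.
  by apply: rpredM; [exact: rpredX (rpredN1 _) | apply: rpredM; exact: Si].
rewrite rmorphM rmorphXn rmorphN1; apply: rpredM; first exact: rpredX (rpredN1 _).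
exact/SE.
Qed.

Lemma elementary_integral w : (forall x, inside I x -> Ccont_at w x) ->
  elementary_primitive I w -> elementary I (integral w x0).
Proof.
move=> Cw [F [EF HF]].
apply: (elementary_ext _ (elementary_plus EF (elementary_const I (- F x0)))) => x Ix.
by rewrite (integral_antiderivative Ix0 Cw HF Ix).
Qed.

Lemma criterion_elementary f1 gamma :
  (forall x, inside I x -> Ccont_at (fun y => gamma y / f1 y) x) ->
  liouville_criterion I f1 gamma \/ by_parts_criterion I f1 gamma ->
  elementary I (integral (fun x => gamma x / f1 x) x0).
Proof.
move=> C [H|H]; apply: elementary_integral => //.
  exact: liouville_primitive.
exact: by_parts_primitive.
Qed.

End Criteria.

(** * Solutions of the linear equation *)

Section Chains.
Variables (I : ointerval) (k : nat) (f : nat -> R -> C).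

(** Here c m stands for the function f_m d/dx ... f_1 d/dx (c 0), and d m for its
   derivative. Exhibiting all of them makes the nested operator linear to handle. *)
Definition chain (c d : nat -> R -> C) (g : R -> C) : Prop :=
  forall x, inside I x ->
    [/\ forall m, (m < k)%N -> has_deriv (c m) x (d m x),
        forall m, (m.+1 < k)%N -> f m.+1 x * d m x = c m.+1 x &
        d k.-1 x = g x].

Lemma chain_zero : chain (fun _ _ => 0) (fun _ _ => 0) (fun=> 0).
Proof.
move=> x Ix; split=> // m Hm; last by rewrite mulr0.
exact: has_deriv_const.
Qed.

Lemma chain_linear a c d g c' d' g' : chain c d g -> chain c' d' g' ->
  chain (fun m x => a * c m x + c' m x) (fun m x => a * d m x + d' m x)
        (fun x => a * g x + g' x).
Proof.
move=> H H' x Ix; have [H1 H2 H3] := H x Ix; have [H1' H2' H3'] := H' x Ix; split=> [m Hm|m Hm|].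
- by apply: has_deriv_plus; [apply: has_deriv_scal; exact: H1 | exact: H1'].
- by rewrite mulrDr mulrCA H2 // H2'.
- by rewrite H3 H3'.
Qed.

Lemma chain_sum n (a : 'I_n -> C) (c d : 'I_n -> nat -> R -> C) (g : 'I_n -> R -> C) :
  (forall i, chain (c i) (d i) (g i)) ->
  chain (fun m x => \sum_(i < n) a i * c i m x) (fun m x => \sum_(i < n) a i * d i m x)
        (fun x => \sum_(i < n) a i * g i x).
Proof.
elim: n a c d g => [|n IH] a c d g H.
  have -> : (fun (m : nat) (x : R) => \sum_(i < 0) a i * c i m x) = (fun _ _ => 0).
    by do 2 apply: funext => ?; rewrite big_ord0.
  have -> : (fun (m : nat) (x : R) => \sum_(i < 0) a i * d i m x) = (fun _ _ => 0).
    by do 2 apply: funext => ?; rewrite big_ord0.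
  have -> : (fun (x : R) => \sum_(i < 0) a i * g i x) = (fun=> 0).
    by apply: funext => ?; rewrite big_ord0.
  exact: chain_zero.
have H1 := chain_linear (a ord0) (H ord0) (IH _ _ _ _ (fun i => H (lift ord0 i))).
move: (H1 (fun i => a (lift ord0 i))).
have E (h : 'I_n.+1 -> nat -> R -> C) : (fun m x => \sum_(i < n.+1) a i * h i m x) =
   (fun m x => a ord0 * h ord0 m x + \sum_(i < n) a (lift ord0 i) * h (lift ord0 i) m x).
  by do 2 apply: funext => ?; rewrite big_ord_recl.
rewrite !E; congr chain.
by apply: funext => ?; rewrite big_ord_recl.
Qed.

Lemma chain_nested c d g (J : ointerval) w m x : chain c d g -> subinterval J I ->
  (forall y, inside J y -> w y = c 0%N y) -> (m < k)%N -> inside J x ->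
  nested_deriv f m w x = c m x.
Proof.
move=> H sub Hw; elim: m x => [|m IH] x Hm Jx; first exact: Hw.
have [H1 H2 _] := H x (sub x Jx); rewrite /= -H2 //.
rewrite (Dx_inside Jx (G := c m)) => [|y Jy]; last by apply: IH => //; exact: ltnW.
by rewrite (has_deriv_Dx (H1 _ (ltnW Hm))).
Qed.

Lemma chain_solves c d g (J : ointerval) w : (0 < k)%N -> chain c d g -> subinterval J I ->
  (forall y, inside J y -> w y = c 0%N y) -> solves_on J k f g w.
Proof.
move=> k0 H sub Hw x Jx; have [H1 _ H3] := H x (sub x Jx).
have D m : (m < k)%N -> has_deriv (nested_deriv f m w) x (d m x).
  move=> Hm; apply: (has_deriv_inside Jx _ (H1 m Hm)) => y Jy.
  by rewrite (chain_nested H sub Hw).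
split=> [m Hm|]; first exact: has_deriv_differentiable (D m Hm).
by rewrite -H3; apply: has_deriv_Dx; apply: D; rewrite prednK.
Qed.

End Chains.

Section Solutions.
Variables (T : Type) (I : ointerval) (x0 : R) (k : nat) (f : nat -> R -> C).
Hypotheses (Ix0 : inside I x0)
  (hf : forall i, (1 <= i <= k - 1)%N ->
      smooth_on I (f i) /\ forall x, inside I x -> f i x <> 0).

Lemma coef_neq0 i x : (1 <= i <= k - 1)%N -> inside I x -> f i x != 0.
Proof. by move=> Hi Ix; apply/eqP; exact: (proj2 (hf Hi)). Qed.

Lemma differentiable_Ccont F x : differentiable_at F x -> Ccont_at F x.
Proof. by move=> /has_derivP; exact: has_deriv_Ccont. Qed.

Lemma Ccont_div_coef i w x : (1 <= i <= k - 1)%N -> inside I x -> Ccont_at w x ->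
  Ccont_at (fun y => w y / f i y) x.
Proof.
move=> Hi Ix Cw; apply: Ccont_mult => //; apply: Ccont_inv; last exact: (proj2 (hf Hi)).
exact/differentiable_Ccont/(proj1 (hf Hi) 0%N).
Qed.

Lemma iterated_integral_has_deriv i m x : (1 <= i)%N -> (i + m < k)%N -> inside I x ->
  has_deriv (iterated_integral f x0 i m.+1) x (iterated_integral f x0 i.+1 m x / f i x).
Proof.
elim: m i x => [|m IH] i x i1 Hi Ix;
  apply: (integral_has_deriv Ix0
    (G := fun s => iterated_integral f x0 i.+1 _ s / f i s)) => // y Iy;
  apply: Ccont_div_coef => //; try lia.
  exact: has_deriv_Ccont (has_deriv_const 1 y).
by apply: has_deriv_Ccont; apply: IH => //; lia.
Qed.

(** Each derivation removes the outermost integral; after j of them the constant f(t) is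
   left. *)
Lemma V_chain (ft : T -> C) t j : (1 <= j <= k - 1)%N ->
  chain I k f
    (fun m x => if (m <= j)%N then ft t * iterated_integral f x0 m.+1 (j - m) x else 0)
    (fun m x => if (m < j)%N
      then ft t * (iterated_integral f x0 m.+2 (j - m.+1) x / f m.+1 x) else 0)
    (fun=> 0).
Proof.
move=> Hj x Ix; split=> [m Hm|m Hm|]; last by rewrite ltnNge (_ : (j <= k.-1)%N) //; lia.
- case: (ltngtP m j) => Hmj; last first.
  + by rewrite Hmj subnn; exact: (has_deriv_const (ft t * 1)).
  + exact: has_deriv_const.
  + apply: has_deriv_scal; have -> : (j - m = (j - m.+1).+1)%N by lia.
    by apply: iterated_integral_has_deriv => //; lia.
- case: ifP => Hmj; last by rewrite mulr0.
  by rewrite mulrCA [_ / _]mulrC mulVKf //; apply: coef_neq0 => //; lia.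
Qed.

Variables (g G Rbar : R -> T -> C) (gbar : nat -> R -> T -> C).
Hypothesis k4 : (4 <= k)%N.
Hypothesis hpart : particular_data I k f g G Rbar gbar.

Definition Vbar_derivs t (m : nat) : R -> C :=
  if m == 0%N then (fun x => Vbar f x0 gbar x t)
  else if (m <= k - 3)%N then (fun x => gbar m.+1 x t)
  else if m == (k - 2)%N then (fun x => Rbar x t) else (fun x => G x t).

Lemma gbar2_Ccont t x : inside I x -> Ccont_at (fun y => gbar 2%N y t) x.
Proof.
move=> Ix; apply: differentiable_Ccont; have [_ _ H3 H4] := hpart t.
have [k3|k3] : (2 <= k - 3)%N \/ k = 4 by lia.
  by have [] := H4 2%N k3 x Ix.
by move: H3; rewrite k3 => /(_ x Ix) [].
Qed.

Lemma Vbar_chain t : chain I k f (Vbar_derivs t)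
  (fun m => if m == 0%N then (fun x => gbar 2%N x t / f 1%N x) else Dx (Vbar_derivs t m))
  (fun x => g x t).
Proof.
move=> x Ix; have [H1 H2 H3 H4] := hpart t.
split=> [m Hm|m Hm|].
- have [->|m0] := eqVneq m 0%N.
    apply: (integral_has_deriv Ix0 (G := fun s => gbar 2%N s t / f 1%N s)) => // y Iy.
    by apply: Ccont_div_coef => //; [lia | exact: gbar2_Ccont].
  apply/has_derivP; rewrite /Vbar_derivs (negbTE m0).
  case: ifP => Hm3.
    have [k3|k3] : (m.+1 <= k - 3)%N \/ (m.+1 = k - 2)%N by lia.
      by have [] := H4 m.+1 ltac:(lia) x Ix.
    by rewrite k3; have [] := H3 x Ix.
  by case: ifP => Hm2; [have [] := H2 x Ix | have [] := H1 x Ix].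
- have [->|m0] := eqVneq m 0%N.
    rewrite mulrC divfK; last by apply: coef_neq0 => //; lia.
    by rewrite /Vbar_derivs /= (_ : (1 <= k - 3)%N) //; lia.
  rewrite /Vbar_derivs (negbTE m0) /=.
  have [c|[c|c]] : (m.+1 <= k - 3)%N \/ (m.+1 = k - 2)%N \/ (m.+1 = k - 1)%N by lia.
  + rewrite c (_ : (m <= k - 3)%N); last lia.
    by have [] := H4 m.+1 ltac:(lia) x Ix.
  + rewrite (_ : (m <= k - 3)%N); last lia.
    rewrite (_ : (m.+1 <= k - 3)%N = false); last lia.
    by rewrite c eqxx; have [] := H3 x Ix.
  + rewrite (_ : (m <= k - 3)%N = false); last lia.
    rewrite (_ : (m == k - 2)%N); last lia.
    rewrite (_ : (m.+1 <= k - 3)%N = false); last lia.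
    rewrite (_ : (m.+1 == k - 2)%N = false); last lia.
    by rewrite c; have [] := H2 x Ix.
- rewrite (_ : (k.-1 == 0)%N = false); last lia.
  rewrite /Vbar_derivs (_ : (k.-1 == 0)%N = false); last lia.
  rewrite (_ : (k.-1 <= k - 3)%N = false); last lia.
  rewrite (_ : (k.-1 == k - 2)%N = false); last lia.
  by have [_] := H1 x Ix; rewrite mul1r.
Qed.

End Solutions.

Lemma V_iterated (T : Type) (f : nat -> R -> C) (ft : T -> C) x0 j x t : (1 <= j)%N ->
  V f ft x0 j x t = ft t * iterated_integral f x0 1 j x.
Proof. by case: j. Qed.

Theorem proposition5p15 (T : Type) (k : nat) (I : ointerval) (x0 : R)
    (f : nat -> R -> C) (ft : T -> C) (g G Rbar : R -> T -> C)
    (gbar : nat -> R -> T -> C) (P : {poly C})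
    (k2 : nat) (j : 'I_k2 -> nat)
    (hk : (4 <= k)%N)
    (hx0 : inside I x0)
    (hf : forall i, (1 <= i <= k - 1)%N ->
      smooth_on I (f i) /\ forall x, inside I x -> f i x <> 0)
    (hg : forall t, smooth_on I (fun x => g x t))
    (hpart : particular_data I k f g G Rbar gbar)
    (hP : (2 < size P)%N)
    (hk2 : (k2 <= k - 1)%N)
    (hj : injective j)
    (hj_range : forall s, (1 <= j s <= k - 1)%N)
    (hV : forall s,
      liouville_criterion I (f 1%N) (g2 f x0 (j s)) \/
      by_parts_criterion I (f 1%N) (g2 f x0 (j s)))
    (hVbar :
      (forall t, liouville_criterion I (f 1%N) (fun x => gbar 2%N x t)) \/
      (forall t, by_parts_criterion I (f 1%N) (fun x => gbar 2%N x t)))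
    (hrad : solvable_by_radicals (generic_level P)) :
  exists B : C, forall A : 'I_k2 -> C,
    let W x t := \sum_(s < k2) A s * V f ft x0 (j s) x t + B * Vbar f x0 gbar x t in
    (forall (Omega : C -> Prop) (alpha : C -> C), root_branch P Omega alpha ->
      forall (t : T) (J : ointerval), subinterval J I ->
      (forall x, inside J x -> Omega (W x t)) ->
      let u x := alpha (W x t) in
      elementary J u /\ solves_on J k f (fun x => g x t) (fun x => P.[u x])) /\
    (forall (t : T) (x : R) (z : C), inside I x ->
      P.[z] = W x t -> (P^`()).[z] <> 0 ->
      exists (Omega : C -> Prop) (alpha : C -> C) (J : ointerval),
        [/\ root_branch P Omega alpha, subinterval J I, inside J x,
            forall y, inside J y -> Omega (W y t) & alpha (W x t) = z]).
Proof.
exists 1 => A W.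
have f1 : (1 <= 1 <= k - 1)%N by lia.
have EV s t : elementary I (fun x => V f ft x0 (j s) x t).
  apply: elementary_mult; first exact: elementary_const.
  apply: (criterion_elementary hx0 _ (hV s)) => y Iy.
  apply: (Ccont_div_coef hf) => //; rewrite /g2.
  have := hj_range s; case: (j s) => [|[|m]] Hm //.
    exact: has_deriv_Ccont (has_deriv_const 1 y).
  by apply: has_deriv_Ccont; apply: (iterated_integral_has_deriv hx0 hf) => //=; lia.
have EVb t : elementary I (fun x => Vbar f x0 gbar x t).
  apply: (criterion_elementary hx0) => [y Iy|].
    by apply: (Ccont_div_coef hf) => //; exact: (gbar2_Ccont hk hpart).
  by case: hVbar => H; [left | right].
have EW t : elementary I (fun x => W x t).
  apply: elementary_plus; last by apply: elementary_mult (EVb t); exact: elementary_const.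
  by apply: elementary_sum => s; apply: elementary_mult (EV s t); exact: elementary_const.
have AW t x : inside I x -> analytic_at (fun y => W y t) x.
  by move=> Ix; exact: elementary_analytic (EW t) Ix.
split=> [Omega alpha [OO Oa] t J sub HO u|t x z Ix Pz P'z].
  have Pu x : inside J x -> P.[u x] = W x t.
    by move=> Jx; exact: (proj2 (Oa _ (HO x Jx))).
  split; last first.
    have Hc := chain_linear 1 (Vbar_chain hx0 hf hk hpart t)
      (chain_sum A (fun s => V_chain hx0 hf ft t (hj_range s))).
    have Eg : (fun x : R => 1 * g x t + \sum_(i < k2) A i * (fun=> 0) x) = (fun x => g x t).
      by apply: funext => x; rewrite mul1r big1 ?addr0 // => i _; rewrite mulr0.
    rewrite Eg in Hc.
    apply: (chain_solves _ Hc sub) => [|y Jy]; first lia.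
    rewrite Pu // /W [RHS]addrC /=; congr (_ + _); apply: eq_bigr => s _.
    by rewrite V_iterated ?subn0 //; have /andP[] := hj_range s.
  apply: (elementary_root (P := P) (w := fun x => W x t)) => //; first exact: ltnW.
    by apply: elementary_restriction (EW t).
  move=> x Jx; apply: (analytic_root (P := P) (w := fun y => W y t)).
  - by apply: AW; exact: sub.
  - have [L [r [L0 r0 HL]]] := C_ex_derive_lipschitz (proj1 (Oa _ (HO x Jx))).
    have CW := analytic_Ccont (AW t x (sub x Jx)).
    exact: Ccont_comp_lipschitz CW L0 r0 HL.
  - apply: (eventually_impl Pu); exact: inside_eventually.
  - exact: (root_branch_deriv_neq0 (conj OO Oa) (HO x Jx)).
have [Omega [alpha [Hb Oz az]]] := local_root_branch P'z.
have [OO Oa] := Hb; rewrite Pz in Oz az.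
have CW := analytic_Ccont (AW t x Ix).
have [r [r0 Hr]] := open_C_near OO Oz.
have [d [d0 Hd]] := eventually_and (inside_eventually Ix) (CW r r0).
have [J [HJ Jx]] := small_interval x d0.
exists Omega, alpha, J; split=> // y /HJ /Hd [] //.
by move=> _; exact: Hr.
Qed.
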